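(* Let $k>\ell\ge 0$ be integers and $\mathcal F$ a family of $k$-graphs. Then $\gamma_\ell(\mathcal F)$ is the maximum of $\delta_\ell(W)$ over all $\mathcal F$-free $k$-hypergraphons $W$. Moreover, a $k$-hypergraphon $W$ belongs to $\mathcal W_\ell(\mathcal F)$ if and only if $W$ is $\mathcal F$-free and $\delta_\ell(W)=\gamma_\ell(\mathcal F)$.
   Context: A $k$-graph $G$ is a pair $(V(G),E(G))$ with $E(G)$ a set of $k$-subsets of the finite set $V(G)$; $\deg_L(G)$ is the number of edges containing $L$. The minimum $\ell$-degree is $\delta_\ell(G):=\min\{\deg_L(G): L\subseteq V(G),|L|=\ell\}$. $G$ is $\mathcal F$-free if it contains no member of $\mathcal F$ as a subgraph. $\mathrm{co\text{-}ex}_\ell(n,\mathcal F)$ is the maximum $m$ such that some $\mathcal F$-free $k$-graph $G$ on $n$ vertices has $\deg_L(G)\ge m$ for every $\ell$-subset $L$ of $V(G)$, and $\gamma_\ell(\mathcal F):=\lim_{n\to\infty}\mathrm{co\text{-}ex}_\ell(n,\mathcal F)/\binom{n-\ell}{k-\ell}$ (this limit is known to exist). For a finite set $A$, $\binom{A}{\le m}$ is the family of nonempty subsets of $A$ of size at most $m$; $r(A)$ denotes all nonempty subsets and $r_<(A)$ all nonempty proper subsets of $A$; $r[m]:=r([m])$, $r_<[m]:=r_<([m])$. For a vector $\mathbf x=(x_B)_B$, $\mathbf x_{\mathcal A}$ is its restriction to indices in $\mathcal A$. A $k$-hypergraphon is a measurable $W:[0,1]^{r_<[k]}\to[0,1]$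 invariant under the natural action of permutations of $[k]$ on the coordinates. For a $k$-graph $F$, $t(F,W):=\int_{[0,1]^{\binom{V(F)}{\le k-1}}}\prod_{A\in E(F)}W(\mathbf x_{r_<(A)})\,d\mathbf x$; $W$ is $\mathcal F$-free if $t(F,W)=0$ for all $F\in\mathcal F$. For a $k$-graph $G$, $t(F,G)$ is the probability that a uniformly random map $V(F)\to V(G)$ sends every edge of $F$ to an edge of $G$; $(G_n)$ converges to $W$ if $t(F,G_n)\to t(F,W)$ for every $k$-graph $F$. For $\mathbf x\in[0,1]^{r[\ell]}$, $\deg_W(\mathbf x):=\int_{[0,1]^{r_<[k]\setminus r[\ell]}}W(\mathbf x_{r_<[k]})\,d\mathbf x_{r_<[k]\setminus r[\ell]}$ (set to $0$ where undefined), and $\delta_\ell(W)$ is the essential infimum of $\deg_W(\mathbf x)$ over $\mathbf x\in[0,1]^{r[\ell]}$. $\mathcal W_\ell(\mathcal F)$ is the set of $k$-hypergraphons $W$ for which there is a sequence $(G_n)$ of $\mathcal F$-free $k$-graphs converging to $W$ with $|V(G_n)|\to\infty$ and $\delta_\ell(G_n)=(\gamma_\ell(\mathcal F)+o(1))\binom{|V(G_n)|-\ell}{k-\ell}$. *)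

(* Defs.v *)
From HB Require Import structures.
From mathcomp Require Import all_boot all_order all_algebra all_fingroup.
From mathcomp Require Import all_classical all_reals all_analysis.
Set Implicit Arguments. Unset Strict Implicit. Unset Printing Implicit Defensive.
Import Order.TTheory GRing.Theory Num.Theory.
Import numFieldNormedType.Exports.
Local Open Scope classical_set_scope.
Local Open Scope ring_scope.

(* k-graphs.  A k-graph is given on the vertex set 'I_(nv G) = {0,...,n-1}   *)
(* (all notions involved are invariant under relabelling of vertices).      *)
Record kgraph (k : nat) := KGraph {
  nv : nat;
  edges : {set {set 'I_nv}};
  edges_size : [forall e in edges, #|e| == k] }.

Definition kdeg k (G : kgraph k) (L : {set 'I_(nv G)}) : nat :=
  #|[set e in edges G | L \subset e]|.

(* delta_l(G) : minimum of deg_L(G) over l-subsets L (the default #|E(G)|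
   is an upper bound for every deg_L, so it only matters when there is no
   l-subset, i.e. |V(G)| < l). *)
Definition kmindeg k (l : nat) (G : kgraph k) : nat :=
  \big[minn/#|edges G|]_(L : {set 'I_(nv G)} | #|L| == l) kdeg L.

Definition subgraph_of k (F G : kgraph k) : Prop :=
  exists f : 'I_(nv F) -> 'I_(nv G),
    injective f /\ forall e, e \in edges F -> f @: e \in edges G.

Definition kfree k (Fam : set (kgraph k)) (G : kgraph k) : Prop :=
  forall F, Fam F -> ~ subgraph_of F G.

Definition coex_feasible k (l : nat) (Fam : set (kgraph k)) (n m : nat) : Prop :=
  exists G : kgraph k, [/\ nv G = n, kfree Fam G &
    forall L : {set 'I_(nv G)}, #|L| = l -> (m <= kdeg L)%N].

(* co-ex_l(n, Fam): the maximum feasible m.  For n >= l every deg_L is at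
   most 'C(n-l, k-l), so the bounded max below is the true maximum. *)
Definition coex k (l : nat) (Fam : set (kgraph k)) (n : nat) : nat :=
  (\max_(m < ('C(n - l, k - l)).+1 | `[< coex_feasible l Fam n m >]) m)%N.

Section Analytic.
Variable R : realType.

Definition gamma k (l : nat) (Fam : set (kgraph k)) : R :=
  limn (fun n : nat => (coex l Fam n)%:R / ('C((n - l)%N, (k - l)%N))%:R : R).

(* Integration over cubes [0,1]^I (I finite), as iterated Lebesgue integrals *)
(* over [0,1]; for the (jointly measurable, nonnegative) integrands used     *)
(* below this is the integral w.r.t. the product Lebesgue measure (Tonelli). *)
Fixpoint iint (I : eqType) (f : (I -> R) -> \bar R) (s : seq I) (x : I -> R)
  : \bar R :=
  match s with
  | [::] => f x
  | i :: s' =>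
      (\int[@lebesgue_measure R]_(t in [set t : R | (0 <= t <= 1)%R])
          iint f s' (fun j => if j == i then t else x j))%E
  end.

Definition coord_gen (I : Type) : set (set (I -> R)) :=
  [set S | exists i : I, exists A : set R,
     measurable A /\ S = (fun x : I -> R => x i) @^-1` A].

Definition prod_measurable (I : Type) (S : set (I -> R)) : Prop :=
  <<s @coord_gen I >> S.

Definition rltP (k : nat) (B : {set 'I_k}) : bool :=
  (B != finset.set0) && (B != finset.setT).
Definition rlt (k : nat) := {B : {set 'I_k} | rltP B}.

Definition hypergraphon (k : nat) (W : (rlt k -> R) -> R) : Prop :=
  [/\ forall B : set R, measurable B -> prod_measurable (W @^-1` B),
      forall x, 0 <= W x <= 1 &
      forall (s : 'S_k) (x y : rlt k -> R),
        (forall B C : rlt k, val C = s @: val B -> y C = x B) -> W y = W x].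

(* image of B ⊆ [k] under the order isomorphism [k] -> A (|A| = k) *)
Definition edge_img (n k : nat) (A : {set 'I_n}) (B : {set 'I_k}) : {set 'I_n} :=
  [set v in A | [exists i in B, val i == index v (enum A)]].

Definition coordF (k n : nat) : {set {set 'I_n}} :=
  [set S : {set 'I_n} | (S != finset.set0) && (#|S| <= k.-1)%N].

Definition tW k (F : kgraph k) (W : (rlt k -> R) -> R) : R :=
  fine (iint (fun x : {set 'I_(nv F)} -> R =>
           (\prod_(A in edges F) W (fun B : rlt k => x (edge_img A (val B))))%:E)
         (enum (coordF k (nv F))) (fun _ => 0)).

Definition tG k (F G : kgraph k) : R :=
  (#|[set f : {ffun 'I_(nv F) -> 'I_(nv G)} |
        [forall A in edges F, f @: A \in edges G]]|)%:R
  / ((nv G) ^ (nv F))%:R.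

Definition Wfree k (Fam : set (kgraph k)) (W : (rlt k -> R) -> R) : Prop :=
  forall F, Fam F -> tW F W = 0.

Definition lowset (k l : nat) : {set rlt k} :=
  [set B : rlt k | [forall i in val B, (i < l)%N]].

Definition degW k (l : nat) (W : (rlt k -> R) -> R) (x : rlt k -> R) : \bar R :=
  iint (fun y => (W y)%:E) (enum (~: lowset k l)) x.

(* delta_l(W): essential infimum of deg_W over [0,1]^{r[l]} (Lebesgue) *)
Definition mindegW k (l : nat) (W : (rlt k -> R) -> R) : \bar R :=
  ereal_sup [set y : \bar R |
    iint (fun x => (((degW l W x < y)%E : bool)%:R : R)%:E)
         (enum (lowset k l)) (fun _ => 0) = 0%E].

Definition converges k (Gs : nat -> kgraph k) (W : (rlt k -> R) -> R) : Prop :=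
  forall F : kgraph k, (fun n => tG F (Gs n)) @ \oo --> tW F W.

Definition Wl k (l : nat) (Fam : set (kgraph k)) (W : (rlt k -> R) -> R) : Prop :=
  hypergraphon W /\
  exists Gs : nat -> kgraph k,
    [/\ forall n, kfree Fam (Gs n),
        converges Gs W,
        forall M : nat, \forall n \near \oo, (M <= nv (Gs n))%N &
        (fun n => (kmindeg l (Gs n))%:R / ('C((nv (Gs n) - l)%N, (k - l)%N))%:R : R)
          @ \oo --> gamma l Fam].

End Analytic.

(* Main.v *)
Require Import Defs.
From HB Require Import structures.
From mathcomp Require Import all_boot all_order all_algebra all_fingroup.
From mathcomp Require Import all_classical all_reals all_analysis.
From mathcomp Require Import ring lra zify measurable_realfun.
Set Implicit Arguments. Unset Strict Implicit. Unset Printing Implicit Defensive.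
Import Order.TTheory GRing.Theory Num.Theory.
Import numFieldNormedType.Exports.
Local Open Scope classical_set_scope.
Local Open Scope ring_scope.

(* Two constructions link hypergraphs and hypergraphons.

   Compactness (Aldous-Hoover).  An ultralimit of the laws of uniform samples from the G_n is
   an exchangeable random array.  Keep half of the sampled vertices as a reservoir and colour
   each set A of the other ones by its adjacencies to all finite sets of the reservoir.  By
   exchangeability and Pythagoras, the conditional law of the colour of A given finitely many
   bits of the colours of its proper subsets converges as the number of bits grows; coding
   the limit law by one uniform variable per set A gives a hypergraphon in coordinates
   x_B, B a subset of [k], with an extra coordinate for the empty set, which is finally fixed
   at a typical value.  The density of p edges sharing their first l vertices is the p-th
   moment of the degree, so lower bounds on the minimum degree survive in the limit.

   Sampling.  In the random hypergraph on n vertices with edges {A : x_A < W(x_B, B < A)} the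
   normalised degree of an l-set is an average of conditionally independent blocks; its
   centred moment of order 2l + 2 is O(n^(-l-1)), which beats the union bound over the n^l
   sets L.  Densities are controlled by second moments, and F-copies occur with probability
   t(F, W) = 0.

   Hence gamma is the supremum of the minimum degrees of F-free hypergraphons: sampling gives
   the lower bound on the liminf of the codegree densities, compactness the upper bound on
   the limsup, and also that the supremum is attained. *)

(** * Integration over finite cubes *)

(** The ultralimit is only a finitely additive mean, so conditioning is restricted to finite
    partitions: bounded energies give an L1 error for stopping at finitely many bits, and pointwise
    limits are taken only in the cube, where the integral is countably additive. The reservoir is
    what makes finite conditioning enough. Moving the sample vertices outside [A] into it leaves [A]
    and its subsets alone and turns each colour bit of a set not containing [A] into a colour bit of
    a proper subset of [A]. Hence, given enough bits below, the colours of the sets of one size are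
    nearly independent, and the array can be rebuilt one size at a time from fresh uniform
    variables. The coordinate of the empty set carries whatever global randomness the limit law has.
    Densities and moments are averages over it; as there are countably many [k]-graphs, the
    vanishing densities and the degree bound hold together at almost every value of it. *)

Section CubeIntegral.
Variable R : realType.
Implicit Types (I : finType).

Definition mu01 : probability (measurableTypeR R) R := uniform_prob (@ltr01 R).

Lemma mu01T : mu01 setT = 1%E. Proof. exact: probability_setT. Qed.

(** Turns the generators of [prod_measurable] into a measurable type, so that the general results on
    measurable functions apply to hypergraphons. *)
Definition cube (I : Type) := g_sigma_algebraType (@coord_gen R I).

Definition upd (I : eqType) (i : I) (t : R) (x : I -> R) : I -> R :=
  fun j => if j == i then t else x j.

Lemma mu01_cst (c : R) : \int[mu01]_t c = c.
Proof.
have -> : \int[mu01]_t c = c * fine (mu01 setT) by exact: Rintegral_cst.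
by rewrite mu01T mulr1.
Qed.

Lemma measurable_coord (I : Type) (i : I) :
  measurable_fun setT ((fun x => x i) : cube I -> R).
Proof.
move=> _ A mA; rewrite setTI; apply: sub_sigma_algebra.
by exists i, A.
Qed.

Lemma measurable_to_cube (I : Type) d (T : measurableType d) (f : T -> cube I) :
  (forall i, measurable_fun setT (fun t => f t i)) -> measurable_fun setT f.
Proof.
move=> mf; apply: (@measurability _ _ T (cube I) setT f (@coord_gen R I)) => //.
move=> _ [_ [i [A [mA ->]]] <-].
rewrite setTI -comp_preimage -[X in measurable X]setTI.
exact: mf.
Qed.

Lemma measurable_upd (I : eqType) (i : I) :
  measurable_fun setT ((fun p => upd i p.2 p.1) : cube I * R -> cube I).
Proof.
apply: measurable_to_cube => j; rewrite /upd; case: (j == i).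
  exact: measurable_snd.
exact: (measurableT_comp (measurable_coord j) measurable_fst).
Qed.

Lemma measurable_updx (I : eqType) (i : I) (x : I -> R) :
  measurable_fun setT ((fun t => upd i t x) : R -> cube I).
Proof.
apply: measurable_to_cube => j; rewrite /upd; case: (j == i) => //.
Qed.

(** The bound holds on the whole space and not only on the unit cube, so every one-coordinate slice
    is integrable against [mu01], whatever the other coordinates are. *)
Definition bmf (I : Type) (f : (I -> R) -> R) : Prop :=
  measurable_fun setT (f : cube I -> R) /\ exists C, forall x, `|f x| <= C.

Definition bm1 (f : R -> R) : Prop :=
  measurable_fun setT f /\ exists C, forall x, `|f x| <= C.

Lemma bm1_integrable (f : R -> R) : bm1 f -> mu01.-integrable setT (EFin \o f).
Proof.
case=> mf [C bC]; apply: measurable_bounded_integrable => //.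
  by apply: (@le_lt_trans _ _ 1%E); [rewrite -mu01T | exact: ltry].
exists C; split; first exact: num_real.
by move=> y Cy x _; exact: le_trans (bC x) (ltW Cy).
Qed.

Lemma bmf_slice I (i : I) f x : bmf f -> bm1 (fun t => f (upd i t x)).
Proof.
case=> mf [C bC]; split; last by exists C => t; exact: bC.
exact: (measurableT_comp mf (measurable_updx i x)).
Qed.

Definition Uint (I : eqType) (i : I) (f : (I -> R) -> R) : (I -> R) -> R :=
  fun x => \int[mu01]_t f (upd i t x).

Lemma bmf_cst (I : Type) c : bmf (fun _ : I -> R => c).
Proof. by split; [exact: measurable_cst | exists `|c|]. Qed.

Lemma bmfD (I : Type) (f g : (I -> R) -> R) :
  bmf f -> bmf g -> bmf (fun x => f x + g x).
Proof.
case=> mf [C bC] [mg [D bD]]; split; first exact: measurable_funD.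
exists (C + D) => x; exact: le_trans (ler_normD _ _) (lerD _ _).
Qed.

Lemma bmfN (I : Type) (f : (I -> R) -> R) : bmf f -> bmf (fun x => - f x).
Proof.
case=> mf [C bC]; split; first exact: measurableT_comp.
by exists C => x; rewrite normrN.
Qed.

Lemma bmfB (I : Type) (f g : (I -> R) -> R) :
  bmf f -> bmf g -> bmf (fun x => f x - g x).
Proof. by move=> bf bg; apply: bmfD => //; exact: bmfN. Qed.

Lemma bmfM (I : Type) (f g : (I -> R) -> R) :
  bmf f -> bmf g -> bmf (fun x => f x * g x).
Proof.
case=> mf [C bC] [mg [D bD]]; split; first exact: measurable_funM.
exists (C * D) => x; rewrite normrM; exact: ler_pM.
Qed.

Lemma bmf_norm (I : Type) (f : (I -> R) -> R) : bmf f -> bmf (fun x => `|f x|).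
Proof.
case=> mf [C bC]; split; first exact: measurableT_comp.
by exists C => x; rewrite normr_id.
Qed.

Lemma bmfX (I : Type) (f : (I -> R) -> R) n : bmf f -> bmf (fun x => f x ^+ n).
Proof.
move=> bf; elim: n => [|n IH].
  by under eq_fun do rewrite expr0; exact: bmf_cst.
by under eq_fun do rewrite exprS; exact: bmfM.
Qed.

Lemma bmf_sum (I J : Type) (s : seq J) (P : pred J) (f : J -> (I -> R) -> R) :
  (forall j, P j -> bmf (f j)) -> bmf (fun x => \sum_(j <- s | P j) f j x).
Proof.
move=> bf; elim: s => [|j s IH].
  by under eq_fun do rewrite big_nil; exact: bmf_cst.
case Pj : (P j).
  by under eq_fun do rewrite big_cons Pj; apply: bmfD => //; exact: bf.
by under eq_fun do rewrite big_cons Pj.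
Qed.

Lemma bmf_prod (I J : Type) (s : seq J) (P : pred J) (f : J -> (I -> R) -> R) :
  (forall j, P j -> bmf (f j)) -> bmf (fun x => \prod_(j <- s | P j) f j x).
Proof.
move=> bf; elim: s => [|j s IH].
  by under eq_fun do rewrite big_nil; exact: bmf_cst.
case Pj : (P j).
  by under eq_fun do rewrite big_cons Pj; apply: bmfM => //; exact: bf.
by under eq_fun do rewrite big_cons Pj.
Qed.

Lemma bmf_lt (I : Type) (f g : (I -> R) -> R) :
  measurable_fun setT (f : cube I -> R) -> measurable_fun setT (g : cube I -> R) ->
  bmf (fun x => (f x < g x)%R%:R).
Proof.
move=> mf mg; split; last by exists 1 => x; case: (f x < g x); rewrite ?normr1 ?normr0.
have mb : measurable_fun setT ((fun x => f x < g x) : cube I -> bool).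
  exact: measurable_fun_ltr.
have -> : (fun x => (f x < g x)%R%:R) = ((fun b : bool => b%:R : R) \o (fun x => f x < g x)) by [].
exact: measurableT_comp mb.
Qed.

Lemma bmf_comp (I J : Type) (f : (I -> R) -> R) (h : (J -> R) -> (I -> R)) :
  bmf f -> (forall i, measurable_fun setT ((fun x => h x i) : cube J -> R)) ->
  bmf (fun x => f (h x)).
Proof.
case=> mf [C bC] mh; split; last by exists C => x.
have mh' : measurable_fun setT (h : cube J -> cube I) by exact: measurable_to_cube.
exact: measurableT_comp mf mh'.
Qed.

Lemma bmf_reindex (I J : Type) (f : (I -> R) -> R) (h : I -> J) :
  bmf f -> bmf (fun x : J -> R => f (x \o h)).
Proof. by move=> bf; apply: (bmf_comp bf) => i; exact: measurable_coord. Qed.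

Section OneCoord.
Variables (I : finType) (i : I).
Implicit Types f g : (I -> R) -> R.

Lemma le_Uint f g x : bmf f -> bmf g -> (forall y, f y <= g y) ->
  Uint i f x <= Uint i g x.
Proof.
by move=> bf bg fg; apply: le_Rintegral => //;
  apply/bm1_integrable/bmf_slice.
Qed.

Lemma UintD f g : bmf f -> bmf g ->
  Uint i (fun x => f x + g x) = (fun x => Uint i f x + Uint i g x).
Proof.
by move=> bf bg; apply/funext => x; apply: RintegralD => //;
  apply/bm1_integrable/bmf_slice.
Qed.

Lemma UintMl f g : bmf g -> (forall x t, f (upd i t x) = f x) ->
  Uint i (fun x => f x * g x) = (fun x => f x * Uint i g x).
Proof.
move=> bg fi; apply/funext => x; rewrite /Uint.
under eq_Rintegral do rewrite fi.
by rewrite RintegralZl //; apply/bm1_integrable/bmf_slice.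
Qed.

Lemma Uint_id f : (forall x t, f (upd i t x) = f x) -> Uint i f = f.
Proof.
move=> fi; apply/funext => x; rewrite /Uint.
under eq_Rintegral do rewrite fi.
by rewrite mu01_cst.
Qed.

Lemma Uint_bound f C x : bmf f -> (forall y, `|f y| <= C) -> `|Uint i f x| <= C.
Proof.
move=> bf bC.
have Uc c : Uint i (fun=> c) x = c by exact: mu01_cst.
rewrite ler_norml -[X in X <= _ <= _]Uc -[X in _ <= _ <= X]Uc.
have bc c : bmf (fun _ : I -> R => c) by exact: bmf_cst.
have h1 y : - C <= f y by have := bC y; rewrite ler_norml => /andP[].
have h2 y : f y <= C by have := bC y; rewrite ler_norml => /andP[].
apply/andP; split; apply: le_Uint => //.
Qed.

Lemma bmf_Uint f : bmf f -> bmf (Uint i f).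
Proof.
move=> bf; have [mf [C bC]] := bf; split; last first.
  by exists C => x; exact: Uint_bound.
have mF : measurable_fun setT ((fun p => (f (upd i p.2 p.1))%:E) : cube I * R -> \bar R).
  by apply/measurable_EFinP; exact: (measurableT_comp mf (measurable_upd i)).
have iF : (mu01.-integrable setT (EFin \o (fun _ : R => C))) by apply/bm1_integrable; split => //; exists `|C|.
have C0 : 0 <= C by exact: le_trans (normr_ge0 _) (bC (fun=> 0)).
have mFC : measurable_fun setT ((fun p => (f (upd i p.2 p.1) + C)%:E) : cube I * R -> \bar R).
  apply/measurable_EFinP; apply: measurable_funD => //.
  exact: (measurableT_comp mf (measurable_upd i)).
(* Shifted by its bound [C] the integrand is nonnegative, and Tonelli gives measurability in the
   remaining coordinates. *)
have -> : Uint i f = (fun x => fine (\int[mu01]_t (f (upd i t x) + C)%:E)%E - C).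
  apply/funext => x.
  have := @RintegralD _ _ _ mu01 setT (fun t => f (upd i t x)) (fun=> C) measurableT
     (bm1_integrable (bmf_slice i x bf)) iF.
  rewrite {1}/Rintegral => ->; rewrite mu01_cst.
  by rewrite addrK.
apply: measurable_funB => //; apply: measurableT_comp => //.
apply: (@measurable_fun_fubini_tonelli_F _ _ (cube I) (measurableTypeR R) R mu01
   (fun p => (f (upd i p.2 p.1) + C)%:E)) => //.
move=> p; rewrite lee_fin -lerBlDr sub0r.
by have := bC (upd i p.2 p.1); rewrite ler_norml => /andP[].
Qed.

End OneCoord.
End CubeIntegral.

Section CubeIntegral2.
Variable R : realType.
Notation mu01 := (mu01 R).

Lemma Rint01E (g : R -> R) : bm1 g ->
  (\int[mu01]_t g t)%:E = (\int[mu01]_t (g t)%:E)%E.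
Proof.
move=> bg; rewrite /Rintegral fineK //.
exact: (integrable_fin_num measurableT (bm1_integrable bg)).
Qed.

Lemma integral01E (g : R -> R) : bm1 g -> (forall t, 0 <= g t) ->
  (\int[@lebesgue_measure R]_(t in [set t : R | (0 <= t <= 1)%R]) (g t)%:E)%E
  = (\int[mu01]_t g t)%:E.
Proof.
move=> bg g0; rewrite Rint01E //.
have mg : measurable_fun setT (EFin \o g) by apply/measurable_EFinP; case: bg.
have := @integral_uniform R 0 1 ltr01 (EFin \o g) mg.
rewrite /= => ->; last by move=> t; rewrite lee_fin.
by rewrite subr0 invr1 mul1e set_itvE.
Qed.

(** A bounded function is integrable for a product of two probabilities, so Fubini applies. All
    reorderings of coordinate lists rest on this. *)
Lemma UintC (I : finType) (i j : I) (f : (I -> R) -> R) : bmf f ->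
  Uint i (Uint j f) = Uint j (Uint i f).
Proof.
move=> bf; have [->//|ij] := eqVneq i j.
have [mf [C bC]] := bf.
apply/funext => x; rewrite /Uint.
have sl k (y : I -> R) : bm1 (fun t => f (upd k t y)).
  exact: bmf_slice.
have swap s t : upd j t (upd i s x) = upd i s (upd j t x).
  apply/funext => k; rewrite /upd; case: eqP => // ->; rewrite eq_sym (negbTE ij) //.
rewrite /Rintegral; congr fine.
under eq_integral => s _ do rewrite fineK ?(integrable_fin_num measurableT (bm1_integrable (sl _ _))) //.
under [RHS]eq_integral => t _ do rewrite fineK ?(integrable_fin_num measurableT (bm1_integrable (sl _ _))) //.
pose F := fun p : measurableTypeR R * measurableTypeR R => (f (upd j p.2 (upd i p.1 x)))%:E.
have mF : measurable_fun setT F.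
  apply/measurable_EFinP; apply: (measurableT_comp mf).
  apply: measurable_to_cube => k; rewrite /upd.
  case: (k == j); first exact: measurable_snd.
  by case: (k == i) => //; exact: measurable_fst.
have /(integrable12ltyP mu01 mu01 mF) iF : (\int[mu01]_s \int[mu01]_t `|F (s, t)| < +oo)%E.
  have CE : (\int[mu01]_t C%:E)%E = C%:E.
    by rewrite -(@Rint01E (fun=> C)) ?mu01_cst //; split => //; exists `|C|.
  apply: (@le_lt_trans _ _ (\int[mu01]_s C%:E)%E); last by rewrite CE ltry.
  apply: ge0_le_integral => //.
  - by move=> s _; apply: integral_ge0.
  - apply: (@measurable_fun_fubini_tonelli_F _ _ _ _ R mu01 (fun p => `|F p|%E)) => //.
    exact: measurableT_comp.
  - move=> s _; rewrite -CE; apply: ge0_le_integral => //.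
    + apply: measurableT_comp => //; apply/measurable_EFinP.
      exact: (sl j (upd i s x)).1.
    + by move=> t _; rewrite lee_fin.
rewrite (Fubini iF) /F /=.
by under eq_integral => t _ do under eq_integral => s _ do rewrite swap.
Qed.

Section Lists.
Variable I : finType.
Implicit Types (f g : (I -> R) -> R) (s : seq I) (i : I).

Definition Ulist s f := foldr (@Uint R I) f s.

Lemma Ulist_cat s1 s2 f : Ulist (s1 ++ s2) f = Ulist s1 (Ulist s2 f).
Proof. exact: foldr_cat. Qed.

Lemma bmf_Ulist s f : bmf f -> bmf (Ulist s f).
Proof. by move=> bf; elim: s => //= i s; exact: bmf_Uint. Qed.

Lemma Ulist_cons i s f : bmf f -> Ulist (i :: s) f = Ulist s (Uint i f).
Proof. by move=> bf; elim: s => //= j s <- /=; rewrite UintC //; exact: bmf_Ulist. Qed.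

Lemma UlistC s1 s2 f : bmf f -> Ulist s1 (Ulist s2 f) = Ulist s2 (Ulist s1 f).
Proof.
move=> bf; elim: s1 => //= i s1 ->.
by rewrite -[LHS]/(Ulist (i :: s2) (Ulist s1 f)) Ulist_cons //; exact: bmf_Ulist.
Qed.

Lemma perm_Ulist s1 s2 f : perm_eq s1 s2 -> bmf f -> Ulist s1 f = Ulist s2 f.
Proof.
move=> s12 bf; elim: s1 s2 s12 => [|i s1 IH] s2.
  by rewrite perm_sym => /perm_nilP->.
move=> s12; have si : i \in s2 by rewrite -(perm_mem s12) mem_head.
case/splitPr: si s12 => p1 p2 s12.
rewrite Ulist_cat /= -[LHS]/(Ulist [:: i] _) -[X in _ = Ulist p1 X]/(Ulist [:: i] (Ulist p2 f)).
rewrite [RHS]UlistC; last exact: bmf_Ulist.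
congr (Ulist _ _); rewrite -Ulist_cat; apply: IH.
by rewrite -(perm_cons i); apply: (perm_trans s12); rewrite -cat1s perm_catCA.
Qed.

Lemma le_Ulist s f g : bmf f -> bmf g -> (forall y, f y <= g y) ->
  forall x, Ulist s f x <= Ulist s g x.
Proof.
move=> bf bg fg; elim: s => //= i s IH x.
by apply: le_Uint => //; exact: bmf_Ulist.
Qed.

Lemma UlistD s f g : bmf f -> bmf g ->
  Ulist s (fun x => f x + g x) = (fun x => Ulist s f x + Ulist s g x).
Proof.
move=> bf bg; elim: s => //= i s ->.
by rewrite UintD //; exact: bmf_Ulist.
Qed.

Definition indep i f := forall x t, f (upd i t x) = f x.

Lemma UlistMl s f g : bmf g -> (forall i, i \in s -> indep i f) ->
  Ulist s (fun x => f x * g x) = (fun x => f x * Ulist s g x).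
Proof.
move=> bg; elim: s => //= i s IH fi.
rewrite IH => [|j js]; last by apply: fi; rewrite inE js orbT.
by rewrite UintMl //; [exact: bmf_Ulist | apply: fi; rewrite mem_head].
Qed.

Lemma Ulist_id s f : (forall i, i \in s -> indep i f) -> Ulist s f = f.
Proof.
elim: s => //= i s IH fi.
rewrite IH => [|j js]; last by apply: fi; rewrite inE js orbT.
by rewrite Uint_id // => x t; apply: fi; rewrite mem_head.
Qed.

Lemma Ulist_cst s c : Ulist s (fun=> c) = fun=> c.
Proof. by rewrite Ulist_id. Qed.

Lemma UlistZl s c f : bmf f -> Ulist s (fun x => c * f x) = fun x => c * Ulist s f x.
Proof. by move=> bf; rewrite UlistMl. Qed.

Lemma UlistB s f g : bmf f -> bmf g ->
  Ulist s (fun x => f x - g x) = (fun x => Ulist s f x - Ulist s g x).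
Proof.
move=> bf bg.
have -> : (fun x => f x - g x) = (fun x => f x + (-1) * g x).
  by apply/funext => x; rewrite mulN1r.
have bN : bmf (fun x => -1 * g x) by apply: bmfM => //; exact: bmf_cst.
by rewrite UlistD // UlistZl //; apply/funext => x; rewrite mulN1r.
Qed.

Lemma Ulist_sum (T : Type) s (r : seq T) (P : pred T) (f : T -> (I -> R) -> R) :
  (forall j, P j -> bmf (f j)) ->
  Ulist s (fun x => \sum_(j <- r | P j) f j x)
  = (fun x => \sum_(j <- r | P j) Ulist s (f j) x).
Proof.
move=> bf; elim: r => [|j r IH].
  under eq_fun do rewrite big_nil; rewrite Ulist_cst.
  by apply/funext => x; rewrite big_nil.
case Pj : (P j); last first.
  under eq_fun do rewrite big_cons Pj; rewrite IH.
  by apply/funext => x; rewrite big_cons Pj.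
under eq_fun do rewrite big_cons Pj; rewrite UlistD //; last 2 first.
- exact: bf.
- exact: bmf_sum.
by rewrite IH; apply/funext => x; rewrite big_cons Pj.
Qed.

Lemma Ulist_ge0 s f : bmf f -> (forall y, 0 <= f y) -> forall x, 0 <= Ulist s f x.
Proof.
move=> bf f0 x; have <- : Ulist s (fun=> 0) x = 0 by rewrite Ulist_cst.
by apply: le_Ulist => //; exact: bmf_cst.
Qed.

Lemma Ulist_le1 s f : bmf f -> (forall y, f y <= 1) -> forall x, Ulist s f x <= 1.
Proof.
move=> bf f0 x; have <- : Ulist s (fun=> 1) x = 1 by rewrite Ulist_cst.
by apply: le_Ulist => //; exact: bmf_cst.
Qed.

(** Bridge to the definitions: on nonnegative integrands the iterated Lebesgue integrals over
    [[0, 1]] become real integrals against the uniform probability. *)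
Lemma iint_Ulist s f x : bmf f -> (forall y, 0 <= f y) ->
  iint (fun y => (f y)%:E) s x = (Ulist s f x)%:E.
Proof.
move=> bf f0; elim: s x => //= i s IH x.
transitivity ((\int[@lebesgue_measure R]_(t in [set t : R | (0 <= t <= 1)%R]) (Ulist s f (upd i t x))%:E)%E).
  by apply: eq_integral => t _; rewrite -IH.
rewrite integral01E //; first by apply: bmf_slice; exact: bmf_Ulist.
by move=> t; exact: Ulist_ge0.
Qed.

Definition depon (D : {set I}) f := forall x y, {in D, x =1 y} -> f x = f y.

Lemma depon_indep D f i : depon D f -> i \notin D -> indep i f.
Proof.
move=> df iD x t; apply: df => j jD; rewrite /upd; case: eqP => // e.
by rewrite -e jD in iD.
Qed.

Lemma deponS (D D' : {set I}) f : D \subset D' -> depon D f -> depon D' f.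
Proof. by move=> /fintype.subsetP DD df x y xy; apply: df => i /DD; exact: xy. Qed.

Lemma depon_Uint i (D : {set I}) f : depon D f -> depon (D :\ i) (Uint i f).
Proof.
move=> df x y xy; rewrite /Uint; apply: eq_Rintegral => t _.
apply: df => j jD; rewrite /upd; case: eqP => // /eqP ji.
by apply: xy; rewrite !inE ji.
Qed.

Lemma depon_Ulist s (D : {set I}) f :
  depon D f -> depon (D :\: [set:: s]) (Ulist s f).
Proof.
move=> df; elim: s => [|i s IH] /=; first by rewrite finset.set_nil finset.setD0.
apply: deponS (depon_Uint (i := i) IH).
by apply/fintype.subsetP => j; rewrite !inE; case: (j == i).
Qed.

(** The base point is immaterial, every coordinate being integrated out. *)
Definition Jint f := Ulist (enum I) f (fun=> 0).

Lemma Jint_any f x : Ulist (enum I) f x = Jint f.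
Proof.
have d0 : depon [set: I] f by move=> y z yz; congr f; apply/funext => i; apply: yz; rewrite inE.
apply: (depon_Ulist (s := enum I) d0) => i; rewrite !inE mem_enum //.
Qed.

Lemma Jint_ext f g : f =1 g -> Jint f = Jint g.
Proof. by move=> /funext->. Qed.

Lemma Jint_Ulist s f : bmf f -> Jint (Ulist s f) = Jint f.
Proof.
move=> bf; rewrite /Jint UlistC // Ulist_id // => i _ x t.
by rewrite !Jint_any.
Qed.

Lemma Ulist_Jint s (D : {set I}) f x : bmf f -> depon D f -> {subset D <= s} ->
  Ulist s f x = Jint f.
Proof.
move=> bf df Ds; rewrite -(Jint_Ulist s bf) -(Jint_any _ x).
rewrite (@Ulist_id (enum I) (Ulist s f)) // => i _.
apply: (depon_indep (depon_Ulist (s := s) df)).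
by rewrite !inE; apply/negP => /andP[/negP h /Ds].
Qed.

Lemma JintD f g : bmf f -> bmf g -> Jint (fun x => f x + g x) = Jint f + Jint g.
Proof. by move=> bf bg; rewrite /Jint UlistD. Qed.
Lemma JintB f g : bmf f -> bmf g -> Jint (fun x => f x - g x) = Jint f - Jint g.
Proof. by move=> bf bg; rewrite /Jint UlistB. Qed.
Lemma JintZl c f : bmf f -> Jint (fun x => c * f x) = c * Jint f.
Proof. by move=> bf; rewrite /Jint UlistZl. Qed.
Lemma Jint_cst c : Jint (fun=> c) = c.
Proof. by rewrite /Jint Ulist_cst. Qed.
Lemma Jint_sum (T : Type) (r : seq T) (P : pred T) (f : T -> (I -> R) -> R) :
  (forall j, P j -> bmf (f j)) ->
  Jint (fun x => \sum_(j <- r | P j) f j x) = \sum_(j <- r | P j) Jint (f j).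
Proof. by move=> bf; rewrite /Jint Ulist_sum. Qed.
Lemma le_Jint f g : bmf f -> bmf g -> (forall y, f y <= g y) -> Jint f <= Jint g.
Proof. by move=> bf bg fg; exact: le_Ulist. Qed.
Lemma Jint_ge0 f : bmf f -> (forall y, 0 <= f y) -> 0 <= Jint f.
Proof. by move=> bf fg; exact: Ulist_ge0. Qed.
Lemma Jint_norm f : bmf f -> `|Jint f| <= Jint (fun x => `|f x|).
Proof.
move=> bf; have bn := bmf_norm bf; rewrite ler_norml; apply/andP; split.
  rewrite -mulN1r -JintZl //; apply: le_Jint => // [|y].
    by apply: bmfM => //; exact: bmf_cst.
  by rewrite mulN1r; have := ler_norm (- f y); rewrite normrN; lra.
by apply: le_Jint => // y; exact: ler_norm.
Qed.

(** The first-moment method; it later selects one sample that avoids all unwanted events. *)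
Lemma Jint_lt_ex f c : bmf f -> Jint f < c -> exists x, f x < c.
Proof.
move=> bf fc; apply/not_existsP => h.
have : c <= Jint f.
  rewrite -[c]Jint_cst; apply: le_Jint => // [|y]; first exact: bmf_cst.
  by rewrite leNgt; apply/negP; exact: h.
by rewrite leNgt fc.
Qed.

End Lists.
End CubeIntegral2.

Section CubeIntegral3.
Variable R : realType.
Notation mu01 := (mu01 R).

Section Series.
Variable I : finType.
Implicit Types (f g : (I -> R) -> R).

Lemma le_Ulist_series (s : seq I) g (h : nat -> (I -> R) -> R) :
  bmf g -> (forall n, bmf (h n)) -> (forall n x, 0 <= h n x) ->
  (forall x, 0 <= g x) ->
  (forall x, ((g x)%:E <= \sum_(0 <= n <oo) (h n x)%:E)%E) ->
  forall x, ((Ulist s g x)%:E <= \sum_(0 <= n <oo) (Ulist s (h n) x)%:E)%E.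
Proof.
move=> bg bh h0 g0 gh; elim: s => //= i s IH x.
have mH n : measurable_fun setT (fun t : R => (Ulist s (h n) (upd i t x))%:E).
  by apply/measurable_EFinP; exact: (bmf_slice i x (bmf_Ulist s (bh n))).1.
have H0 n t : (0 <= (Ulist s (h n) (upd i t x))%:E)%E.
  by rewrite lee_fin; exact: Ulist_ge0.
have UE f : bmf f -> (Uint i (Ulist s f) x)%:E = (\int[mu01]_t (Ulist s f (upd i t x))%:E)%E.
  by move=> bf; apply: Rint01E; exact: bmf_slice (bmf_Ulist _ _).
rewrite UE // (eq_eseriesr (fun n _ => UE _ (bh n))).
rewrite -(integral_nneseries mu01 measurableT) //.
apply: ge0_le_integral => //.
- by move=> t _; rewrite lee_fin; exact: Ulist_ge0.
- by apply/measurable_EFinP; exact: (bmf_slice i x (bmf_Ulist s bg)).1.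
- by apply: ge0_emeasurable_sum => // n _; exact: mH.
Qed.

(** Monotone convergence in each coordinate. The series meant here are telescoping ones that
    dominate the distance from a limsup to a term. *)
Lemma Jint_le_series g (h : nat -> (I -> R) -> R) (c : R) :
  bmf g -> (forall n, bmf (h n)) -> (forall n x, 0 <= h n x) ->
  (forall x, 0 <= g x) ->
  (forall x, ((g x)%:E <= \sum_(0 <= n <oo) (h n x)%:E)%E) ->
  (forall N, \sum_(0 <= n < N) Jint (h n) <= c) ->
  Jint g <= c.
Proof.
move=> bg bh h0 g0 gh hc.
rewrite -lee_fin; apply: le_trans (le_Ulist_series (enum I) bg bh h0 g0 gh _) _.
apply: lime_le.
  by apply: is_cvg_nneseries => n _ _; rewrite lee_fin; exact: Ulist_ge0.
by apply: nearW => N; rewrite sumEFin lee_fin; exact: hc.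
Qed.

End Series.

Lemma Uint_reindex (I I' : finType) (eta : I -> I') (i : I) (f : (I -> R) -> R) :
  injective eta ->
  Uint (eta i) (fun x => f (x \o eta)) = fun x => Uint i f (x \o eta).
Proof.
move=> inj; apply/funext => x; rewrite /Uint; apply: eq_Rintegral => t _.
by congr f; apply/funext => j; rewrite /upd /= (inj_eq inj).
Qed.

Lemma Ulist_reindex (I I' : finType) (eta : I -> I') (s : seq I) (f : (I -> R) -> R) :
  injective eta ->
  Ulist (map eta s) (fun x => f (x \o eta)) = fun x => Ulist s f (x \o eta).
Proof.
by move=> inj; elim: s => //= i s ->; rewrite Uint_reindex.
Qed.

Lemma Jint_reindex (I I' : finType) (eta : I -> I') (f : (I -> R) -> R) :
  injective eta -> bmf f -> Jint (fun x => f (x \o eta)) = Jint f.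
Proof.
move=> inj bf; have bf' := bmf_reindex eta bf.
rewrite -(Ulist_Jint (s := map eta (enum I)) (D := [set eta i | i in I]) (fun=> 0)) //.
- by rewrite Ulist_reindex // Jint_any.
- move=> x y xy; congr f; apply/funext => i /=; apply: xy.
  by apply/imsetP; exists i.
- by move=> j /imsetP[i _ ->]; apply: map_f; rewrite mem_enum.
Qed.

Section Prod.
Variable I : finType.
Implicit Types (f g : (I -> R) -> R).

Lemma updC (i j : I) s t (x : I -> R) : i != j -> upd i s (upd j t x) = upd j t (upd i s x).
Proof.
move=> ij; apply/funext => k; rewrite /upd; case: eqP => // ->.
by rewrite (negbTE ij).
Qed.

Lemma indep_Uint (i j : I) f : indep i f -> indep i (Uint j f).
Proof.
move=> fi x t; rewrite /Uint; have [<-|ij] := eqVneq i j.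
  by apply: eq_Rintegral => u _; congr f; apply/funext => k; rewrite /upd; case: eqP.
by apply: eq_Rintegral => u _; rewrite updC 1?eq_sym // fi.
Qed.

Lemma indep_Uint_self (i : I) f : indep i (Uint i f).
Proof.
move=> x t; rewrite /Uint.
by apply: eq_Rintegral => u _; congr f; apply/funext => k; rewrite /upd; case: eqP.
Qed.

Lemma indepM (i : I) f g : indep i f -> indep i g -> indep i (fun x => f x * g x).
Proof. by move=> fi gi x t; rewrite fi gi. Qed.

Lemma indep_prod (T : Type) (r : seq T) (P : pred T) (i : I) (F : T -> (I -> R) -> R) :
  (forall a, P a -> indep i (F a)) -> indep i (fun x => \prod_(a <- r | P a) F a x).
Proof. by move=> Fi x t; apply: eq_bigr => a Pa; exact: Fi. Qed.

(** Conditional independence: [a] is the only coordinate of [s] that [phi a] may involve, so the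
    integral over [s] factors. *)
Lemma Ulist_prod (s : seq I) (Phi : (I -> R) -> R) (phi : I -> (I -> R) -> R) :
  uniq s -> bmf Phi -> (forall a, bmf (phi a)) ->
  (forall a, a \in s -> indep a Phi) ->
  (forall a b, a \in s -> b \in s -> a != b -> indep b (phi a)) ->
  Ulist s (fun x => Phi x * \prod_(a <- s) phi a x)
  = fun x => Phi x * \prod_(a <- s) Uint a (phi a) x.
Proof.
move=> us; elim: s Phi us => [|a s IH] Phi /=.
  by move=> _ _ _ _ _; apply/funext => x; rewrite !big_nil.
move=> /andP[as_ us] bPhi bphi iPhi iphi.
have E1 : (fun x => Phi x * \prod_(b <- a :: s) phi b x) =
          (fun x => (Phi x * phi a x) * \prod_(b <- s) phi b x).
  by apply/funext => x; rewrite big_cons mulrA.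
rewrite E1 IH //; last 3 first.
- exact: bmfM.
- move=> b bs; apply: indepM; first by apply: iPhi; rewrite inE bs orbT.
  apply: iphi; rewrite ?mem_head ?inE ?bs ?orbT //.
  by apply: contraNneq as_ => ->.
- by move=> b c bs cs; apply: iphi; rewrite inE ?bs ?cs orbT.
have -> : (fun x => Phi x * phi a x * \prod_(b <- s) Uint b (phi b) x) =
   (fun x => (Phi x * \prod_(b <- s) Uint b (phi b) x) * phi a x).
  by apply/funext => x; rewrite mulrAC.
rewrite UintMl //; first by apply/funext => x; rewrite big_cons -mulrA; congr (_ * _); rewrite mulrC.
apply: indepM; first by apply: iPhi; rewrite mem_head.
move=> x t; rewrite !big_seq; apply: eq_bigr => b bs; apply: indep_Uint.
apply: iphi; rewrite ?mem_head ?inE ?bs ?orbT //.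
by apply: contraNneq as_ => <-.
Qed.

Lemma Jint_prod (s : seq I) (Phi : (I -> R) -> R) (phi : I -> (I -> R) -> R) :
  uniq s -> bmf Phi -> (forall a, bmf (phi a)) ->
  (forall a, a \in s -> indep a Phi) ->
  (forall a b, a \in s -> b \in s -> a != b -> indep b (phi a)) ->
  Jint (fun x => Phi x * \prod_(a <- s) phi a x)
  = Jint (fun x => Phi x * \prod_(a <- s) Uint a (phi a) x).
Proof.
move=> us bPhi bphi iPhi iphi; rewrite -(Ulist_prod us) // Jint_Ulist //.
by apply: bmfM => //; apply: bmf_prod.
Qed.

End Prod.
End CubeIntegral3.

(** * Hypergraphons with a coordinate for the empty set *)

Section JointGraphons.
Variables (R : realType) (k : nat).
Implicit Types (w : ({set 'I_k} -> R) -> R) (n : nat).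

Definition pull (T T' : finType) (h : T -> T') (x : {set T'} -> R) : {set T} -> R :=
  fun B => x (h @: B).

(** Indexing by all sets avoids a subtype. [jg_top] makes the coordinate of [[k]] itself invisible,
    while the coordinate of the empty set is kept: an exchangeable law is in general a mixture, and
    this coordinate selects the component. *)
Record jgraphon w : Prop := JGraphon {
  jg_bmf : bmf w;
  jg_ge0 : forall x, 0 <= w x;
  jg_le1 : forall x, w x <= 1;
  jg_top : indep [set: 'I_k]%SET w;
  jg_sym : forall (s : 'S_k) x, w (pull s x) = w x }.

Definition wE w n (A : {set 'I_n}) (x : {set 'I_n} -> R) : R :=
  w (fun B => x (edge_img A B)).

(** [edge_img] works with positions in [enum A]; here it is replaced by the image under an
    injection, which composes well with relabellings. *)
Lemma edge_param n (A : {set 'I_n}) : #|A| = k ->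
  exists th : 'I_k -> 'I_n,
    [/\ injective th, th @: [set: 'I_k]%SET = A & forall B, edge_img A B = th @: B].
Proof.
move=> cA; pose th i := enum_val (cast_ord (esym cA) i).
have inj : injective th.
  by move=> i j /enum_val_inj /cast_ord_inj.
have idx i : index (th i) (enum A) = i.
  rewrite /th (enum_val_nth (th i)) index_uniq ?enum_uniq //.
  by rewrite -cardE /= cA.
exists th; split => //.
  apply/eqP; rewrite eqEcard card_imset // cardsT card_ord cA leqnn andbT.
  by apply/fintype.subsetP => _ /imsetP[i _ ->]; exact: enum_valP.
move=> B; apply/setP => v; rewrite inE; apply/andP/imsetP.
  move=> [vA /existsP[i /andP[iB /eqP iv]]]; exists i => //.
  rewrite /th (enum_val_nth v) /= iv nth_index // mem_enum //.
move=> [i iB ->]; split; first exact: enum_valP.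
by apply/existsP; exists i; rewrite iB idx eqxx.
Qed.

Lemma inj_same_image n (th th' : 'I_k -> 'I_n) :
  injective th -> injective th' -> th @: [set: 'I_k]%SET = th' @: [set: 'I_k]%SET ->
  exists s : 'S_k, forall i, th' i = th (s i).
Proof.
move=> inj inj' E.
have h i : exists j, th' i == th j.
  have /imsetP[j _ ->] : th' i \in th @: [set: 'I_k]%SET by rewrite E imset_f // inE.
  by exists j.
pose s0 i := xchoose (h i).
have s0E i : th' i = th (s0 i) by apply/eqP; exact: xchooseP (h i).
have s0i : injective s0 by move=> i j e; apply: inj'; rewrite !s0E e.
by exists (perm s0i) => i; rewrite permE.
Qed.

(** Two parametrisations of [A] differ by a permutation of [[k]], under which [w] is invariant. *)
Lemma wE_inj w n (th : 'I_k -> 'I_n) (A : {set 'I_n}) x :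
  (forall (s : 'S_k) x, w (pull s x) = w x) ->
  injective th -> th @: [set: 'I_k]%SET = A -> wE w A x = w (pull th x).
Proof.
move=> sym inj E; have cA : #|A| = k by rewrite -E card_imset // cardsT card_ord.
have [th' [inj' E' eE]] := edge_param cA.
have [s sE] := inj_same_image inj inj' (etrans E (esym E')).
rewrite /wE -(sym s (pull th x)); congr w; apply/funext => B.
rewrite /pull eE; congr x.
by rewrite -imset_comp; apply: eq_imset => i /=; exact: sE.
Qed.

Lemma bmf_wE w n (A : {set 'I_n}) : bmf w -> bmf (wE w A).
Proof. by move=> bw; exact: (bmf_reindex (edge_img A) bw). Qed.

Lemma wE_ge0 w n (A : {set 'I_n}) x : jgraphon w -> 0 <= wE w A x.
Proof. by move=> jw; exact: jg_ge0. Qed.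
Lemma wE_le1 w n (A : {set 'I_n}) x : jgraphon w -> wE w A x <= 1.
Proof. by move=> jw; exact: jg_le1. Qed.

Definition noempty w := indep (finset.set0 : {set 'I_k}) w.

Lemma indep_pull (T : finType) (g : (T -> R) -> R) i (x y : T -> R) :
  indep i g -> (forall j, j != i -> x j = y j) -> g x = g y.
Proof.
move=> gi xy; rewrite -(gi x (y i)); congr g; apply/funext => j.
by rewrite /upd; case: eqP => [->//|/eqP]; exact: xy.
Qed.

Lemma depon_wE w n (A : {set 'I_n}) : jgraphon w -> #|A| = k ->
  depon [set B : {set 'I_n} | B \proper A]%SET (wE w A).
Proof.
move=> jw cA x y xy; have [th [inj E eE]] := edge_param cA.
rewrite /wE; apply: (indep_pull (jg_top jw)) => B BT; rewrite eE.
apply: xy; rewrite inE -E properE; apply/andP; split; first by rewrite imsetS // finset.subsetT.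
apply: contra BT => /fintype.subsetP sub; apply/eqP/setP => i; rewrite inE.
by have /imsetP[j jB /inj ->] : th i \in th @: B by apply: sub; rewrite imset_f.
Qed.

Lemma depon_wE0 w n (A : {set 'I_n}) : jgraphon w -> noempty w -> #|A| = k ->
  depon [set B : {set 'I_n} | (B \proper A) && (B != finset.set0)]%SET (wE w A).
Proof.
move=> jw ne cA x y xy; have [th [inj E eE]] := edge_param cA.
transitivity (wE w A (upd finset.set0 (y finset.set0) x)).
  rewrite /wE; apply: (indep_pull ne) => B B0; rewrite /upd eE imset_eq0 (negbTE B0) //.
apply: (depon_wE jw cA) => B; rewrite inE => BA; rewrite /upd.
by case: eqP => [->//|/eqP B0]; apply: xy; rewrite inE BA.
Qed.

Definition tJ (F : kgraph k) w : R := Jint (fun x => \prod_(A in edges F) wE w A x).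

Lemma edge_card (F : kgraph k) A : A \in edges F -> #|A| = k.
Proof. by move=> AF; have /forallP /(_ A) := edges_size F; rewrite AF => /eqP. Qed.

Lemma bmf_prodE w (F : kgraph k) : jgraphon w -> bmf (fun x => \prod_(A in edges F) wE w A x).
Proof. by move=> jw; apply: bmf_prod => A _; apply: bmf_wE; exact: jg_bmf. Qed.

Section OfHypergraphon.
Variable (W : (rlt k -> R) -> R).
Hypothesis hW : hypergraphon W.

Definition wW (x : {set 'I_k} -> R) : R := W (x \o val).

Lemma W_bmf : bmf W.
Proof.
case: hW => mW W01 _; split.
  by move=> _ B mB; rewrite setTI; exact: mW.
by exists 1 => x; have /andP[? ?] := W01 x; rewrite ger0_norm.
Qed.

Lemma wW_jg : jgraphon wW.
Proof.
have [mW W01 sW] := hW; split.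
- exact: bmf_reindex W_bmf.
- by move=> x; have /andP[] := W01 (x \o val).
- by move=> x; have /andP[] := W01 (x \o val).
- move=> x t; congr W; apply/funext => -[B /= HB]; rewrite /upd /=.
  by case: eqP => // e; move: (HB); rewrite /rltP e eqxx andbF.
- move=> s x; apply/esym/(sW s) => B C e.
  by rewrite /pull /= -e.
Qed.

Lemma wW_noempty : noempty wW.
Proof.
move=> x t; congr W; apply/funext => -[B /= HB]; rewrite /upd /=.
by case: eqP => // e; move: (HB); rewrite /rltP e eqxx.
Qed.

(** The integrand involves only nonempty proper subsets of edges, so integrating over further
    coordinates than those of [coordF] changes nothing. *)
Lemma tW_tJ (F : kgraph k) : tW F W = tJ F wW.
Proof.
rewrite /tW (_ : (fun x => _) = fun x => (\prod_(A in edges F) wE wW A x)%:E); last first.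
  by apply/funext => x.
have bP := bmf_prodE F wW_jg.
rewrite iint_Ulist //; last by move=> y; apply: prodr_ge0 => A _; exact: wE_ge0 wW_jg.
rewrite /= (@Ulist_Jint _ _ _ (coordF k (nv F))) //; last by move=> B; rewrite mem_enum.
move=> x y xy; apply: eq_bigr => A AF; have cA := edge_card AF.
apply: (depon_wE0 wW_jg wW_noempty cA) => B; rewrite inE => /andP[BA B0].
apply: xy; have := proper_card BA; rewrite cA => h.
by rewrite inE B0 /= -ltnS (ltn_predK h).
Qed.

End OfHypergraphon.

Definition lowk l : {set 'I_k} := [set i : 'I_k | (i < l)%N]%SET.
Definition hidx l : {set {set 'I_k}} := [set B : {set 'I_k} | ~~ (B \subset lowk l)]%SET.
Definition degJ l w := Ulist (enum (hidx l)) w.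

Section Deg.
Variable (W : (rlt k -> R) -> R) (l : nat).
Hypotheses (hW : hypergraphon W) (hlk : (l < k)%N).

Lemma in_lowset (B : rlt k) : (B \in lowset k l) = (val B \subset lowk l).
Proof.
rewrite inE; apply/forallP/fintype.subsetP => [h i iB|h i]; first by have := h i; rewrite iB inE.
by apply/implyP => /h; rewrite inE.
Qed.

(** The coordinates of [hidx] are those outside [lowset] together with the full set, which belongs
    to [hidx] because [l < k] and of which [wW W] is independent. *)
Lemma degJ_degW x : degW l W (x \o val) = (degJ l (wW W) x)%:E.
Proof.
have W01 : forall x, 0 <= W x <= 1 by case: hW.
rewrite /degW iint_Ulist; [|exact: W_bmf|by move=> y; have /andP[] := W01 y].
congr EFin; have bw := jg_bmf (wW_jg hW).
transitivity (Ulist (map val (enum (~: lowset k l)%SET)) (wW W) x).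
  by rewrite (Ulist_reindex _ _ val_inj).
have sT : [set: 'I_k]%SET \in hidx l.
  rewrite inE; apply/negP => /fintype.subsetP /(_ (Ordinal hlk)).
  by rewrite !inE ltnn => /(_ isT).
have pe : perm_eq (enum (hidx l)) (map val (enum (~: lowset k l)%SET) ++ [:: [set: 'I_k]%SET]).
  apply: uniq_perm; first exact: enum_uniq.
    rewrite cat_uniq map_inj_uniq ?enum_uniq //=; last exact: val_inj.
    rewrite orbF andbT; apply/mapP => -[[B HB] _ /= e].
    by move: (HB); rewrite /rltP -e eqxx andbF.
  move=> B; rewrite mem_enum mem_cat mem_seq1.
  have [->|BT] := eqVneq B [set: 'I_k]%SET; first by rewrite sT orbT.
  rewrite orbF inE; apply/idP/mapP => [nB|[C]].
    have B0 : B != finset.set0 by apply: contraNneq nB => ->; rewrite finset.sub0set.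
    have HB : rltP B by rewrite /rltP B0.
    by exists (exist _ B HB) => //; rewrite mem_enum inE in_lowset.
  by rewrite mem_enum inE in_lowset => h ->.
rewrite /degJ (perm_Ulist pe bw) Ulist_cat; congr (Ulist _ _ x).
by rewrite Ulist_id // => i; rewrite inE => /eqP->; exact: jg_top (wW_jg hW).
Qed.

Lemma bmf_degJ w : bmf w -> bmf (degJ l w).
Proof. exact: bmf_Ulist. Qed.

Definition below w (y : R) := Jint (fun x => (degJ l w x < y)%R%:R : R).

Lemma bmf_below w y : bmf w -> bmf (fun x => (degJ l w x < y)%R%:R : R).
Proof.
move=> bw; apply: bmf_lt; last exact: measurable_cst.
exact: (bmf_degJ bw).1.
Qed.

Lemma iint_below (y : R) :
  iint (fun x => (((degW l W x < y%:E)%E : bool)%:R : R)%:E)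
         (enum (lowset k l)) (fun _ => 0) = (below (wW W) y)%:E.
Proof.
pose ext (x : rlt k -> R) (B : {set 'I_k}) : R :=
  if insub B is Some C then x C else 0.
have extK x : ext x \o val = x.
  by apply/funext => B; rewrite /ext /= valK.
pose d (x : rlt k -> R) := degJ l (wW W) (ext x).
have dE x : degW l W x = (d x)%:E by rewrite -{1}(extK x) degJ_degW.
have bw := jg_bmf (wW_jg hW).
have dv x : d (x \o val) = degJ l (wW W) x.
  by apply: EFin_inj; rewrite -dE degJ_degW.
have bd : bmf (fun x => (d x < y)%R%:R : R).
  apply: (@bmf_comp _ _ _ (fun x => (degJ l (wW W) x < y)%R%:R) ext).
    exact: bmf_below.
  move=> B; rewrite /ext; case: insubP => [C _ _|_]; first exact: measurable_coord.
  exact: measurable_cst.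
transitivity (iint (fun x => ((d x < y)%R%:R : R)%:E) (enum (lowset k l)) (fun _ => 0)).
  by congr (iint _ _ _); apply/funext => x; rewrite dE lte_fin.
rewrite iint_Ulist //.
congr EFin; rewrite (@Ulist_Jint _ _ _ (lowset k l)) //; last by move=> B; rewrite mem_enum.
  rewrite /below -(Jint_reindex val_inj bd).
  by apply: Jint_ext => x; rewrite dv.
have [W1 W2] : bmf W /\ depon (lowset k l) (Ulist (enum (~: lowset k l)%SET) W).
  split; first exact: W_bmf.
  have dT : depon [set: rlt k]%SET W.
    by move=> a b ab; congr W; apply/funext => i; apply: ab; rewrite inE.
  apply: deponS (depon_Ulist (s := enum (~: lowset k l)%SET) dT).
  apply/fintype.subsetP => i; rewrite finset.in_setD finset.in_setT andbT.
  have -> s : (i \in [set:: s])%SET = (i \in s) by rewrite inE.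
  by rewrite mem_enum finset.in_setC negbK.
have dU x : d x = Ulist (enum (~: lowset k l)%SET) W x.
  apply: EFin_inj; rewrite -dE /degW iint_Ulist // => z.
  by case: hW => _ /(_ z) /andP[].
move=> a b ab; rewrite !dU; congr ((_ < _)%R%:R); exact: W2.
Qed.

(** Stated for all [y < c], so that neither direction has to decide whether the supremum defining
    [mindegW] is attained. *)
Lemma mindegW_geP (c : R) : (c%:E <= mindegW l W)%E <->
  (forall y, y < c -> below (wW W) y = 0).
Proof.
split=> [h y yc|h].
  have : (y%:E < mindegW l W)%E by apply: lt_le_trans h; rewrite lte_fin.
  move=> /ereal_sup_gt[z /= z0 yz].
  have le y1 y2 : y1 <= y2 -> below (wW W) y1 <= below (wW W) y2.
    move=> y12; have bw := jg_bmf (wW_jg hW).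
    apply: le_Jint; try exact: bmf_below.
    by move=> x; rewrite ler_nat; case: (ltP _ y1) => // h1; rewrite (lt_le_trans h1).
  apply/eqP; rewrite eq_le; apply/andP; split; last first.
    by apply: Jint_ge0 => //; exact/bmf_below/jg_bmf/wW_jg.
  case: z z0 yz => [r||] //= z0 yz.
    have <- : below (wW W) r = 0 by apply: EFin_inj; rewrite -iint_below.
    by apply: le; move: yz; rewrite lte_fin => /ltW.
  (* The remaining case [z = +oo] is impossible: degrees are finite, so the indicator is constantly
     1 and its integral cannot vanish. *)
  exfalso; move: z0; rewrite (_ : (fun x => _) = fun=> (1 : R)%:E); last first.
    apply/funext => x; rewrite /degW iint_Ulist ?ltry //; first exact: W_bmf.
    by move=> u; case: hW => _ /(_ u) /andP[].
  rewrite (@iint_Ulist _ _ _ (fun=> 1)) ?Ulist_cst //; last exact: bmf_cst.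
  by case=> e10; have := oner_neq0 R; rewrite e10 eqxx.
apply/lee_subgt0Pr => e e0; apply: ereal_sup_ubound.
by rewrite /= iint_below h // ltrBlDr ltrDl.
Qed.

End Deg.
End JointGraphons.

(** * Exchangeable means on finite arrays of edges *)

Section Averages.
Variable R : realType.

Definition avg (T : finType) (g : T -> R) : R := (\sum_t g t) / (#|T|)%:R.

Lemma avgD (T : finType) (f g : T -> R) : avg (fun t => f t + g t) = avg f + avg g.
Proof. by rewrite /avg big_split mulrDl. Qed.

Lemma avgZl (T : finType) c (f : T -> R) : avg (fun t => c * f t) = c * avg f.
Proof. by rewrite /avg -mulr_sumr mulrA. Qed.

Lemma avg_ge0 (T : finType) (f : T -> R) : (forall t, 0 <= f t) -> 0 <= avg f.
Proof. by move=> f0; apply: divr_ge0 => //; apply: sumr_ge0. Qed.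

Lemma le_avg (T : finType) (f g : T -> R) : (forall t, f t <= g t) -> avg f <= avg g.
Proof. by move=> fg; apply: ler_wpM2r; [rewrite invr_ge0|apply: ler_sum]. Qed.

Lemma avg_cst (T : finType) c : (0 < #|T|)%N -> avg (fun _ : T => c) = c.
Proof.
move=> T0; rewrite /avg sumr_const -[c *+ _]mulr_natr mulfK //.
by rewrite pnatr_eq0 -lt0n.
Qed.

Lemma avg_bound (T : finType) (f : T -> R) C : 0 <= C -> (forall t, `|f t| <= C) -> `|avg f| <= C.
Proof.
move=> C0 fC; have [T0|T0] := posnP #|T|.
  by rewrite /avg T0 invr0 mulr0 normr0.
rewrite ler_norml -(avg_cst (- C) T0) -[X in _ && (_ <= X)](avg_cst C T0).
by apply/andP; split; apply: le_avg => t; have := fC t; rewrite ler_norml => /andP[].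
Qed.

(* the fibres of [phi |-> phi \o h] all have the same size *)
Lemma avg_marginal (I J V : finType) (h : I -> J) (g : {ffun I -> V} -> R) :
  injective h -> (0 < #|V|)%N ->
  avg (fun phi : {ffun J -> V} => g [ffun i => phi (h i)]) = avg g.
Proof.
move=> inj V0.
pose fib (psi : {ffun I -> V}) (j : J) : pred V :=
  if [pick i | h i == j] is Some i then pred1 (psi i) else predT.
have fibP psi (phi : {ffun J -> V}) : ([ffun i => phi (h i)] == psi) = (phi \in family (fib psi)).
  apply/eqP/familyP => [<- j|fb].
    rewrite /fib; case: pickP => [i /eqP <-|] //=.
    by rewrite inE ffunE.
  apply/ffunP => i; rewrite ffunE; have := fb (h i).
  rewrite /fib; case: pickP => [i' /eqP /inj ->|/(_ i)]; last by rewrite eqxx.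
  by rewrite inE => /eqP.
pose c := (\prod_(j : J) (if [pick i | h i == j] is Some i then 1 else #|V|))%N.
have cf psi : #|family (fib psi)| = c.
  rewrite card_family foldrE big_map big_enum /=; apply: eq_bigr => j _.
  by rewrite /fib; case: pickP => [i _|_]; [rewrite card1 | apply: eq_card].
have S : \sum_(phi : {ffun J -> V}) g [ffun i => phi (h i)] = c%:R * \sum_psi g psi.
  rewrite (partition_big (fun phi : {ffun J -> V} => [ffun i => phi (h i)]) predT) //=.
  rewrite mulr_sumr; apply: eq_bigr => psi _.
  rewrite (eq_bigr (fun _ => g psi)); last by move=> phi /eqP->.
  by rewrite sumr_const mulr_natl -(cf psi); congr (_ *+ _); apply: eq_card => phi; rewrite -fibP.
have c0 : (0 < c)%N by apply: prodn_gt0 => j; case: pickP.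
have cJ : (#|{ffun J -> V}| = c * #|{ffun I -> V}|)%N.
  rewrite -sum1_card (partition_big (fun phi : {ffun J -> V} => [ffun i => phi (h i)]) predT) //=.
  rewrite -sum1_card big_distrr /=; apply: eq_bigr => psi _.
  rewrite muln1 -(cf psi) -sum1_card; apply: eq_bigl => phi.
  by rewrite -fibP.
rewrite /avg S cJ natrM invfM mulrACA divff ?mul1r //.
by rewrite pnatr_eq0 -lt0n.
Qed.

End Averages.

Section Means.
Variable R : realType.

Definition bdf (T : Type) (f : T -> R) := exists C, forall x, `|f x| <= C.

Lemma bdf_cst T c : bdf (fun _ : T => c). Proof. by exists `|c|. Qed.
Lemma bdfD T (f g : T -> R) : bdf f -> bdf g -> bdf (fun x => f x + g x).
Proof. by move=> [C fC] [D gD]; exists (C + D) => x; exact: le_trans (ler_normD _ _) (lerD _ _). Qed.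
Lemma bdfN T (f : T -> R) : bdf f -> bdf (fun x => - f x).
Proof. by move=> [C fC]; exists C => x; rewrite normrN. Qed.
Lemma bdfM T (f g : T -> R) : bdf f -> bdf g -> bdf (fun x => f x * g x).
Proof. by move=> [C fC] [D gD]; exists (C * D) => x; rewrite normrM; exact: ler_pM. Qed.
Lemma bdf_norm T (f : T -> R) : bdf f -> bdf (fun x => `|f x|).
Proof. by move=> [C fC]; exists C => x; rewrite normr_id. Qed.
Lemma bdf01 T (f : T -> R) : (forall x, 0 <= f x <= 1) -> bdf f.
Proof. by move=> f01; exists 1 => x; have /andP[? ?] := f01 x; rewrite ger0_norm. Qed.
Lemma bdf_bool T (f : T -> bool) : bdf (fun x => (f x)%:R).
Proof. by apply: bdf01 => x; case: (f x); rewrite ler01 lexx. Qed.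
Lemma bdf_fin T (S : finType) (z : S -> R) (pi : T -> S) : bdf (fun x => z (pi x)).
Proof.
exists (\sum_s `|z s|) => x; rewrite (bigD1 (pi x)) //= lerDl; exact: sumr_ge0.
Qed.

(** A finitely additive expectation on bounded functions, which is what an ultralimit of averages
    provides. *)
Record mean (T : Type) (E : (T -> R) -> R) : Prop := Mean {
  mean1 : E (fun=> 1) = 1;
  meanD : forall f g, bdf f -> bdf g -> E (fun x => f x + g x) = E f + E g;
  meanZ : forall c f, bdf f -> E (fun x => c * f x) = c * E f;
  mean_ge0 : forall f, bdf f -> (forall x, 0 <= f x) -> 0 <= E f }.

Section MeanTheory.
Variables (T : Type) (E : (T -> R) -> R).
Hypothesis mE : mean E.
Implicit Types f g : T -> R.

Lemma mean_cst c : E (fun=> c) = c.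
Proof.
rewrite (_ : (fun=> c) = (fun x : T => c * 1)); last by apply/funext => x; rewrite mulr1.
by rewrite (meanZ mE) ?(mean1 mE) ?mulr1 //; exact: bdf_cst.
Qed.

Lemma meanN f : bdf f -> E (fun x => - f x) = - E f.
Proof.
move=> bf; rewrite -mulN1r -(meanZ mE) //.
by congr E; apply/funext => x; rewrite mulN1r.
Qed.

Lemma meanB f g : bdf f -> bdf g -> E (fun x => f x - g x) = E f - E g.
Proof. by move=> bf bg; rewrite (meanD mE) ?meanN //; exact: bdfN. Qed.

Lemma le_mean f g : bdf f -> bdf g -> (forall x, f x <= g x) -> E f <= E g.
Proof.
move=> bf bg fg; rewrite -subr_ge0 -meanB //; apply: (mean_ge0 mE).
  by apply: bdfD => //; exact: bdfN.
by move=> x; rewrite subr_ge0.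
Qed.

Lemma mean_norm f : bdf f -> `|E f| <= E (fun x => `|f x|).
Proof.
move=> bf; have bn := bdf_norm bf; rewrite ler_norml; apply/andP; split.
  rewrite -meanN //; apply: le_mean => // [|x]; first exact: bdfN.
  by have := ler_norm (- f x); rewrite normrN; lra.
by apply: le_mean => // x; exact: ler_norm.
Qed.

Lemma mean_sum (S : finType) (f : S -> T -> R) : (forall s, bdf (f s)) ->
  E (fun x => \sum_s f s x) = \sum_s E (f s).
Proof.
move=> bf; elim: (index_enum S) => [|s r IH].
  by rewrite big_nil -[RHS]mean_cst; congr E; apply/funext => x; rewrite big_nil.
rewrite big_cons -IH -(meanD mE) //.
  by congr E; apply/funext => x; rewrite big_cons.
elim: r {IH} => [|s' r IH].
  by under eq_fun do rewrite big_nil; exact: bdf_cst.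
by under eq_fun do rewrite big_cons; exact: bdfD.
Qed.

Section CondExp.
Variables (S : finType) (pi : T -> S) (f : T -> R).
Hypothesis f01 : forall x, 0 <= f x <= 1.

Definition cpr s := E (fun x => (pi x == s)%:R).
Definition cav s := E (fun x => f x * (pi x == s)%:R).
(** Conditional expectation on a cell of a finite partition; cells of probability 0 get the value 0
    by the convention for division. *)
Definition cexp s := cav s / cpr s.

Let bf : bdf f. Proof. exact: bdf01. Qed.

Lemma cav_bound s : 0 <= cav s <= cpr s.
Proof.
have bs : bdf (fun x => (pi x == s)%:R : R) by exact: bdf_bool.
apply/andP; split.
  apply: (mean_ge0 mE); first exact: bdfM.
  by move=> x; have /andP[? _] := f01 x; apply: mulr_ge0.
apply: le_mean => //; first exact: bdfM.
by move=> x; have /andP[? ?] := f01 x; apply: ler_piMl.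
Qed.

Lemma cexp01 s : 0 <= cexp s <= 1.
Proof.
have /andP[h0 h1] := cav_bound s; rewrite /cexp.
have [->|p0] := eqVneq (cpr s) 0; first by rewrite invr0 mulr0 lexx ler01.
have p_gt0 : 0 < cpr s by rewrite lt_neqAle eq_sym p0 (le_trans h0).
by apply/andP; split; [apply: divr_ge0 => //; exact: ltW | rewrite ler_pdivrMr // mul1r].
Qed.

(** Both sides are sums over the cells. On a null cell the numerator [cav] vanishes too, being
    squeezed by [cav_bound], so the value chosen there is harmless. *)
Lemma mean_cexp (z : S -> R) :
  E (fun x => z (pi x) * f x) = E (fun x => z (pi x) * cexp (pi x)).
Proof.
have bs s : bdf (fun x => (pi x == s)%:R : R) by exact: bdf_bool.
transitivity (\sum_s z s * cav s).
  rewrite -(eq_bigr _ (fun s _ => meanZ mE (z s) (bdfM bf (bs s)))) -mean_sum; last first.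
    by move=> s; apply: bdfM; [exact: bdf_cst|exact: bdfM].
  congr E; apply/funext => x; rewrite (bigD1 (pi x)) //= eqxx mulr1 big1 ?addr0 // => s.
  by rewrite eq_sym => /negbTE->; rewrite !mulr0.
transitivity (\sum_s (z s * cexp s) * cpr s).
  apply: eq_bigr => s _; rewrite /cexp -mulrA; congr (_ * _).
  have [p0|p0] := eqVneq (cpr s) 0; last by rewrite mulfVK.
  by have := cav_bound s; rewrite p0 -eq_le => /eqP <-; rewrite mulr0.
rewrite -(eq_bigr _ (fun s _ => meanZ mE (z s * cexp s) (bs s))) -mean_sum; last first.
  by move=> s; apply: bdfM => //; exact: bdf_cst.
congr E; apply/funext => x; rewrite (bigD1 (pi x)) //= eqxx mulr1 big1 ?addr0 // => s.
by rewrite eq_sym => /negbTE->; rewrite mulr0.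
Qed.

End CondExp.

(* Pythagoras for a refinement [pi'] of [pi] *)
Lemma mean_cexp_refine (S S' : finType) (pi : T -> S) (pi' : T -> S') (rho : S' -> S) f :
  (forall x, 0 <= f x <= 1) -> (forall x, pi x = rho (pi' x)) ->
  E (fun x => (cexp pi' f (pi' x) - cexp pi f (pi x)) ^+ 2)
  = E (fun x => cexp pi' f (pi' x) ^+ 2) - E (fun x => cexp pi f (pi x) ^+ 2).
Proof.
move=> f01 ref; set g := fun x => cexp pi f (pi x); set g' := fun x => cexp pi' f (pi' x).
have bg : bdf g by exact: bdf_fin.
have bg' : bdf g' by exact: bdf_fin.
have e1 : E (fun x => g x * f x) = E (fun x => g x * g x) by exact: mean_cexp.
have e2 : E (fun x => g x * f x) = E (fun x => g x * g' x).
  have := @mean_cexp _ pi' f f01 (fun s => cexp pi f (rho s)).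
  rewrite /g /g' => h; have := h; under eq_fun do rewrite -ref.
  by move=> ->; congr E; apply/funext => x; rewrite -ref.
transitivity (E (fun x => g' x * g' x + (- 2 * (g x * g' x) + g x * g x))).
  by congr E; apply/funext => x; rewrite /g /g'; ring.
have b1 := bdfM bg bg; have b2 := bdfM bg bg'; have b3 := bdfM bg' bg'.
have b4 : bdf (fun x => - 2 * (g x * g' x)) by apply: bdfM => //; exact: bdf_cst.
rewrite (meanD mE) //; last exact: bdfD.
rewrite (meanD mE) // (meanZ mE) // -e2 e1.
have sq (h : T -> R) : (fun x => h x ^+ 2) = (fun x => h x * h x) by apply/funext => x; rewrite expr2.
by rewrite !sq; ring.
Qed.

End MeanTheory.
End Means.

(** * Ultralimits of uniform samples *)

Section UltraMean.
Variables (R : realType).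

(* the adjacency of every vertex set of an infinite random sample *)
Definition arr := set nat -> bool.

Definition fdep (N : nat) (f : arr -> R) := forall X Y : arr,
  (forall e : set nat, e `<=` `I_N -> X e = Y e) -> f X = f Y.

Definition parr (h : nat -> nat) (X : arr) : arr := fun e => X (h @` e).

(** Invariance is asked for maps injective on the vertices that [f] sees, not just for permutations,
    so that sample vertices can be moved into the reservoir directly. *)
Definition exch (E : (arr -> R) -> R) := forall (f : arr -> R) N h,
  bdf f -> fdep N f -> {in `I_N &, injective h} ->
  E (fun X => f (parr h X)) = E f.

Variables (k : nat) (G : nat -> kgraph k) (U : set_system nat).
Hypotheses (UU : UltraFilter U) (Uoo : \oo `<=` U).
Hypothesis Gbig : forall M : nat, \forall n \near \oo, (M <= nv (G n))%N.

(** Elements of [e] beyond the sample are dropped; a function with [fdep N] does not see this once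
    [N <= n]. *)
Definition garr n (K : kgraph k) (phi : {ffun 'I_n -> 'I_(nv K)}) : arr :=
  fun e => [set w | `[< exists2 v : 'I_n, e v & phi v = w >]]%SET \in edges K.

Definition uE_seq (f : arr -> R) n : R :=
  avg (fun phi : {ffun 'I_n -> 'I_(nv (G n))} => f (garr phi)).

Definition uE (f : arr -> R) : R := lim (uE_seq f @ U).

Lemma ultra_fmap (T : Type) (u : nat -> T) : UltraFilter (u @ U).
Proof.
split=> [|H HF sub]; first exact: fmap_proper_filter.
rewrite eqEsubset; split=> // A HA.
have [//|UA] := in_ultra_setVsetC (u @^-1` A) UU.
have HnA : H (~` A) by exact: sub.
by exfalso; apply: (@filter_not_empty _ H); rewrite -(setICr A); exact: (@filterI _ H).
Qed.

Lemma bounded_ultra_cvg (u : nat -> R) C : (forall n, `|u n| <= C) -> cvg (u @ U).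
Proof.
move=> uC; have := @segment_compact R (- C) C.
rewrite compact_ultra => /(_ (u @ U)) [].
- exact: ultra_fmap.
- apply: (@filterE _ U) => n /=; rewrite in_itv /= -ler_norml; exact: uC.
- move=> l [_ ul]; apply/cvg_ex; exists l; exact: ul.
Qed.

Lemma uE_cvg f : bdf f -> uE_seq f @ U --> uE f.
Proof.
move=> [C fC]; apply: (@bounded_ultra_cvg _ `|C|) => n.
by apply: avg_bound => // t; exact: le_trans (fC _) (ler_norm _).
Qed.

Lemma uE_lim f l : uE_seq f @ U --> l -> uE f = l.
Proof. by move=> h; apply/cvg_lim. Qed.

Lemma U_near (P : nat -> Prop) : (\forall n \near \oo, P n) -> \forall n \near U, P n.
Proof. exact: Uoo. Qed.

Lemma uE_mean : mean uE.
Proof.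
split.
- apply: uE_lim; apply: (@cvg_trans _ (fmap (fun=> 1 : R) U)); last exact: cvg_cst.
  apply: near_eq_cvg.
  apply: U_near; near=> n; rewrite /uE_seq avg_cst //.
  have n0 : (0 < nv (G n))%N by near: n; exact: Gbig.
  by rewrite card_ffun !card_ord expn_gt0 n0.
- move=> f g bf bg; apply: uE_lim.
  have -> : uE_seq (fun x => f x + g x) = uE_seq f + uE_seq g.
    by apply/funext => n; rewrite /uE_seq avgD.
  by apply: cvgD; exact: uE_cvg.
- move=> c f bf; apply: uE_lim.
  have -> : uE_seq (fun x => c * f x) = (fun n => c * uE_seq f n).
    by apply/funext => n; rewrite /uE_seq avgZl.
  by apply: cvgMr; exact: uE_cvg.
- move=> f bf f0; apply: (closed_cvg (fun x : R => 0 <= x)) (uE_cvg bf).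
  + exact: closed_ge.
  + by apply: nearW => n; apply: avg_ge0.
Unshelve. all: by end_near. Qed.

Lemma uE_eq f g : (\forall n \near \oo, uE_seq f n = uE_seq g n) -> uE f = uE g.
Proof.
move=> fg; rewrite /uE; congr lim; rewrite eqEsubset; split; apply: near_eq_cvg.
  by apply: U_near; apply: filterS fg => n.
by apply: U_near; apply: filterS fg => n.
Qed.

Lemma uE_seq_fdep f N (h : nat -> nat) n : fdep N f -> {in `I_N &, injective h} ->
  (forall u, (u < N)%N -> (h u < n)%N) -> (0 < nv (G n))%N ->
  uE_seq (fun X => f (parr h X)) n =
  avg (fun psi : {ffun 'I_N -> 'I_(nv (G n))} => f (garr psi)).
Proof.
move=> df inj hn n0.
pose h' (i : 'I_N) : 'I_n := Ordinal (hn i (ltn_ord i)).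
have inj' : injective h'.
  move=> i j /(congr1 val) /= e; apply/val_inj/inj => //; exact/mem_set/ltn_ord.
have V0 : (0 < #|'I_(nv (G n))|)%N by rewrite card_ord.
rewrite -(avg_marginal (fun psi : {ffun 'I_N -> 'I_(nv (G n))} => f (garr psi)) inj' V0).
rewrite /uE_seq; congr avg; apply/funext => phi; apply: df => e eN.
rewrite /parr /garr; apply: (congr1 (fun s : {set _} => s \in edges (G n))); apply/setP => w; rewrite !inE.
apply/asboolP/asboolP => [[v [u eu huv] <-]|[u eu <-]].
  have uN : (u < N)%N := eN _ eu.
  exists (Ordinal uN) => //; rewrite ffunE; congr (phi _).
  exact: val_inj.
by exists (h' u); [exists (val u) | rewrite ffunE].
Qed.

(** The marginal of a uniform map on any [N] coordinates is uniform, so the two averages are equal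
    for every large [n], before any limit is taken. *)
Lemma uE_exch : exch uE.
Proof.
move=> f N h bf df inj; apply: uE_eq.
have [B hB] : exists B, forall u, (u < N)%N -> (h u < B)%N.
  exists (\max_(u < N) (h u).+1)%N => u uN.
  exact: (leq_bigmax (Ordinal uN)).
near=> n.
have n0 : (0 < nv (G n))%N by near: n; exact: Gbig.
have nB : (B <= n)%N by near: n; exact: nbhs_infty_ge.
have nN : (N <= n)%N by near: n; exact: nbhs_infty_ge.
rewrite (uE_seq_fdep df inj _ n0); last by move=> u uN; exact: leq_trans (hB _ uN) nB.
have idi : {in `I_N &, injective (@id nat)} by [].
rewrite -(uE_seq_fdep df idi _ n0); last by move=> u uN; exact: leq_trans uN nN.
congr (uE_seq _ n); apply/funext => X; congr f; apply/funext => e.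
by rewrite /parr image_id.
Unshelve. all: by end_near. Qed.

Lemma mem_cset (T : finType) (b : pred T) x : (x \in [set y | b y]%classic) = b x.
Proof. by apply/idP/idP; rewrite in_setE. Qed.

(* vertex [i] of the sample is the number [2 i]; the odd numbers are kept as a reservoir *)
Definition sam m (A : {set 'I_m}) : set nat :=
  [set v | exists2 i : 'I_m, i \in A & v = (val i).*2].

(** Once [n] is at least twice [nv F], the sampled map restricted to the even numbers that represent
    the vertices of [F] is a uniform map into [G n], so the two sequences agree. *)
Lemma tG_uE (F : kgraph k) :
  tG R F (G n) @[n --> U] --> uE (fun X => \prod_(A in edges F) (X (sam A))%:R).
Proof.
set f := fun X : arr => _.
have bf : bdf f.
  apply: bdf01 => X; apply/andP; split; first exact: prodr_ge0.
  by apply: prodr_ile1 => A; case: (X _); rewrite ?ler01 ?lexx.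
apply: cvg_trans (uE_cvg bf); apply: near_eq_cvg; apply: U_near; near=> n.
have n0 : (0 < nv (G n))%N by near: n; exact: Gbig.
have nm : ((nv F).*2 <= n)%N by near: n; exact: nbhs_infty_ge.
have hn (u : 'I_(nv F)) : (u.*2 < n)%N.
  by apply: leq_trans nm; rewrite ltn_double.
pose h (i : 'I_(nv F)) : 'I_n := Ordinal (hn i).
have inj : injective h.
  by move=> i j /(congr1 val) /= /double_inj e; exact: val_inj.
have V0 : (0 < #|'I_(nv (G n))|)%N by rewrite card_ord.
transitivity (avg (fun psi : {ffun 'I_(nv F) -> 'I_(nv (G n))} =>
   \prod_(A in edges F) (psi @: A \in edges (G n))%:R : R)).
  rewrite -(avg_marginal _ inj V0) /uE_seq; congr avg; apply/funext => phi.
  apply: eq_bigr => A AF; rewrite /garr.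
  apply: (congr1 (fun s : {set _} => (s \in edges (G n))%:R)).
  apply/setP => w; rewrite inE; apply/asboolP/imsetP => [[v [i iA vi] <-]|[u uA ->]].
    by exists i => //; rewrite ffunE; congr (phi _); exact: val_inj.
  by exists (h u); [exists u | rewrite ffunE].
rewrite /tG /avg card_ffun !card_ord natrX; congr (_ / _).
rewrite -sum1_card natr_sum [RHS]big_mkcond /=; apply: eq_bigr => psi _.
rewrite mem_cset; case: ifP => [/forallP al|/negbT].
  by rewrite big1 // => A AF; have := al A; rewrite AF => /= ->.
rewrite negb_forall => /existsP[A]; rewrite negb_imply => /andP[AF /negbTE nA].
by rewrite (bigD1 A) //= nA mul0r.
Unshelve. all: by end_near. Qed.

End UltraMean.

(** * Colours and their conditional probabilities *)

Section Colours.
Variables (R : realType).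

(* bit [s] of the colour of a set of sample vertices is its adjacency to the
   reservoir set with code [s]; code [0] is the empty set *)
Definition dec (s : nat) : seq nat :=
  if s is s'.+1 then odflt [::] (unpickle s') else [::].
Definition cod (l : seq nat) : nat := (pickle l).+1.

Lemma codK : cancel cod dec.
Proof. by move=> l; rewrite /dec /cod pickleK. Qed.

Definition rsv (l : seq nat) : set nat := [set v | exists2 r, r \in l & v = r.*2.+1].

Definition colours m := {set 'I_m} -> nat -> bool.

Definition col m (X : arr) : colours m := fun A s => X (sam A `|` rsv (dec s)).

(* most recent bit first *)
Fixpoint rpre (c : nat -> bool) n : seq bool :=
  if n is n'.+1 then c n' :: rpre c n' else [::].

Definition pat (b : seq bool) (c : nat -> bool) : bool := b == rpre c (size b).

Lemma rpre_ext c c' n : (forall s, (s < n)%N -> c s = c' s) -> rpre c n = rpre c' n.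
Proof.
elim: n => //= n IH h; rewrite h // IH // => s sn; apply: h; exact: ltnW.
Qed.

Lemma size_rpre c n : size (rpre c n) = n.
Proof. by elim: n => //= n ->. Qed.

Lemma pat_cons y b c : pat (y :: b) c = (y == c (size b)) && pat b c.
Proof. by rewrite /pat /= eqseq_cons. Qed.

Lemma pat_ext b c c' : (forall s, (s < size b)%N -> c s = c' s) -> pat b c = pat b c'.
Proof. by move=> h; rewrite /pat (rpre_ext h). Qed.

(** The finite information available below [A]. Masking the other entries keeps one type of
    partition for all [A]. *)
Definition res m (A : {set 'I_m}) M (c : colours m) : {ffun {set 'I_m} * 'I_M -> bool} :=
  [ffun p : {set 'I_m} * 'I_M => (p.1 \proper A) && c p.1 p.2].

Definition cdep (S : Type) m N (Phi : colours m -> S) :=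
  forall c c', (forall B s, (s < N)%N -> c B s = c' B s) -> Phi c = Phi c'.

Lemma cdep_res m (A : {set 'I_m}) M : cdep M (res A M).
Proof. by move=> c c' h; apply/ffunP => -[B s]; rewrite !ffunE h. Qed.

Lemma cdep_bdf m N (Phi : colours m -> R) : cdep N Phi -> exists C, forall c, `|Phi c| <= C.
Proof.
move=> dP; pose un (t : {ffun {set 'I_m} * 'I_N -> bool}) : colours m :=
  fun B s => if insub s is Some i then t (B, i) else false.
exists (\sum_t `|Phi (un t)|) => c.
have -> : Phi c = Phi (un [ffun p : {set 'I_m} * 'I_N => c p.1 p.2]).
  by apply: dP => B s sN; rewrite /un insubT ffunE.
rewrite (bigD1 [ffun p : {set 'I_m} * 'I_N => c p.1 p.2]) //= lerDl; exact: sumr_ge0.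
Qed.

Lemma bdf_col m N (Phi : colours m -> R) : cdep N Phi -> bdf (fun X => Phi (col X)).
Proof. by move=> /cdep_bdf[C hC]; exists C. Qed.

Definition rbound N (Q : nat) := forall s r, (s < N)%N -> r \in dec s -> (r < Q)%N.

Lemma rbound_ex N : exists Q, forall Q', (Q <= Q')%N -> rbound N Q'.
Proof.
exists (\max_(s < N) \max_(r <- dec s) r.+1)%N => Q' QQ s r sN rs.
apply: leq_trans QQ; apply: leq_trans (leq_bigmax (Ordinal sN)) => /=.
exact: (@leq_bigmax_seq _ (dec s) xpredT (fun r => r.+1)).
Qed.

Lemma fdep_col m N (Phi : colours m -> R) Q : cdep N Phi -> rbound N Q -> (m <= Q)%N ->
  fdep Q.*2 (fun X => Phi (col X)).
Proof.
move=> dP bQ mQ X Y XY; apply: dP => B s sN; apply: XY => v.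
case=> [[i iB ->]|[r rs ->]] /=.
  by rewrite ltn_double (leq_trans (ltn_ord i)).
by rewrite ltn_Sdouble; exact: bQ sN rs.
Qed.

Section Mean.
Variables (E : (arr -> R) -> R).
Hypotheses (mE : mean E) (xE : exch E).

(** Conditional probability that the colour of [A] begins with the pattern [b], given the first [M]
    bits of the colours of the proper subsets of [A]. *)
Definition qq m (A : {set 'I_m}) M b (c : colours m) : R :=
  cexp E (fun X => res A M (col X)) (fun X => (pat b (col X A))%:R) (res A M c).

Lemma pat01 m b (A : {set 'I_m}) X : 0 <= ((pat b (col X A))%:R : R) <= 1.
Proof. by case: (pat _ _); rewrite ?lexx ?ler01. Qed.

Lemma qq01 m (A : {set 'I_m}) M b c : 0 <= qq A M b c <= 1.
Proof. by apply: cexp01 => // X; exact: pat01. Qed.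

Lemma cdep_qq m (A : {set 'I_m}) M b : cdep M (qq A M b).
Proof. by move=> c c' h; rewrite /qq (cdep_res A h). Qed.

Lemma qq_low m (A : {set 'I_m}) M b (c c' : colours m) :
  (forall (B : {set 'I_m}) s, B \proper A -> (s < M)%N -> c B s = c' B s) -> qq A M b c = qq A M b c'.
Proof.
move=> h; rewrite /qq; congr cexp; apply/ffunP => -[B s]; rewrite !ffunE /=.
by case: (boolP (B \proper A)) => //= BA; exact: h.
Qed.

(** Exchangeability for colours: the sample vertices move along [h] while the reservoir stays
    fixed. *)
Lemma mean_relabel m m' (h : 'I_m -> 'I_m') N (Phi : colours m -> R) :
  injective h -> cdep N Phi ->
  E (fun X => Phi (fun B => col X (h @: B))) = E (fun X => Phi (col X)).
Proof.
move=> inj dP.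
(* Even numbers that represent none of the [m] sample vertices go to [2 * m'] and beyond, clear of
   the images of [h]; this keeps [g] injective. *)
pose g v := if odd v then v else
  if insub v./2 is Some i then (val (h i)).*2 else (m' + v./2).*2.
have gE (i : 'I_m) : g i.*2 = (val (h i)).*2.
  by rewrite /g odd_double doubleK insubT //= => hi; congr (_ (h _)).*2; exact: val_inj.
have gO r : g r.*2.+1 = r.*2.+1 by rewrite /g /= odd_double.
have [Q0 hQ] := rbound_ex N; pose Q := maxn Q0 m.
have dQ : fdep Q.*2 (fun X => Phi (col X)).
  by apply: fdep_col dP _ _; [apply: hQ; exact: leq_maxl | exact: leq_maxr].
have gi : injective g.
  move=> u v; rewrite /g; case: ifP => [ou|/negbT ou]; case: ifP => [ov|/negbT ov] //.
  - case: insubP => [i _ _|_] e; move: ou; rewrite e odd_double //.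
  - case: insubP => [i _ _|_] e; move: ov; rewrite -e odd_double //.
  have uE : u = u./2.*2 by rewrite -[LHS]odd_double_half (negbTE ou).
  have vE : v = v./2.*2 by rewrite -[LHS]odd_double_half (negbTE ov).
  case: insubP => [i _ iu|nu]; case: insubP => [j _ jv|nv] /double_inj e.
  - by rewrite uE vE -iu -jv; congr (_.*2); congr val; apply/inj/val_inj.
  - by have := ltn_ord (h i); rewrite e; rewrite ltnNge leq_addr.
  - by have := ltn_ord (h j); rewrite -e; rewrite ltnNge leq_addr.
  - by move/addnI: e => e; rewrite uE vE e.
rewrite -(xE (bdf_col dP) dQ (h := g)); last by move=> u v _ _; exact: gi.
congr E; apply/funext => X; congr Phi; apply/funext => B; apply/funext => s.
rewrite /col /parr; congr X; rewrite eqEsubset; split=> v.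
  case=> [[i /imsetP[j jB ->] ->]|[r rs ->]].
    by exists j.*2; [left; exists j|rewrite gE].
  by exists r.*2.+1; [right; exists r|rewrite gO].
case=> u [[i iB ->] <-|[r rs ->] <-].
  by left; exists (h i); [rewrite imset_f|rewrite gE].
by right; exists r; rewrite ?gO.
Qed.

Definition relab m m' (h : 'I_m -> 'I_m') (c : colours m') : colours m := fun B => c (h @: B).

Lemma proper_imset m m' (h : 'I_m -> 'I_m') (A B : {set 'I_m}) : injective h ->
  (h @: B \proper h @: A) = (B \proper A).
Proof.
move=> inj; have sub (C D : {set 'I_m}) : (h @: C \subset h @: D) = (C \subset D).
  apply/idP/idP => [/fintype.subsetP s|CD]; last exact: imsetS.
  by apply/fintype.subsetP => i iC; have /imsetP[j jD /inj ->] := s _ (imset_f h iC).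
by rewrite !properE !sub.
Qed.

Lemma subset_imset m m' (h : 'I_m -> 'I_m') (A : {set 'I_m}) (C : {set 'I_m'}) :
  injective h -> C \subset h @: A -> exists2 B : {set 'I_m}, B \subset A & C = h @: B.
Proof.
move=> inj CA; exists (h @^-1: C :&: A)%SET; first exact: finset.subsetIr.
apply/setP => v; apply/idP/imsetP => [vC|[i]]; last by rewrite !inE => /andP[? _] ->.
have /imsetP[i iA e] := fintype.subsetP CA _ vC.
by exists i => //; rewrite !inE -e vC.
Qed.

Lemma res_relab m m' (h : 'I_m -> 'I_m') (A : {set 'I_m}) M (c c' : colours m') :
  injective h ->
  (res (h @: A) M c == res (h @: A) M c') = (res A M (relab h c) == res A M (relab h c')).
Proof.
move=> inj; apply/eqP/eqP => e; apply/ffunP => -[B s]; rewrite !ffunE /=.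
  case: (boolP (B \proper A)) => //= BA.
  by have /ffunP/(_ (h @: B, s)) := e; rewrite !ffunE /= proper_imset // BA.
case: (boolP (B \proper _)) => //= BA.
have [D DA eB] := subset_imset inj (proper_sub BA).
move: BA; rewrite eB proper_imset // => BA.
by have /ffunP/(_ (D, s)) := e; rewrite !ffunE /= BA.
Qed.

Lemma cdep_comp2 (S1 S2 S3 : Type) m N (f : colours m -> S1) (g : colours m -> S2) (F : S1 -> S2 -> S3) :
  cdep N f -> cdep N g -> cdep N (fun c => F (f c) (g c)).
Proof. by move=> df dg c c' h; rewrite (df _ _ h) (dg _ _ h). Qed.

Lemma cdepW (S : Type) m N N' (f : colours m -> S) : (N <= N')%N -> cdep N f -> cdep N' f.
Proof. by move=> NN df c c' h; apply: df => B s sN; apply: h; exact: leq_trans NN. Qed.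

Lemma cdep_pat m (A : {set 'I_m}) b : cdep (size b) (fun c : colours m => pat b (c A)).
Proof. by move=> c c' h; apply: pat_ext => s; exact: h. Qed.

Lemma qq_relab m m' (h : 'I_m -> 'I_m') (A : {set 'I_m}) M b c : injective h ->
  qq (h @: A) M b c = qq A M b (relab h c).
Proof.
move=> inj; pose N := maxn M (size b).
have d1 : cdep N (fun d : colours m => res A M d == res A M (relab h c)).
  by apply: (cdepW (leq_maxl _ _)) => d d' e; rewrite (cdep_res A e).
have d2 : cdep N (fun d : colours m => pat b (d A)).
  by apply: (cdepW (leq_maxr _ _)); exact: cdep_pat.
rewrite /qq /cexp; congr (_ / _).
  rewrite /cav -(mean_relabel (Phi := fun d => (pat b (d A))%:R * (res A M d == res A M (relab h c))%:R) inj
    (cdep_comp2 (fun x y : bool => (x%:R * y%:R : R)) d2 d1)).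
  by congr E; apply/funext => X; rewrite res_relab.
rewrite /cpr -(mean_relabel (Phi := fun d => (res A M d == res A M (relab h c))%:R) inj
    (cdep_comp2 (fun x y : bool => (x%:R : R)) d1 d2)).
by congr E; apply/funext => X; rewrite res_relab.
Qed.

(** [M] bits below [A] suffice for [b]: any further conditioning moves the probability by at most
    [d] in L1. *)
Definition good m (A : {set 'I_m}) b M (d : R) := forall M', (M <= M')%N ->
  E (fun X => `|qq A M' b (col X) - qq A M b (col X)|) <= d.

Lemma good_relab m m' (h : 'I_m -> 'I_m') (A : {set 'I_m}) b M d : injective h ->
  good A b M d -> good (h @: A) b M d.
Proof.
move=> inj gA M' MM; apply: le_trans (gA _ MM).
rewrite -(mean_relabel (N := M') (Phi := fun c => `|qq A M' b c - qq A M b c|) inj); last first.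
  apply: (cdep_comp2 (fun x y : R => `|x - y|)); first exact: cdep_qq.
  by apply: cdepW MM _; exact: cdep_qq.
rewrite le_eqVlt; apply/orP; left; apply/eqP.
by congr E; apply/funext => X; rewrite !qq_relab.
Qed.

(** The energies [en M] increase and are at most 1, hence converge. By Pythagoras a small energy
    gain is a small L2 distance, uniformly over all finer partitions. *)
Lemma good_ex m (A : {set 'I_m}) b d : 0 < d -> exists M0, forall M, (M0 <= M)%N -> good A b M d.
Proof.
move=> d0.
pose en M := E (fun X => qq A M b (col X) ^+ 2).
have bq M : bdf (fun X => qq A M b (col X)) by exact: (bdf_col (cdep_qq A b)).
have ref M M' : (M <= M')%N ->
    E (fun X => (qq A M' b (col X) - qq A M b (col X)) ^+ 2) = en M' - en M.
  move=> MM; pose rho (t : {ffun {set 'I_m} * 'I_M' -> bool}) : {ffun {set 'I_m} * 'I_M -> bool} :=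
    [ffun p : {set 'I_m} * 'I_M => t (p.1, widen_ord MM p.2)].
  apply: (mean_cexp_refine mE (rho := rho)); first by move=> X; exact: pat01.
  by move=> X; apply/ffunP => -[B s]; rewrite !ffunE.
have sqb (f : arr -> R) : bdf f -> bdf (fun X => f X ^+ 2).
  by move=> bf; under eq_fun do rewrite expr2; exact: bdfM.
have nd : nondecreasing_seq en.
  move=> M M' MM; rewrite -subr_ge0 -ref //; apply: (mean_ge0 mE) => [|X]; last exact: sqr_ge0.
  by apply: sqb; apply: bdfD => //; exact: bdfN.
have ub M : en M <= 1.
  rewrite -(mean1 mE); apply: le_mean => //; [exact: sqb | exact: bdf_cst |].
  by move=> X; have /andP[? ?] := qq01 A M b (col X); rewrite expr_le1.
have cv : cvgn en by apply: nondecreasing_is_cvgn => //; exists 1 => _ [M _ <-].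
(* With an energy gain of at most [d ^+ 2 / 4], the AM-GM bound below totals [d / 2 + d / 8], which
   is less than [d]. *)
have d4 : 0 < d ^+ 2 / 4 by rewrite divr_gt0 // exprn_gt0.
have /cvgrPdist_lt/(_ _ d4)[M0 _ hM0] := cv.
exists M0 => M M0M M' MM.
have eL : en M' - en M <= d ^+ 2 / 4.
  have h1 := hM0 M M0M; have h2 := nondecreasing_cvgn_le nd cv M'.
  have h3 := nondecreasing_cvgn_le nd cv M.
  move: h1; rewrite /= ger0_norm ?subr_ge0 //; lra.
(* AM-GM: |t| <= d/2 + t^2/(2d) *)
pose D X := qq A M' b (col X) - qq A M b (col X).
have bD : bdf D by apply: bdfD => //; exact: bdfN.
apply: (@le_trans _ _ (E (fun X => d / 2 + (2 * d)^-1 * D X ^+ 2))).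
  apply: le_mean => //; first exact: bdf_norm.
    by apply: bdfD; [exact: bdf_cst | apply: bdfM; [exact: bdf_cst | exact: sqb]].
  move=> X; have -> : D X ^+ 2 = `|D X| ^+ 2 by rewrite real_normK ?num_real.
  rewrite -/(D X); set t := `|D X|.
  have -> : d / 2 + (2 * d)^-1 * t ^+ 2 = (d ^+ 2 + t ^+ 2) / (2 * d).
    by field; rewrite gt_eqF.
  rewrite ler_pdivlMr; last by rewrite mulr_gt0.
  have := sqr_ge0 (d - t); rewrite !expr2; lra.
rewrite (meanD mE) ?(mean_cst mE) ?(meanZ mE); [|exact: sqb|exact: bdf_cst|]; last first.
  by apply: bdfM; [exact: bdf_cst | exact: sqb].
rewrite /D ref //.
have : (2 * d)^-1 * (en M' - en M) <= (2 * d)^-1 * (d ^+ 2 / 4).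
  by apply: ler_wpM2l => //; rewrite invr_ge0 mulr_ge0 // ltW.
have -> : (2 * d)^-1 * (d ^+ 2 / 4) = d / 8 by field; rewrite gt_eqF.
lra.
Qed.

End Mean.
End Colours.

(** * Conditional independence through the reservoir *)

Section Swap.
Variables (R : realType) (E : (arr -> R) -> R).
Hypotheses (mE : mean E) (xE : exch E).

Definition zdep m (A : {set 'I_m}) N (Z : colours m -> R) := forall c c',
  (forall (B : {set 'I_m}) s, ~~ (A \subset B) -> (s < N)%N -> c B s = c' B s) -> Z c = Z c'.

Lemma zdep_cdep m (A : {set 'I_m}) N Z : zdep A N Z -> cdep N Z.
Proof. by move=> dZ c c' h; apply: dZ => B s _; exact: h. Qed.

Definition ext m (A B : {set 'I_m}) Q : seq nat := [seq (Q + val i)%N | i <- enum (B :\: A)].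

Section Push.
Variables (m : nat) (A : {set 'I_m}) (Q : nat).

(* pushes the sample vertices outside [A] into the reservoir, beyond [Q] *)
Definition push (v : nat) : nat :=
  if odd v then v else
  if insub v./2 is Some i then if (i : 'I_m) \in A then v else (Q + v./2)%N.*2.+1 else v.

Lemma push_odd r : push r.*2.+1 = r.*2.+1.
Proof. by rewrite /push /= odd_double. Qed.

Lemma push_in (i : 'I_m) : i \in A -> push i.*2 = i.*2.
Proof.
by move=> iA; rewrite /push odd_double doubleK (valK i) iA.
Qed.

Lemma push_out (i : 'I_m) : i \notin A -> push i.*2 = (Q + i)%N.*2.+1.
Proof.
by move=> iA; rewrite /push odd_double doubleK (valK i) (negbTE iA).
Qed.

Lemma push_inj : {in `I_(Q.*2) &, injective push}.
Proof.
move=> u v /set_mem /= uQ /set_mem /= vQ; rewrite /push.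
have big w i : (Q + i)%N.*2.+1 = w -> (w < Q.*2)%N -> False.
  by move=> <-; rewrite ltn_Sdouble ltnNge leq_addr.
case: ifP => [ou|/negbT ou]; case: ifP => [ov|/negbT ov] //.
- by case: insubP => [i _ _|_] //; case: ifP => // _ e; case: (big _ _ (esym e) uQ).
- by case: insubP => [i _ _|_] //; case: ifP => // _ e; case: (big _ _ e vQ).
have uE : u = u./2.*2 by rewrite -[LHS]odd_double_half (negbTE ou).
have vE : v = v./2.*2 by rewrite -[LHS]odd_double_half (negbTE ov).
case: insubP => [i _ iu|nu]; case: insubP => [j _ jv|nv] //.
- case: ifP => _; case: ifP => _ // e.
  + by case: (big _ _ (esym e) uQ).
  + by case: (big _ _ e vQ).
  + by move: e => [] /double_inj /addnI e; rewrite uE vE e.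
- by case: ifP => _ // e; case: (big _ _ e vQ).
- by case: ifP => _ // e; case: (big _ _ (esym e) uQ).
Qed.

(** The part of [B] outside [A] moves to the reservoir, so the bit is one of the colour of
    [B :&: A], read at a longer reservoir set. *)
Lemma col_push X (B : {set 'I_m}) s :
  col (parr push X) B s = X (sam (B :&: A) `|` rsv (dec s ++ ext A B Q)).
Proof.
rewrite /col /parr; congr X; rewrite eqEsubset; split=> v.
  case=> u [[i iB ->]|[r rs ->]] <-.
    have [iA|iA] := boolP (i \in A).
      by rewrite push_in //; left; exists i => //; rewrite inE iB.
    rewrite push_out //; right; exists (Q + i)%N => //.
    by rewrite mem_cat; apply/orP; right; apply: map_f; rewrite mem_enum inE iA.
  by rewrite push_odd; right; exists r => //; rewrite mem_cat rs.
case=> [[i] |[r]].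
  by rewrite inE => /andP[iB iA] ->; exists i.*2; [left; exists i | rewrite push_in].
rewrite mem_cat => /orP[rs ->|].
  by exists r.*2.+1; [right; exists r | rewrite push_odd].
move=> /mapP[i]; rewrite mem_enum inE => /andP[iA iB] -> ->.
by exists i.*2; [left; exists i | rewrite push_out].
Qed.

Lemma col_push_sub X (B : {set 'I_m}) s : B \subset A -> col (parr push X) B s = col X B s.
Proof.
move=> BA; rewrite col_push (finset.setIidPl BA) /ext.
have -> : (B :\: A)%SET = finset.set0 by apply/eqP; rewrite finset.setD_eq0.
by rewrite enum_set0 cats0.
Qed.

End Push.

(** After the push, [Z] is a function of finitely many colour bits of proper subsets of [A], because
    [B :&: A] is proper whenever [A] is not contained in [B]. The pattern at [A] and its conditional
    probability are untouched. So the pattern may be replaced exactly by [qq] at a finer level [M'],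
    and [good] pays for returning to [M]. *)
Lemma swap_one m (A : {set 'I_m}) b M d N Z :
  good E A b M d -> (forall c, `|Z c| <= 1) -> zdep A N Z ->
  `|E (fun X => Z (col X) * (pat b (col X A))%:R) - E (fun X => Z (col X) * qq E A M b (col X))| <= d.
Proof.
move=> gA Z1 dZ.
pose N' := maxn N (maxn M (size b)).
have NN : (N <= N')%N by exact: leq_maxl.
have MN : (M <= N')%N by rewrite /N' leq_max leq_maxl orbT.
have bN : (size b <= N')%N by rewrite /N' leq_max leq_maxr orbT.
have dZ' : cdep N' Z by apply: (cdepW NN); exact: zdep_cdep dZ.
have dq : cdep N' (qq E A M b) by apply: (cdepW MN); exact: cdep_qq.
have dp : cdep N' (fun c : colours m => (pat b (c A))%:R : R).
  by move=> c c' h; rewrite (cdepW bN (cdep_pat A (b := b)) h).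
have d1 : cdep N' (fun c => Z c * (pat b (c A))%:R) by exact: (cdep_comp2 _ dZ' dp).
have d2 : cdep N' (fun c => Z c * qq E A M b c) by exact: (cdep_comp2 _ dZ' dq).
have [Q0 hQ] := rbound_ex N'; pose Q := maxn Q0 m.
have bQ : rbound N' Q by apply: hQ; exact: leq_maxl.
have mQ : (m <= Q)%N by exact: leq_maxr.
have pi := @push_inj m A Q.
rewrite -(xE (bdf_col d1) (fdep_col d1 bQ mQ) pi) -(xE (bdf_col d2) (fdep_col d2 bQ mQ) pi).
pose Z' (c : colours m) := Z (fun B s => c (B :&: A)%SET (cod (dec s ++ ext A B Q))).
have ZE X : Z (col (parr (push A Q) X)) = Z' (col X).
  by apply: dZ => B s _ _; rewrite col_push // /col codK.
have pE X : pat b (col (parr (push A Q) X) A) = pat b (col X A).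
  by apply: pat_ext => s _; rewrite col_push_sub.
have qE X : qq E A M b (col (parr (push A Q) X)) = qq E A M b (col X).
  by apply: qq_low => B s /proper_sub BA _; rewrite col_push_sub.
under eq_fun do rewrite ZE pE.
under [X in _ - E X]eq_fun do rewrite ZE qE.
(* Large enough for the codes of all reservoir sets that [Z'] reads. *)
pose M' := maxn M (\max_(B : {set 'I_m}) \max_(s < N) (cod (dec s ++ ext A B Q)).+1)%N.
have MM : (M <= M')%N by exact: leq_maxl.
have cM (B : {set 'I_m}) s : (s < N)%N -> (cod (dec s ++ ext A B Q) < M')%N.
  move=> sN; rewrite /M' leq_max; apply/orP; right.
  apply: leq_trans (leq_bigmax B) => /=.
  exact: (@leq_bigmax _ (fun s : 'I_N => (cod (dec s ++ ext A B Q)).+1) (Ordinal sN)).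
pose un (t : {ffun {set 'I_m} * 'I_M' -> bool}) : colours m :=
  fun B s => if insub s is Some i then t (B, i) else false.
have ZU X : Z' (col X) = Z' (un (res A M' (col X))).
  apply: dZ => B s AB sN; rewrite /un insubT ?cM // => hi; rewrite ffunE /=.
  by rewrite properE finset.subsetIr /= finset.subsetI (negbTE AB) /=.
have := mean_cexp mE (fun X => res A M' (col X)) (pat01 R b A) (fun t => Z' (un t)).
rewrite -/(qq E A M' b) => h.
have -> : E (fun X => Z' (col X) * (pat b (col X A))%:R) =
          E (fun X => Z' (col X) * qq E A M' b (col X)).
  by under eq_fun do rewrite ZU; rewrite h; under [in RHS]eq_fun do rewrite ZU.
have bZ' : bdf (fun X => Z' (col X)) by exists 1 => X; exact: Z1.
have bq K : bdf (fun X => qq E A K b (col X)) by exact: (bdf_col (cdep_qq E A b)).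
rewrite -meanB //; try exact: bdfM.
apply: le_trans (gA _ MM).
have bb : bdf (fun X => qq E A M' b (col X) - qq E A M b (col X)).
  by apply: bdfD => //; exact: bdfN.
apply: (le_trans (mean_norm mE _)).
  by apply: bdfD; [exact: bdfM | apply: bdfN; exact: bdfM].
apply: le_mean => //.
- by apply: bdf_norm; apply: bdfD; [exact: bdfM | apply: bdfN; exact: bdfM].
- exact: bdf_norm.
move=> X; rewrite -mulrBr normrM ler_piMl //; exact: Z1.
Qed.

(** One set is swapped at a time. The antichain condition keeps the weight admissible: neither a
    pattern at another set of [s] nor a conditional probability below it reads the colour of a set
    containing the one being swapped. *)
Lemma prod_swap m (s : seq {set 'I_m}) (b : {set 'I_m} -> seq bool) M d N (Z : colours m -> R) :
  uniq s -> (forall A, A \in s -> good E A (b A) M d) ->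
  (forall A A', A \in s -> A' \in s -> A != A' -> ~~ (A \subset A')) ->
  (forall c, `|Z c| <= 1) -> (forall A, A \in s -> zdep A N Z) ->
  `|E (fun X => Z (col X) * \prod_(A <- s) (pat (b A) (col X A))%:R)
    - E (fun X => Z (col X) * \prod_(A <- s) qq E A M (b A) (col X))| <= (size s)%:R * d.
Proof.
elim: s N Z => [|A s IH] N Z /=.
  move=> _ _ _ _ _; rewrite mul0r.
  under eq_fun do rewrite big_nil.
  by under [X in _ - E X]eq_fun do rewrite big_nil; rewrite subrr normr0.
move=> /andP[As us] gs anti Z1 dZ.
have sub A' : A' \in s -> A' \in A :: s by move=> h; rewrite inE h orbT.
have ne A' : A' \in s -> A' != A by move=> h; apply: contraNneq As => <-.
(* For the tail, the pattern at [A] joins the weight; for [A], the conditional probabilities of the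
   tail do. *)
pose Z1' c := Z c * (pat (b A) (c A))%:R.
pose Z2 c := Z c * \prod_(A' <- s) qq E A' M (b A') c.
have h1 := IH (maxn N (size (b A))) Z1' us (fun A' h => gs A' (sub _ h))
   (fun A1 A2 h1 h2 => anti A1 A2 (sub _ h1) (sub _ h2)).
have {}h1 : `|E (fun X => Z1' (col X) * \prod_(A <- s) (pat (b A) (col X A))%:R)
    - E (fun X => Z1' (col X) * \prod_(A <- s) qq E A M (b A) (col X))| <= (size s)%:R * d.
  apply: h1 => [c|A' A's].
    by rewrite normrM; case: (pat _ _); rewrite ?normr1 ?normr0 ?mulr1 ?mulr0.
  move=> c c' h; rewrite /Z1' (dZ A' (sub _ A's) c c'); last first.
    by move=> B t AB tN; apply: h => //; rewrite leq_max tN.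
  rewrite (pat_ext (c' := c' A)) // => t tb; apply: h; last by rewrite leq_max tb orbT.
  exact: anti (sub _ A's) (mem_head _ _) (ne _ A's).
have h2 : `|E (fun X => Z2 (col X) * (pat (b A) (col X A))%:R) - E (fun X => Z2 (col X) * qq E A M (b A) (col X))| <= d.
  apply: (@swap_one _ _ _ _ _ (maxn N M)); first exact: gs (mem_head _ _).
    move=> c; rewrite normrM; apply: (le_trans (y := 1 * 1)); last by rewrite mulr1.
    apply: ler_pM => //; rewrite ger0_norm; last by apply: prodr_ge0 => A' _; have /andP[] := qq01 mE A' M (b A') c.
    by apply: prodr_ile1 => A' _; exact: qq01.
  move=> c c' h; rewrite /Z2 (dZ A (mem_head _ _) c c'); last first.
    by move=> B t AB tN; apply: h => //; rewrite leq_max tN.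
  congr (_ * _); rewrite !big_seq; apply: eq_bigr => A' A's.
  apply: qq_low => B t BA' tM; apply: h; last by rewrite leq_max tM orbT.
  have := anti A A' (mem_head _ _) (sub _ A's); rewrite eq_sym ne // => /(_ isT).
  by apply: contra => /fintype.subset_trans; apply; exact: proper_sub.
have e1 : E (fun X => Z (col X) * \prod_(A0 <- A :: s) (pat (b A0) (col X A0))%:R) =
          E (fun X => Z1' (col X) * \prod_(A <- s) (pat (b A) (col X A))%:R).
  by congr E; apply/funext => X; rewrite big_cons mulrA.
have e2 : E (fun X => Z (col X) * \prod_(A0 <- A :: s) qq E A0 M (b A0) (col X)) =
          E (fun X => Z2 (col X) * qq E A M (b A) (col X)).
  by congr E; apply/funext => X; rewrite big_cons /Z2 mulrA mulrAC.
have e3 : E (fun X => Z1' (col X) * \prod_(A <- s) qq E A M (b A) (col X)) =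
          E (fun X => Z2 (col X) * (pat (b A) (col X A))%:R).
  by congr E; apply/funext => X; rewrite /Z1' /Z2 mulrAC.
rewrite e1 e2; move: h1 h2; rewrite e3 => h1 h2.
rewrite -natr1 mulrDl mul1r; apply: le_trans (lerD h1 h2).
by rewrite -[X in `|X| <= _](subrKA (E (fun X => Z2 (col X) * (pat (b A) (col X A))%:R))) ler_normD.
Qed.

End Swap.

(** * Coding the conditional laws by intervals *)

Section Coding.
Variable R : realType.
Notation mu01 := (mu01 R).

(* the subintervals of [0, 1[ coding bit strings (most recent bit first); the
   string [true :: b] gets mass [kappa (true :: b)], truncated to what is left *)
Fixpoint itvc (kappa : seq bool -> R) (b : seq bool) : R * R :=
  if b is y :: b' then
    let lh := itvc kappa b' in
    let mid := lh.2 - Num.min (kappa (true :: b')) (lh.2 - lh.1) in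
    if y then (mid, lh.2) else (lh.1, mid)
  else (0, 1).

Definition midc kappa b : R :=
  (itvc kappa b).2 - Num.min (kappa (true :: b)) ((itvc kappa b).2 - (itvc kappa b).1).

Definition pk kappa b : R := (itvc kappa b).2 - (itvc kappa b).1.

(** Inverse of the coding: the address of [xi] in the nested intervals, of which [Qb] is the bit at
    position [n]. *)
Fixpoint pfc kappa (xi : R) n : seq bool :=
  if n is n'.+1 then (midc kappa (pfc kappa xi n') <= xi) :: pfc kappa xi n' else [::].

Definition Qb kappa xi n : bool := midc kappa (pfc kappa xi n) <= xi.

Lemma rpre_Qb kappa xi n : rpre (Qb kappa xi) n = pfc kappa xi n.
Proof. by elim: n => //= n ->. Qed.

Lemma pk_nil kappa : pk kappa [::] = 1. Proof. by rewrite /pk subr0. Qed.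

Lemma pk_true kappa b : pk kappa (true :: b) = Num.min (kappa (true :: b)) (pk kappa b).
Proof. by rewrite /pk /= opprB addrC subrK. Qed.

Lemma pk_false kappa b : pk kappa (false :: b) = pk kappa b - pk kappa (true :: b).
Proof. by rewrite pk_true /pk /=; ring. Qed.

Lemma itvc_ext kappa kappa' b : kappa =1 kappa' -> itvc kappa b = itvc kappa' b.
Proof. by move=> e; elim: b => //= y b ->; rewrite e. Qed.

Lemma Qb_ext kappa kappa' xi n : kappa =1 kappa' -> Qb kappa xi n = Qb kappa' xi n.
Proof.
move=> e; have me b : midc kappa b = midc kappa' b by rewrite /midc (itvc_ext b e) e.
rewrite /Qb me; congr (midc kappa' _ <= _).
by elim: n => //= n ->; rewrite me.
Qed.

Lemma pk_ge0 kappa b : (forall b, 0 <= kappa b) -> 0 <= pk kappa b.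
Proof.
move=> k0; elim: b => [|[] b IH]; first by rewrite pk_nil.
  by rewrite pk_true le_min k0.
by rewrite pk_false subr_ge0 pk_true ge_min lexx orbT.
Qed.

Lemma pk_le1 kappa b : (forall b, 0 <= kappa b) -> pk kappa b <= 1.
Proof.
move=> k0; elim: b => [|[] b IH]; first by rewrite pk_nil.
  by rewrite pk_true ge_min IH orbT.
by rewrite pk_false lerBlDr (le_trans IH) // lerDl pk_ge0.
Qed.

Lemma midc_btw kappa b : (forall b, 0 <= kappa b) ->
  (itvc kappa b).1 <= midc kappa b <= (itvc kappa b).2.
Proof.
move=> k0; have p0 := pk_ge0 b k0; rewrite /midc; apply/andP; split.
  by rewrite lerBrDl -lerBrDr ge_min lexx orbT.
by rewrite gerBl le_min k0.
Qed.

Lemma itvc01 kappa b : (forall b, 0 <= kappa b) ->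
  0 <= (itvc kappa b).1 /\ (itvc kappa b).2 <= 1.
Proof.
move=> k0; elim: b => [|y b [IH1 IH2]] //=.
have /andP[h1 h2] := midc_btw b k0; rewrite -/(midc kappa b).
by case: y => /=; split => //; [exact: le_trans h1|exact: le_trans IH2].
Qed.

Lemma pat_Qb kappa xi b : (forall b, 0 <= kappa b) -> 0 <= xi < 1 ->
  pat b (Qb kappa xi) = ((itvc kappa b).1 <= xi < (itvc kappa b).2).
Proof.
move=> k0 x01; elim: b => [|y b IH]; first by rewrite /pat /= x01.
rewrite pat_cons IH; have /andP[h1 h2] := midc_btw b k0.
have [hb|/negP hb] := boolP ((itvc kappa b).1 <= xi < (itvc kappa b).2); last first.
  rewrite andbF /= -/(midc kappa b); apply/esym/negP => h; apply: hb.
  case: y h => /= /andP[? ?]; apply/andP; split => //.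
    exact: (le_trans h1).
  by apply: lt_le_trans h2.
have e : Qb kappa xi (size b) = (midc kappa b <= xi).
  by move: IH; rewrite hb /pat rpre_Qb /Qb => /eqP <-.
rewrite e andbT /= -/(midc kappa b); case/andP: hb => hb1 hb2.
by case: y; rewrite /= ?hb1 ?hb2 ?andbT /=; case: (leP (midc kappa b) xi).
Qed.

Lemma pat_Qb_cons kappa xi y b :
  pat (y :: b) (Qb kappa xi) = (y == (midc kappa b <= xi)) && pat b (Qb kappa xi).
Proof.
rewrite pat_cons; have [hb|] := boolP (pat b (Qb kappa xi)); last by rewrite !andbF.
by move: hb; rewrite /pat rpre_Qb !andbT /Qb => /eqP <-.
Qed.

Lemma int_pat_Qb kappa b : (forall b, 0 <= kappa b) ->
  \int[mu01]_t (pat b (Qb kappa t))%:R = pk kappa b.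
Proof.
move=> k0; set f := fun t => _.
have [lo0 hi1] := itvc01 b k0; have p0 := pk_ge0 b k0; rewrite /pk in p0 *.
set lo := (itvc kappa b).1 in lo0 p0 *; set hi := (itvc kappa b).2 in hi1 p0 *.
have fE t : 0 <= t < 1 -> f t = \1_(`[lo, hi[%classic) t.
  by move=> t01; rewrite /f pat_Qb // indicE mem_setE in_itv.
have f01 t : 0 <= f t by rewrite /f; case: pat; rewrite ?lexx ?ler01.
have mf : measurable_fun setT (EFin \o f).
  apply/measurable_EFinP; rewrite /f.
  elim: (b) => [|y b' IH]; first by under eq_fun do rewrite /pat /=; exact: measurable_cst.
  have -> : (fun t => (pat (y :: b') (Qb kappa t))%:R : R) =
     (fun t => (if y then (midc kappa b' <= t)%R%:R else (t < midc kappa b')%R%:R)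
               * (pat b' (Qb kappa t))%:R).
    apply/funext => t; rewrite pat_Qb_cons -mulnb natrM; congr (_ * _).
    by case: y; case: (leP (midc kappa b') t).
  apply: measurable_funM IH; case: y.
    have -> : (fun t => (midc kappa b' <= t)%R%:R : R) = \1_(`[midc kappa b', +oo[%classic).
      by apply/funext => t; rewrite indicE mem_setE in_itv /= andbT.
    exact: measurable_indic.
  have -> : (fun t => (t < midc kappa b')%R%:R : R) = \1_(`]-oo, midc kappa b'[%classic).
    by apply/funext => t; rewrite indicE mem_setE in_itv /=.
  exact: measurable_indic.
rewrite /Rintegral integral_uniform //.
(* The coding intervals partition the half-open [[0, 1[]; the point 1 is dropped as a null set. *)
rewrite subr0 invr1 mul1e -integral_itv_bndo_bndc; last exact: measurable_funTS.
transitivity (fine (\int[lebesgue_measure]_(t in `[0, 1[) (\1_(`[lo, hi[%classic) t)%:E)).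
  congr fine; apply: eq_integral => t; rewrite inE /= in_itv /= => t01.
  by rewrite -fE.
rewrite integral_indic //= (_ : `[lo, hi[%classic `&` _ = `[lo, hi[%classic); last first.
  rewrite eqEsubset; split=> t /=; first by case.
  rewrite !in_itv /= => h; split=> //; have /andP[h1 h2] := h.
  by rewrite (le_trans lo0 h1) (lt_le_trans h2 hi1).
rewrite lebesgue_measure_itv /= lte_fin; case: ltP => [//|h].
by apply/esym/eqP; rewrite /= subr_eq0 eq_le h -subr_ge0 p0.
Qed.

(** A limsup is defined and measurable at every point; [lsup_close] will show that it is also the
    limit in mean. *)
Definition lsup (u : nat -> R) : R := fine (limn_esup (EFin \o u)).

Lemma limn_esup_btw (u : nat -> R) (a c : R) N :
  (forall n, (N <= n)%N -> a <= u n <= c) ->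
  (a%:E <= limn_esup (EFin \o u) <= c%:E)%E.
Proof.
move=> h; rewrite /limn_esup /limf_esup; apply/andP; split.
  apply: le_ereal_inf_tmp => _ [V [M _ MV] <-].
  have hV : V (maxn M N) by apply: MV => /=; exact: leq_maxl.
  apply: (@le_trans _ _ (u (maxn M N))%:E).
    by rewrite lee_fin; have /andP[] := h (maxn M N) (leq_maxr _ _).
  by apply: ereal_sup_ubound; exists (maxn M N).
apply: (@le_trans _ _ (ereal_sup ((EFin \o u) @` [set n | (N <= n)%N]))).
  apply: ereal_inf_lbound; exists [set n | (N <= n)%N] => //.
  by exists N.
apply: ge_ereal_sup => _ [n nN <-]; rewrite /= lee_fin.
by have /andP[] := h n nN.
Qed.

Lemma lsup_btw (u : nat -> R) (a c : R) N :
  (forall n, (N <= n)%N -> a <= u n <= c) -> a <= lsup u <= c.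
Proof.
move=> h; have /andP[] := limn_esup_btw h; rewrite /lsup.
by case: (limn_esup _) => [r||] //=; rewrite !lee_fin => -> ->.
Qed.

(** Every term after [i] lies within the sum of the later increments, hence so does the limsup;
    where the series diverges the bound is vacuous. *)
Lemma lsup_close (u : nat -> R) i :
  ((`|lsup u - u i|)%:E <= \sum_(0 <= n <oo) (`|u (i + n).+1 - u (i + n)%N|)%:E)%E.
Proof.
set S := (\sum_(0 <= n <oo) _)%E.
have S0 : (0 <= S)%E by apply: nneseries_ge0 => n _ _; rewrite lee_fin.
have [->|Soo] := eqVneq S +oo%E; first by rewrite leey.
have [s Ss] : exists s, S = s%:E.
  by move: S0 Soo; case: S => [r||] // _ _; exists r.
have part N : \sum_(0 <= n < N) `|u (i + n).+1 - u (i + n)%N| <= s.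
  rewrite -lee_fin -Ss -sumEFin; apply: nneseries_lim_ge => n _ _.
  by rewrite lee_fin.
have near n : (i <= n)%N -> `|u n - u i| <= s.
  move=> /subnKC <-; apply: le_trans (part (n - i)%N).
  elim: (n - i)%N => [|j IH]; first by rewrite addn0 subrr normr0 big_nil.
  rewrite big_nat_recr //= addnS; apply: le_trans (lerD IH (lexx _)).
  rewrite (_ : u _ - u i = (u (i + j)%N - u i) + (u (i + j).+1 - u (i + j)%N)).
    exact: ler_normD.
  by rewrite [RHS]addrC addrA subrK.
have /andP[h1 h2] : u i - s <= lsup u <= u i + s.
  apply: (@lsup_btw _ _ _ i) => n /near; rewrite ler_norml => /andP[? ?].
  by apply/andP; split; lra.
by rewrite Ss lee_fin ler_norml; apply/andP; split; lra.
Qed.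

Lemma bmf_lsup (I : Type) (f : nat -> (I -> R) -> R) :
  (forall n, bmf (f n)) -> (forall n x, 0 <= f n x <= 1) -> bmf (fun x => lsup (fun n => f n x)).
Proof.
move=> bf f01; split; last first.
  exists 1 => x; have /andP[h0 h1] : 0 <= lsup (fun n => f n x) <= 1.
    by apply: (@lsup_btw _ _ _ 0) => n _; exact: f01.
  by rewrite ger0_norm.
rewrite /lsup; apply: measurableT_comp => //.
apply: (@measurable_fun_limn_esup _ (cube R I) R setT (fun n => EFin \o f n)) => n.
by apply/measurable_EFinP; exact: (bf n).1.
Qed.

Lemma bmf_min (I : Type) (f g : (I -> R) -> R) : bmf f -> bmf g -> bmf (fun x => Num.min (f x) (g x)).
Proof.
move=> bf bg; under eq_fun do rewrite minr_absE.
by apply: bmfM; [apply: bmfB; [exact: bmfD | exact/bmf_norm/bmfB]|exact: bmf_cst].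
Qed.

Lemma bmf_itvc (I : Type) (kappa : (I -> R) -> seq bool -> R) :
  (forall b, bmf (fun x => kappa x b)) ->
  forall b, bmf (fun x => (itvc (kappa x) b).1) /\ bmf (fun x => (itvc (kappa x) b).2).
Proof.
move=> bk; elim=> [|y b [IH1 IH2]] /=; first by split; exact: bmf_cst.
have bm : bmf (fun x => (itvc (kappa x) b).2 - Num.min (kappa x (true :: b))
   ((itvc (kappa x) b).2 - (itvc (kappa x) b).1)).
  by apply: bmfB => //; apply: bmf_min => //; exact: bmfB.
by case: y.
Qed.

Lemma bmf_pk (I : Type) (kappa : (I -> R) -> seq bool -> R) :
  (forall b, bmf (fun x => kappa x b)) -> forall b, bmf (fun x => pk (kappa x) b).
Proof. by move=> bk b; have [? ?] := bmf_itvc bk b; exact: bmfB. Qed.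

Lemma bmf_patQ (I : Type) (kappa : (I -> R) -> seq bool -> R) (i : I) :
  (forall b, bmf (fun x => kappa x b)) ->
  forall b, bmf (fun x => (pat b (Qb (kappa x) (x i)))%:R : R).
Proof.
move=> bk; elim=> [|y b IH]; first by under eq_fun do rewrite /pat /=; exact: bmf_cst.
under eq_fun do rewrite pat_Qb_cons -mulnb natrM.
apply: bmfM IH.
have bm : bmf (fun x => midc (kappa x) b).
  have [? ?] := bmf_itvc bk b; rewrite /midc.
  by apply: bmfB => //; apply: bmf_min => //; exact: bmfB.
have b1 : bmf (fun x : I -> R => (x i < midc (kappa x) b)%R%:R : R).
  by apply: bmf_lt; [exact: measurable_coord | exact: bm.1].
case: y; last first.
  rewrite (_ : (fun x => (false == _)%:R) = (fun x => (x i < midc (kappa x) b)%R%:R)) //.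
  by apply/funext => x; rewrite leNgt; case: (_ < _).
have -> : (fun x => (true == (midc (kappa x) b <= x i))%:R : R) =
  (fun x => 1 - (x i < midc (kappa x) b)%R%:R).
  by apply/funext => x; rewrite leNgt; case: (_ < _); rewrite /= ?subrr ?subr0.
by apply: bmfB => //; exact: bmf_cst.
Qed.

Lemma bmf_Qb (I : Type) (kappa : (I -> R) -> seq bool -> R) (i : I) :
  (forall b, bmf (fun x => kappa x b)) ->
  forall n, bmf (fun x => (Qb (kappa x) (x i) n)%:R : R).
Proof.
move=> bk n.
have -> : (fun x => (Qb (kappa x) (x i) n)%:R : R) =
  (fun x => \sum_(b : n.-tuple bool) (pat (true :: b) (Qb (kappa x) (x i)))%:R).
  apply/funext => x; set c := Qb _ _.
  have sz : size (rpre c n) == n by rewrite size_rpre.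
  rewrite (bigD1 (Tuple sz)) //= big1 ?addr0; last first.
    move=> b; rewrite -val_eqE /= => nb; rewrite pat_cons /pat size_tuple.
    by rewrite (negbTE nb) andbF.
  by rewrite pat_cons /pat /= size_rpre eqxx andbT; case: (c n).
by apply: bmf_sum => b _; exact: bmf_patQ.
Qed.

End Coding.

Section Generic.
Variable R : realType.

Lemma dist_prod (T : Type) (s : seq T) (f g : T -> R) :
  (forall t, 0 <= f t <= 1) -> (forall t, 0 <= g t <= 1) ->
  `|\prod_(t <- s) f t - \prod_(t <- s) g t| <= \sum_(t <- s) `|f t - g t|.
Proof.
move=> f01 g01; elim: s => [|t s IH]; first by rewrite !big_nil subrr normr0.
rewrite !big_cons.
rewrite (_ : f t * _ - _ = (f t - g t) * \prod_(j <- s) f j +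
   g t * (\prod_(j <- s) f j - \prod_(j <- s) g j)); last by ring.
apply: (le_trans (ler_normD _ _)); apply: lerD; rewrite normrM.
  rewrite ler_piMr // ger0_norm; last by apply: prodr_ge0 => j _; have /andP[] := f01 j.
  by apply: prodr_ile1 => j _; exact: f01.
apply: le_trans IH; rewrite ler_piMl //; have /andP[h0 h1] := g01 t.
by rewrite ger0_norm.
Qed.

(** Only a finite table of bits matters, so the function is a finite combination of products of bit
    indicators. *)
Lemma bmf_cdep (I : Type) m N (Phi : colours m -> R) (c : (I -> R) -> colours m) :
  cdep N Phi -> (forall B s, bmf (fun x => (c x B s)%:R : R)) -> bmf (fun x => Phi (c x)).
Proof.
move=> dP bc; pose un (t : {ffun {set 'I_m} * 'I_N -> bool}) : colours m :=
  fun B s => if insub s is Some i then t (B, i) else false.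
have -> : (fun x => Phi (c x)) = (fun x => \sum_(t : {ffun {set 'I_m} * 'I_N -> bool})
   Phi (un t) * \prod_(p : {set 'I_m} * 'I_N) (c x p.1 p.2 == t p)%:R).
  apply/funext => x; pose t0 := [ffun p : {set 'I_m} * 'I_N => c x p.1 p.2].
  rewrite (bigD1 t0) //= [X in _ * X]big1 ?mulr1; last by move=> p _; rewrite ffunE eqxx.
  rewrite [X in _ + X]big1 ?addr0 => [|t tt0].
    by apply: dP => B s sN; rewrite /un insubT ffunE.
  suff [p hp] : exists p : {set 'I_m} * 'I_N, c x p.1 p.2 != t p.
    by rewrite (bigD1 p) //= (negbTE hp) mul0r mulr0.
  apply/existsP; apply: contraNT tt0; rewrite negb_exists => /forallP h.
  by apply/eqP/ffunP => p; rewrite ffunE; have := h p; rewrite negbK => /eqP->.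
apply: bmf_sum => t _; apply: bmfM; first exact: bmf_cst.
apply: bmf_prod => -[B s] _; case: (t _).
  by under eq_fun => x do rewrite eqb_id; exact: bc.
have -> : (fun x => (c x B s == false)%:R : R) = (fun x => 1 - (c x B s)%:R).
  by apply/funext => x; case: (c x B s); rewrite /= ?subrr ?subr0.
by apply: bmfB => //; exact: bmf_cst.
Qed.

End Generic.

(** * Colours rebuilt from uniform variables *)

Section Gamma.
Variables (R : realType) (E : (arr -> R) -> R) (Mseq : nat -> nat).
Hypotheses (mE : mean E) (xE : exch E).

(** Geometric, so that the telescoping tail from [i] on is still of order [rate i]. *)
Definition rate i : R := (4^-1) ^+ i.

Definition kap m (A : {set 'I_m}) (c : colours m) (b : seq bool) : R :=
  lsup (fun i => qq E A (Mseq i) b c).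

Fixpoint Gamn m n (x : {set 'I_m} -> R) : colours m := fun A =>
  if n is n'.+1 then Qb (kap A (Gamn n' x)) (x A) else fun=> false.

Lemma GamnS m n (x : {set 'I_m} -> R) A : Gamn n.+1 x A = Qb (kap A (Gamn n x)) (x A).
Proof. by []. Qed.

(* [Gamn] recurses on fuel; [#|A|.+1] is always enough ([Gamn_fuel]) *)
Definition Gam m (x : {set 'I_m} -> R) : colours m := fun A => Gamn #|A|.+1 x A.

Lemma kap01 m (A : {set 'I_m}) c b : 0 <= kap A c b <= 1.
Proof. by apply: (@lsup_btw _ _ _ _ 0) => n _; exact: qq01. Qed.

Lemma kap_ge0 m (A : {set 'I_m}) c b : 0 <= kap A c b.
Proof. by have /andP[] := kap01 A c b. Qed.

Lemma kap_low m (A : {set 'I_m}) (c c' : colours m) :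
  (forall B : {set 'I_m}, B \proper A -> c B = c' B) -> kap A c =1 kap A c'.
Proof.
move=> h b; rewrite /kap; congr lsup; apply/funext => i.
by apply: qq_low => B s BA _; rewrite h.
Qed.

Lemma Gamn_fuel m (x : {set 'I_m} -> R) n (A : {set 'I_m}) : (#|A| < n)%N -> Gamn n x A = Gam x A.
Proof.
have [k] := ubnP #|A|; elim: k => [|k IH] in n A *; first by move=> h0; exfalso; rewrite ltn0 in h0.
rewrite ltnS => Ak; case: n => [|n]; first by move=> h0; exfalso; rewrite ltn0 in h0.
rewrite ltnS => An.
rewrite /Gam !GamnS; apply/funext => s; apply: Qb_ext; apply: kap_low => B BA.
have BA' := proper_card BA.
have Bk : (#|B| < k)%N by exact: leq_trans BA' Ak.
have Bn : (#|B| < n)%N by exact: leq_trans BA' An.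
by rewrite (IH n B Bk Bn) (IH #|A| B Bk BA').
Qed.

Lemma GamE m (x : {set 'I_m} -> R) A : Gam x A = Qb (kap A (Gam x)) (x A).
Proof.
rewrite {1}/Gam GamnS; apply/funext => s; apply: Qb_ext; apply: kap_low => B BA.
by rewrite Gamn_fuel // proper_card.
Qed.

Opaque Gam Gamn.

Lemma Gam_dep m (x y : {set 'I_m} -> R) (A : {set 'I_m}) :
  (forall B : {set 'I_m}, B \subset A -> x B = y B) -> Gam x A = Gam y A.
Proof.
have [k] := ubnP #|A|; elim: k => [|k IH] in A *; first by move=> h0; exfalso; rewrite ltn0 in h0.
rewrite ltnS => Ak xy.
rewrite (GamE x) (GamE y) (xy A (subxx A)); apply/funext => s; apply: Qb_ext; apply: kap_low => B BA.
apply: IH => [|C CB]; first exact: leq_trans (proper_card BA) Ak.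
by apply: xy; exact: fintype.subset_trans CB (proper_sub BA).
Qed.

Lemma Gam_relab m m' (h : 'I_m -> 'I_m') (x : {set 'I_m'} -> R) (B : {set 'I_m}) : injective h ->
  Gam x (h @: B) = Gam (pull h x) B.
Proof.
move=> inj; have [k] := ubnP #|B|; elim: k => [|k IH] in B *; first by move=> h0; exfalso; rewrite ltn0 in h0.
rewrite ltnS => Bk.
rewrite (GamE x) (GamE (pull h x)); apply/funext => s; apply: Qb_ext => b; rewrite /kap; congr lsup.
apply/funext => i; rewrite (qq_relab xE _ _ _ _ inj).
apply: qq_low => C s' CB _.
by rewrite /relab (IH C (leq_trans (proper_card CB) Bk)).
Qed.

Lemma bmf_kap (I : Type) m (A : {set 'I_m}) (c : (I -> R) -> colours m) :
  (forall (B : {set 'I_m}) s, B \proper A -> bmf (fun x => (c x B s)%:R : R)) ->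
  forall b, bmf (fun x => kap A (c x) b).
Proof.
move=> bc b; apply: bmf_lsup => [n|n x]; last exact: qq01.
(* Measurability is known only for the colours below [A] when this is used in the induction; the
   others are masked. *)
pose c' x : colours m := fun B s => (B \proper A) && c x B s.
have -> : (fun x => qq E A (Mseq n) b (c x)) = (fun x => qq E A (Mseq n) b (c' x)).
  by apply/funext => x; apply: qq_low => B s BA _; rewrite /c' BA.
apply: bmf_cdep; first exact: cdep_qq.
move=> B s; rewrite /c'; case: (boolP (B \proper A)) => [BA|_] /=.
  exact: bc.
exact: bmf_cst.
Qed.

Lemma bmf_Gam m (A : {set 'I_m}) s : bmf (fun x => (Gam x A s)%:R : R).
Proof.
have [k] := ubnP #|A|; elim: k => [|k IH] in A s *; first by move=> h0; exfalso; rewrite ltn0 in h0.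
rewrite ltnS => Ak.
under eq_fun do rewrite GamE.
apply: bmf_Qb; apply: bmf_kap => B s' BA; apply: IH.
exact: leq_trans (proper_card BA) Ak.
Qed.

Lemma bmf_cdepG m N (Phi : colours m -> R) : cdep N Phi -> bmf (fun x => Phi (Gam x)).
Proof. by move=> dP; apply: bmf_cdep dP _ => B s; exact: bmf_Gam. Qed.

(** Probability, given the coordinates below [A], that the rebuilt colour of [A] begins with [b]. At
    [[:: true]] it is the edge probability, bit 0 being the adjacency of [A] alone. *)
Definition wp m (A : {set 'I_m}) b (x : {set 'I_m} -> R) : R := pk (kap A (Gam x)) b.

Lemma bmf_wp m (A : {set 'I_m}) b : bmf (wp A b).
Proof. by apply: bmf_pk; apply: bmf_kap => B s _; exact: bmf_Gam. Qed.

Lemma wp01 m (A : {set 'I_m}) b x : 0 <= wp A b x <= 1.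
Proof. by rewrite /wp pk_ge0 ?pk_le1 // => b'; exact: kap_ge0. Qed.

Lemma wp_dep m (A : {set 'I_m}) b (x y : {set 'I_m} -> R) :
  (forall B : {set 'I_m}, B \proper A -> x B = y B) -> wp A b x = wp A b y.
Proof.
move=> xy; have e : kap A (Gam x) =1 kap A (Gam y).
  apply: kap_low => B BA; apply: Gam_dep => C CB; apply: xy.
  exact: fintype.sub_proper_trans CB BA.
rewrite /wp /pk (itvc_ext b e); reflexivity.
Qed.

Lemma wp_relab m m' (h : 'I_m -> 'I_m') (A : {set 'I_m}) b (x : {set 'I_m'} -> R) : injective h ->
  wp (h @: A) b x = wp A b (pull h x).
Proof.
move=> inj; rewrite /wp /pk (itvc_ext (kappa' := kap A (Gam (pull h x)))) // => b'.
rewrite /kap; congr lsup; apply/funext => i; rewrite (qq_relab xE _ _ _ _ inj).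
apply: qq_low => B s BA _.
by rewrite /relab (Gam_relab _ _ inj).
Qed.

Hypothesis Mseq_nd : forall i j, (i <= j)%N -> (Mseq i <= Mseq j)%N.
Hypothesis Mseq_good : forall i a b, (a <= i)%N -> (size b <= i)%N ->
  good E [set: 'I_a]%SET b (Mseq i) (rate i).

Lemma rate_gt0 i : 0 < rate i. Proof. by rewrite exprn_gt0 ?invr_gt0. Qed.

Lemma sum_rate i N : \sum_(0 <= n < N) rate (i + n) <= 2 * rate i.
Proof.
suff : \sum_(0 <= n < N) rate (i + n) + 2 * rate (i + N) <= 2 * rate i.
  by have := rate_gt0 (i + N); lra.
elim: N => [|N IH]; first by rewrite big_nil addn0 add0r.
rewrite big_nat_recr //= addnS; apply: le_trans IH.
have -> : rate (i + N).+1 = rate (i + N) / 4 by rewrite /rate exprSr.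
by have := rate_gt0 (i + N); lra.
Qed.

Lemma rate_cvg c : (fun i => c * rate i) @ \oo --> (0 : R).
Proof. by apply: cvg_geometric; rewrite ger0_norm ?invr_ge0 // invf_lt1 ?ltr1n. Qed.

Section Induction.
Variable m : nat.

(** Relabelling reduces every [A] to a full set [[set: 'I_a]], so that each [Mseq i] has to meet
    only finitely many requirements. *)
Lemma good_card i (A : {set 'I_m}) b : (#|A| <= i)%N -> (size b <= i)%N ->
  good E A b (Mseq i) (rate i).
Proof.
move=> Ai bi; pose h (j : 'I_#|A|) : 'I_m := enum_val j.
have inj : injective h by exact: enum_val_inj.
have <- : h @: [set: 'I_#|A|]%SET = A.
  apply/setP => v; apply/imsetP/idP => [[j _ ->]|vA]; first exact: enum_valP.
  by exists (enum_rank_in vA v); rewrite ?inE // /h enum_rankK_in.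
exact: (good_relab xE inj (Mseq_good Ai bi)).
Qed.

Definition ldep a N (Phi : colours m -> R) := forall c c' : colours m,
  (forall (B : {set 'I_m}) s, (#|B| < a)%N -> (s < N)%N -> c B s = c' B s) -> Phi c = Phi c'.

(** The rebuilt colours of the sets with fewer than [a] elements have the joint law prescribed by
    [E], as far as finitely many bits can tell. *)
Definition law a := forall N Phi, ldep a N Phi ->
  Jint (fun x => Phi (Gam x)) = E (fun X => Phi (col X)).

Lemma ldep_cdep a N Phi : ldep a N Phi -> cdep N Phi.
Proof. by move=> dP c c' h; apply: dP => B s _; exact: h. Qed.

Lemma ldep_qq a (A : {set 'I_m}) M b : #|A| = a -> ldep a M (qq E A M b).
Proof. by move=> cA c c' h; apply: qq_low => B s BA sM; apply: h; rewrite // -cA proper_card. Qed.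

Section Step.
Variable a : nat.
Hypothesis La : law a.

Definition gap (A : {set 'I_m}) b i : R :=
  Jint (fun x => `|wp A b x - qq E A (Mseq i) b (Gam x)|).

Lemma bmf_qqG A M b : bmf (fun x => qq E A M b (Gam (m := m) x)).
Proof. by apply: (@bmf_cdepG _ M); exact: cdep_qq. Qed.

(** Conditional probabilities at a set of size [a] read only smaller sets, so [law a] carries the
    estimate [good] from [E] over to the cube. *)
Lemma step_le (A : {set 'I_m}) b i : #|A| = a -> (a <= i)%N -> (size b <= i)%N ->
  Jint (fun x => `|qq E A (Mseq i.+1) b (Gam x) - qq E A (Mseq i) b (Gam x)|) <= rate i.
Proof.
move=> cA ai bi.
rewrite (La (N := Mseq i.+1) (Phi := fun c => `|qq E A (Mseq i.+1) b c - qq E A (Mseq i) b c|)).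
  by apply: good_card; rewrite ?cA //; exact: Mseq_nd.
move=> c c' h; rewrite (ldep_qq b cA h) (ldep_qq (M := Mseq i) b cA (c' := c')) // => B s Ba sM.
by apply: h => //; exact: leq_trans sM (Mseq_nd (leqnSn i)).
Qed.

Lemma kap_gap (A : {set 'I_m}) b i : #|A| = a -> (a <= i)%N -> (size b <= i)%N ->
  Jint (fun x => `|kap A (Gam x) b - qq E A (Mseq i) b (Gam x)|) <= 2 * rate i.
Proof.
move=> cA ai bi.
have bq j : bmf (fun x => qq E A (Mseq j) b (Gam (m := m) x)) by exact: bmf_qqG.
have bk : bmf (fun x => kap A (Gam (m := m) x) b) by apply: bmf_kap => B s _; exact: bmf_Gam.
apply: (@Jint_le_series _ _ _ (fun n x => `|qq E A (Mseq (i + n).+1) b (Gam x) - qq E A (Mseq (i + n)) b (Gam x)|)).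
- by apply: bmf_norm; exact: bmfB.
- by move=> n; apply: bmf_norm; exact: bmfB.
- by [].
- by [].
- by move=> x; exact: (lsup_close (fun j => qq E A (Mseq j) b (Gam x))).
move=> N; apply: le_trans (sum_rate i N); apply: ler_sum => n _; apply: step_le => //.
  by rewrite (leq_trans ai) ?leq_addr.
by rewrite (leq_trans bi) ?leq_addr.
Qed.

Lemma gap_ge0 A b i : 0 <= gap A b i.
Proof. by apply: Jint_ge0 => //; apply: bmf_norm; apply: bmfB; [exact: bmf_wp|exact: bmf_qqG]. Qed.

(** The sure event has conditional probability 1 except on null cells, where [cexp] is 0; so the
    integrand is nonnegative with mean 0. *)
Lemma gap_nil (A : {set 'I_m}) i : #|A| = a -> gap A [::] i = 0.
Proof.
move=> cA; rewrite /gap.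
rewrite (_ : (fun x => _) = (fun x => 1 - qq E A (Mseq i) [::] (Gam x))); last first.
  apply/funext => x; rewrite /wp pk_nil ger0_norm // subr_ge0.
  by have /andP[] := qq01 mE A (Mseq i) [::] (Gam x).
rewrite (La (N := Mseq i) (Phi := fun c => 1 - qq E A (Mseq i) [::] c)); last first.
  by move=> c c' h; rewrite (ldep_qq _ cA h).
have bq : bdf (fun X => qq E A (Mseq i) [::] (col X)) by exact: (bdf_col (cdep_qq E A [::])).
rewrite meanB //; last exact: bdf_cst.
have := mean_cexp mE (fun X => res A (Mseq i) (col X)) (pat01 R [::] A) (fun=> 1).
under [X in _ = E X]eq_fun do rewrite mul1r.
rewrite -/(qq E A (Mseq i) [::]) => h; rewrite [X in _ - X](_ : _ = 1) ?(mean_cst mE) ?subrr //.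
rewrite -[RHS](mean_cst mE) -h; congr E; apply/funext => X.
by rewrite /pat /= mulr1.
Qed.

Lemma qq_split A M b c : qq E A M (false :: b) c = qq E (m := m) A M b c - qq E A M (true :: b) c.
Proof.
rewrite /qq /cexp -mulrBl; congr (_ / _); rewrite /cav -meanB //; last first.
- by apply: bdfM; exact: bdf_bool.
- by apply: bdfM; exact: bdf_bool.
congr E; apply/funext => X; rewrite !pat_cons.
by case: (pat b _); case: (col X A (size b)); rewrite /= ?mul0r ?subrr ?subr0.
Qed.

Lemma qq_true_le A M b c : qq E A M (true :: b) c <= qq E (m := m) A M b c.
Proof. by rewrite -subr_ge0 -qq_split; have /andP[] := qq01 mE A M (false :: b) c. Qed.

(** Truncating [kappa] by the length [p] left over does no harm: the true probability satisfies
    [q1 <= q], so the minimum misses [q1] by at most the errors of [kappa] and of [p] together. *)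
Lemma gap_true (A : {set 'I_m}) b i : #|A| = a -> (a <= i)%N -> (size b < i)%N ->
  gap A (true :: b) i <= 2 * rate i + gap A b i.
Proof.
move=> cA ai bi; apply: le_trans (lerD (@kap_gap A (true :: b) i cA ai bi) (lexx _)).
have bq b' : bmf (fun x => qq E A (Mseq i) b' (Gam (m := m) x)) by exact: bmf_qqG.
have bk b' : bmf (fun x => kap A (Gam (m := m) x) b') by apply: bmf_kap => B s _; exact: bmf_Gam.
have bw b' := bmf_wp A b'.
rewrite -JintD; try by apply: bmf_norm; exact: bmfB.
apply: le_Jint; first by apply: bmf_norm; exact: bmfB.
  by apply: bmfD; apply: bmf_norm; exact: bmfB.
move=> x; rewrite /wp pk_true; have := qq_true_le A (Mseq i) b (Gam x).
set k1 := kap _ _ _; set q1 := qq _ _ _ (true :: b) _; set q := qq _ _ _ b _; set p := pk _ b.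
move=> q1q; rewrite minr_absE.
have := ler_norm (k1 - q1); have := ler_norm (- (k1 - q1)).
have := ler_norm (p - q); have := ler_norm (- (p - q)); rewrite !normrN.
set N1 := `|k1 - q1|; set N2 := `|p - q| => h1 h2 h3 h4.
have [kp|kp] := leP k1 p.
  by rewrite ler_norml; have := ler_normr (k1 - p) 0 => _;
     rewrite (ler0_norm (_ : k1 - p <= 0)) ?subr_le0 //; apply/andP; split; lra.
by rewrite ler_norml (gtr0_norm (_ : 0 < k1 - p)) ?subr_gt0 //; apply/andP; split; lra.
Qed.

Lemma gap_false (A : {set 'I_m}) b i : gap A (false :: b) i <= gap A b i + gap A (true :: b) i.
Proof.
have bq b' : bmf (fun x => qq E A (Mseq i) b' (Gam (m := m) x)) by exact: bmf_qqG.
have bw b' := bmf_wp A b'.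
rewrite /gap -JintD; try by apply: bmf_norm; exact: bmfB.
apply: le_Jint; first by apply: bmf_norm; exact: bmfB.
  by apply: bmfD; apply: bmf_norm; exact: bmfB.
move=> x; rewrite /wp pk_false qq_split.
rewrite (_ : _ - _ - (_ - _) = (pk (kap A (Gam x)) b - qq E A (Mseq i) b (Gam x)) -
  (pk (kap A (Gam x)) (true :: b) - qq E A (Mseq i) (true :: b) (Gam x))); last by ring.
exact: ler_normB.
Qed.

Lemma gap_cvg (A : {set 'I_m}) b : #|A| = a -> gap A b i @[i --> \oo] --> (0 : R).
Proof.
move=> cA; elim: b => [|y b IH].
  by apply: cvg_near_cst; apply: nearW => i; exact: gap_nil.
have ct : gap A (true :: b) i @[i --> \oo] --> (0 : R).
  apply: (@squeeze_cvgr _ _ _ _ (fun=> 0) (fun i => 2 * rate i + gap A b i)).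
  - near=> i; rewrite gap_ge0 /=; apply: gap_true => //.
      by near: i; exact: nbhs_infty_ge.
    by near: i; exact: nbhs_infty_gt.
  - exact: cvg_cst.
  - by rewrite -[X in _ --> X](addr0 0); apply: cvgD IH; exact: rate_cvg.
case: y => //; apply: (@squeeze_cvgr _ _ _ _ (fun=> 0) (fun i => gap A b i + gap A (true :: b) i)).
- by apply: nearW => i; rewrite gap_ge0 gap_false.
- exact: cvg_cst.
- by rewrite -[X in _ --> X](addr0 0); exact: cvgD.
Unshelve. all: by end_near. Qed.

End Step.
End Induction.
End Gamma.

(** * Equality of the two laws, one layer at a time *)

Lemma cvg_of_bound (R : realType) (u v : nat -> R) (L : R) :
  (\forall n \near \oo, `|u n - L| <= v n) -> v n @[n --> \oo] --> 0 -> u n @[n --> \oo] --> L.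
Proof.
move=> h v0; apply/subr_cvg0/norm_cvg0P.
apply: (@squeeze_cvgr _ _ _ _ (fun=> 0) v) => //; last exact: cvg_cst.
by apply: filterS h => n ->; rewrite normr_ge0.
Qed.

Opaque Gam Gamn.

Section LawStep.
Variables (R : realType) (E : (arr -> R) -> R) (Mseq : nat -> nat).
Hypotheses (mE : mean E) (xE : exch E).
Hypothesis Mseq_nd : forall i j, (i <= j)%N -> (Mseq i <= Mseq j)%N.
Hypothesis Mseq_good : forall i a b, (a <= i)%N -> (size b <= i)%N ->
  good E [set: 'I_a]%SET b (Mseq i) (rate R i).
Variable m : nat.

Notation Gam := (Gam E Mseq (m := m)).
Notation wp := (wp E Mseq).
Notation law := (law E Mseq m).

Definition layer a : {set {set 'I_m}} := [set A : {set 'I_m} | #|A| == a]%SET.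

Lemma law0 : law 0.
Proof.
move=> N Phi dP; pose c0 : colours m := fun _ _ => false.
have PE c : Phi c = Phi c0 by exact: dP.
rewrite (_ : (fun x => _) = fun=> Phi c0); last by apply/funext => x; exact: PE.
rewrite (_ : (fun X => _) = fun=> Phi c0); last by apply/funext => x; exact: PE.
by rewrite Jint_cst mean_cst.
Qed.

Section Step.
Variable a : nat.
Hypothesis La : law a.
Variables (N : nat) (Psi : colours m -> R) (b : {set 'I_m} -> seq bool).
Hypothesis dPsi : ldep a N Psi.

Let s := enum (layer a).

Lemma in_layer A : A \in s -> #|A| = a.
Proof. by rewrite mem_enum inE => /eqP. Qed.

Lemma layer_anti A A' : A \in s -> A' \in s -> A != A' -> ~~ (A \subset A').
Proof.
move=> /in_layer cA /in_layer cA'; apply: contra => AA'.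
by rewrite eqEcard AA' cA cA' leqnn.
Qed.

Let bG (M : nat) (Phi : colours m -> R) : cdep M Phi -> bmf (fun x => Phi (Gam x)).
Proof. exact: bmf_cdepG. Qed.

Lemma bmf_patG A b' : bmf (fun x => (pat b' (Gam x A))%:R : R).
Proof. by apply: (bG (M := size b') (Phi := fun c => (pat b' (c A))%:R)) => c c' h; rewrite (cdep_pat A h). Qed.

(** The coordinate [x A] enters neither [Psi] nor any other pattern of the layer, so the integral
    over the layer factors and each factor is the length of its coding interval. *)
Lemma layer_coding :
  Jint (fun x => Psi (Gam x) * \prod_(A <- s) (pat (b A) (Gam x A))%:R)
  = Jint (fun x => Psi (Gam x) * \prod_(A <- s) wp A (b A) x).
Proof.
have updG (A : {set 'I_m}) t x (B : {set 'I_m}) : ~~ (A \subset B) -> Gam (upd A t x) B = Gam x B.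
  move=> AB; apply: Gam_dep => C CB; rewrite /upd; case: eqP => // e.
  by rewrite -e CB in AB.
have UE (A : {set 'I_m}) : A \in s -> Uint A (fun x => (pat (b A) (Gam x A))%:R) = wp A (b A).
  move=> As; apply/funext => x; rewrite /Uint.
  rewrite -[RHS]/(pk (kap E Mseq A (Gam x)) (b A)) -(int_pat_Qb (b A) (fun b' => kap_ge0 Mseq mE A (Gam x) b')).
  apply: eq_Rintegral => t _; rewrite GamE.
  rewrite {2}/upd eqxx.
  apply: (congr1 (fun z : bool => z%:R : R)).
  apply: pat_ext => n _; apply: Qb_ext; apply: kap_low => B BA.
  by apply: updG; move: BA; rewrite properE => /andP[].
rewrite (Jint_prod (phi := fun A x => (pat (b A) (Gam x A))%:R)).
- by congr Jint; apply/funext => x; congr (_ * _); rewrite !big_seq; apply: eq_bigr => A As; rewrite UE.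
- exact: enum_uniq.
- exact: bG (ldep_cdep dPsi).
- by move=> A; exact: bmf_patG.
- move=> A As x t; apply: dPsi => B n Ba _; rewrite updG //.
  by apply: contraTN Ba => /subset_leq_card; rewrite (in_layer As) -leqNgt.
- move=> A A' As As' AA' x t; rewrite updG //; apply: layer_anti => //.
  by rewrite eq_sym.
Qed.

(** The sequence [u] has both sides as its limit. In [E], patterns are swapped for conditional
    probabilities with an error of order [rate i]; these read only lower layers, so [La] moves them
    to the cube, where [gap_cvg] replaces them by interval lengths. *)
Lemma layer_law :
  E (fun X => Psi (col X) * \prod_(A <- s) (pat (b A) (col X A))%:R)
  = Jint (fun x => Psi (Gam x) * \prod_(A <- s) wp A (b A) x).
Proof.
have [C0 hC0] := cdep_bdf (ldep_cdep dPsi).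
(* [Psi] is divided by [C] to meet the normalisation in [prod_swap]; adding 1 keeps [C] positive. *)
pose C := `|C0| + 1.
have C_gt0 : 0 < C by rewrite /C ltr_wpDl.
have hC c : `|Psi c| <= C.
  by apply: le_trans (hC0 c) _; rewrite /C ler_wpDr // ler_norm.
pose B0 := (a + \max_(A : {set 'I_m}) size (b A))%N.
have bB A : (size (b A) <= B0)%N.
  by apply: leq_trans (leq_addl _ _); exact: (leq_bigmax A).
pose u i := E (fun X => Psi (col X) * \prod_(A <- s) qq E A (Mseq i) (b A) (col X)).
set L := E _; set J := Jint _.
have q01 A i c : 0 <= qq E A (Mseq i) (b A) c <= 1 by exact: qq01.
have bP i : bmf (fun x => Psi (Gam x) * \prod_(A <- s) qq E A (Mseq i) (b A) (Gam x)).
  by apply: bmfM; [exact: bG (ldep_cdep dPsi) | apply: bmf_prod => A _; exact: bmf_qqG].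
have uL : u @ \oo --> L.
  apply: (@cvg_of_bound _ _ (fun i => (C * (size s)%:R) * rate R i)); last exact: rate_cvg.
  near=> i.
  have iB : (B0 <= i)%N by near: i; exact: nbhs_infty_ge.
  have ai : (a <= i)%N by apply: leq_trans iB; exact: leq_addr.
  pose Z c := C^-1 * Psi c.
  have bZ (F : arr -> R) : bdf F -> E (fun X => Psi (col X) * F X) = C * E (fun X => Z (col X) * F X).
    move=> bF; rewrite -(meanZ mE); last first.
      by apply: bdfM => //; apply: bdfM; [exact: bdf_cst | exact: bdf_col (ldep_cdep dPsi)].
    by congr E; apply/funext => X; rewrite /Z !mulrA divff ?mul1r // gt_eqF.
  rewrite /L /u bZ ?[X in _ - X]bZ; last 2 first.
  - by apply: bdf01 => X; apply/andP; split; [apply: prodr_ge0 => A _; exact: ler0n |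
      apply: prodr_ile1 => A _; exact: pat01].
  - by apply: bdf01 => X; apply/andP; split; [apply: prodr_ge0 => A _; have /andP[] := q01 A i (col X) |
      apply: prodr_ile1 => A _].
  rewrite -mulrBr normrM gtr0_norm // -mulrA ler_pM2l // distrC.
  apply: (prod_swap mE xE (N := N)) => [|A /in_layer cA|||].
  - exact: enum_uniq.
  - by apply: good_card => //; [rewrite cA | exact: leq_trans (bB A) iB].
  - by move=> A A'; exact: layer_anti.
  - by move=> c; rewrite /Z normrM gtr0_norm ?invr_gt0 // mulrC ler_pdivrMr ?mul1r.
  - move=> A /in_layer cA c c' h; rewrite /Z; congr (_ * _); apply: dPsi => B n Ba nN.
    by apply: h => //; apply: contraTN Ba => /subset_leq_card; rewrite cA -leqNgt.
have uJ : u @ \oo --> J.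
  have -> : u = fun i => Jint (fun x => Psi (Gam x) * \prod_(A <- s) qq E A (Mseq i) (b A) (Gam x)).
    apply/funext => i; rewrite /u.
    rewrite (La (N := maxn N (Mseq i)) (Phi := fun c => Psi c * \prod_(A <- s) qq E A (Mseq i) (b A) c)) //.
    move=> c c' h; rewrite (dPsi (c' := c')); last first.
      by move=> B n Ba nN; apply: h => //; rewrite leq_max nN.
    congr (_ * _); rewrite !big_seq; apply: eq_bigr => A /in_layer cA.
    by apply: ldep_qq cA _ _ _ => B n Ba nM; apply: h => //; rewrite leq_max nM orbT.
  apply: (@cvg_of_bound _ _ (fun i => C * \sum_(A <- s) gap E Mseq A (b A) i)).
    apply: nearW => i; rewrite /J -JintB //; last first.
      by apply: bmfM; [exact: bG (ldep_cdep dPsi) | apply: bmf_prod => A _; exact: bmf_wp].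
    set d := fun x => _; have bd : bmf d.
      apply: bmfB => //; apply: bmfM; first exact: bG (ldep_cdep dPsi).
      by apply: bmf_prod => A _; exact: bmf_wp.
    apply: (le_trans (Jint_norm bd)).
    have bg A : bmf (fun x => `|wp A (b A) x - qq E A (Mseq i) (b A) (Gam x)|).
      by apply: bmf_norm; apply: bmfB; [exact: bmf_wp | exact: bmf_qqG].
    rewrite /gap -Jint_sum // -JintZl; last exact: bmf_sum.
    apply: le_Jint; [exact: bmf_norm | by apply: bmfM; [exact: bmf_cst | exact: bmf_sum] |].
    move=> x; rewrite /d -mulrBr normrM; apply: ler_pM => //.
    rewrite distrC; apply: dist_prod => A; [exact: wp01 | exact: q01].
  rewrite -[X in _ --> X](mulr0 C); apply: cvgMr.
  suff : (\sum_(A <- s) gap E Mseq A (b A) i) @[i --> \oo] --> \sum_(A <- s) (0 : R).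
    by rewrite big1_eq.
  have cs : all (fun A : {set 'I_m} => #|A| == a) s by apply/allP => A /in_layer ->.
  elim: s cs => [_|A s' IH /= /andP[/eqP cA cs]].
    by under eq_fun do rewrite big_nil; rewrite big_nil; exact: cvg_cst.
  under eq_fun do rewrite big_cons; rewrite big_cons.
  have c1 : gap E Mseq A (b A) i @[i --> \oo] --> (0 : R).
    exact: (gap_cvg mE xE Mseq_nd Mseq_good La (b A) cA).
  exact: cvgD c1 (IH cs).
exact: (cvg_unique (@Rhausdorff R) uL uJ).
Unshelve. all: by end_near. Qed.

End Step.

Lemma rev_rpre c n : rev (rpre c n) = mkseq c n.
Proof. by elim: n => //= n IH; rewrite rev_cons IH mkseqS. Qed.

(** [Phi] is split according to the first [N] bits of the colours in layer [a]. Each piece is a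
    function of the lower layers times patterns on the layer, and on such products [layer_law] and
    [layer_coding] agree. *)
Lemma law_step a : law a -> law a.+1.
Proof.
move=> La N Phi dP.
pose T := {ffun {set 'I_m} -> N.-tuple bool}.
pose dummy : N.-tuple bool := [tuple of nseq N false].
(* [t] is defined on all sets; fixing it outside the layer makes each assignment of patterns occur
   exactly once. *)
pose adm (t : T) := [forall A : {set 'I_m}, (#|A| != a) ==> (t A == dummy)].
pose mix (t : T) (c : colours m) : colours m := fun B n =>
  if #|B| == a then nth false (rev (t B)) n else c B n.
pose Psi (t : T) c := (adm t)%:R * Phi (mix t c).
have dPsi t : ldep a N (Psi t).
  move=> c c' h; rewrite /Psi; congr (_ * _); apply: dP => B n.
  rewrite /mix ltnS leq_eqVlt => /orP[->//|Ba] nN; case: ifP => // _; exact: h.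
have split c : Phi c = \sum_(t : T) Psi t c * \prod_(A <- enum (layer a)) (pat (t A) (c A))%:R.
  have sz (A : {set 'I_m}) : size (rpre (c A) N) == N by rewrite size_rpre.
  pose t0 : T := [ffun A : {set 'I_m} => if #|A| == a then Tuple (sz A) else dummy].
  have ad0 : adm t0.
    by apply/forallP => A; apply/implyP => /negbTE h; rewrite ffunE h.
  rewrite (bigD1 t0) //= [X in _ + X]big1 ?addr0; last first.
    move=> t tt0; rewrite /Psi; have [ad|] := boolP (adm t); last by rewrite !mul0r.
    suff [A Aa hp] : exists2 A, A \in layer a & ~~ pat (t A) (c A).
      have As : A \in enum (layer a) by rewrite mem_enum.
      by rewrite (big_rem A As) /= (negbTE hp) mul0r mulr0.
    apply/exists_inP; apply: contraNT tt0 => /exists_inPn h.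
    apply/eqP/ffunP => A; rewrite ffunE; case: (boolP (#|A| == a)) => Aa.
      apply/val_inj => /=; have := h A; rewrite inE Aa negbK => /(_ isT) /eqP.
      by rewrite size_tuple.
    by have /forallP/(_ A) := ad; rewrite Aa => /eqP.
  rewrite /Psi ad0 mul1r big_seq big1 ?mulr1 => [|A].
    apply: dP => B n Ba nN; rewrite /mix; case: ifP => // Be.
    by rewrite ffunE Be rev_rpre nth_mkseq.
  by rewrite mem_enum inE => Aa; rewrite ffunE Aa /pat /= size_rpre eqxx.
rewrite (_ : (fun x => Phi (Gam x)) = (fun x => \sum_(t : T) Psi t (Gam x) *
   \prod_(A <- enum (layer a)) (pat (t A) (Gam x A))%:R)); last by apply/funext => x; exact: split.
rewrite [X in _ = E X](_ : _ = (fun X => \sum_(t : T) Psi t (col X) *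
   \prod_(A <- enum (layer a)) (pat (t A) (col X A))%:R)); last by apply/funext => X; exact: split.
rewrite (mean_sum mE); last first.
  move=> t; have b1 : bdf (fun X => Psi t (col X)) by exact: (bdf_col (ldep_cdep (dPsi t))).
  apply: (bdfM b1).
  by apply: bdf01 => X; apply/andP; split; [apply: prodr_ge0 => A _; exact: ler0n |
      apply: prodr_ile1 => A _; exact: pat01].
rewrite Jint_sum; last first.
  move=> t _; apply: bmfM; first by apply: bmf_cdepG => //; exact: (ldep_cdep (dPsi t)).
  by apply: bmf_prod => A _; exact: bmf_patG.
by apply: eq_bigr => t _; rewrite (layer_law La _ (dPsi t)) (layer_coding _ (dPsi t)).
Qed.

Lemma law_all a : law a.
Proof. by elim: a => [|a IH]; [exact: law0 | exact: law_step]. Qed.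

(** Sets of the layer outside [F] get the empty pattern, which imposes nothing; those in [F] get
    [[:: true]], and bit 0 is the adjacency of the set itself. *)
Lemma edge_law (F : {set {set 'I_m}}) a : (forall A, A \in F -> #|A| = a) ->
  E (fun X => \prod_(A in F) (X (sam A))%:R) = Jint (fun x => \prod_(A in F) wp A [:: true] x).
Proof.
move=> cF; pose b A := if A \in F then [:: true] else [::].
have d1 : ldep a 0 (fun _ : colours m => 1 : R) by [].
have := layer_law (@law_all a) b d1.
have prodE (f : {set 'I_m} -> seq bool -> R) : (forall A, f A [::] = 1) ->
    1 * \prod_(A <- enum (layer a)) f A (b A) = \prod_(A in F) f A [:: true].
  move=> f1; rewrite mul1r big_enum /= (bigID (mem F)) /= [X in _ * X]big1 ?mulr1.
    apply: eq_big => [A|A /andP[_ AF]]; last by rewrite /b AF.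
    by case: (boolP (A \in F)) => AF; rewrite ?andbF // andbT inE (cF _ AF) eqxx.
  by move=> A /andP[_ /negbTE AF]; rewrite /b AF.
move=> h; transitivity (Jint (fun x => 1 * \prod_(A <- enum (layer a)) wp A (b A) x)); last first.
  by congr Jint; apply/funext => x; apply: (prodE (fun A b' => wp A b' x)) => A; exact: pk_nil.
rewrite -h; congr E; apply/funext => X.
rewrite (prodE (fun A b' => (pat b' (col X A))%:R)) //.
apply: eq_bigr => A _; congr (nat_of_bool _)%:R; rewrite /pat /= eqseq_cons andbT eq_sym eqb_id /col /=.
congr X; rewrite eqEsubset; split=> v; first by left.
by case=> // -[r].
Qed.

End LawStep.

(** * Limits of hypergraph sequences *)

Section Existence.
Variables (R : realType) (k : nat).

Opaque Gam Gamn.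

(** For each [i] there are finitely many pairs of a size and a pattern to serve; a running maximum
    makes the choice monotone. *)
Lemma Mseq_ex (E : (arr -> R) -> R) : mean E -> exists Mseq : nat -> nat,
  (forall i j, (i <= j)%N -> (Mseq i <= Mseq j)%N) /\
  forall i a b, (a <= i)%N -> (size b <= i)%N ->
    good E [set: 'I_a]%SET b (Mseq i) (rate R i).
Proof.
move=> mE; pose M0 a b i := projT1 (cid (good_ex mE [set: 'I_a]%SET b (rate_gt0 R i))).
have hM0 a b i M : (M0 a b i <= M)%N -> good E [set: 'I_a]%SET b M (rate R i).
  exact: (projT2 (cid (good_ex mE [set: 'I_a]%SET b (rate_gt0 R i)))).
pose M1 i := (\max_(a < i.+1) \max_(s < i.+1) \max_(b : s.-tuple bool) M0 a b i)%N.
have hM1 i a b : (a <= i)%N -> (size b <= i)%N -> (M0 a b i <= M1 i)%N.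
  move=> ai bi; have ai' : (a < i.+1)%N by []. have bi' : (size b < i.+1)%N by [].
  apply: leq_trans (leq_bigmax (Ordinal ai')) => /=.
  apply: leq_trans (leq_bigmax (Ordinal bi')) => /=.
  exact: (@leq_bigmax _ (fun b : (size b).-tuple bool => M0 a b i) (in_tuple b)).
exists (fun i => \max_(j < i.+1) M1 j)%N; split=> [i j ij|i a b ai bi].
  apply/bigmax_leqP => u _; have uj : (u < j.+1)%N by exact: leq_trans (ltn_ord u) _.
  exact: (@leq_bigmax _ (fun u : 'I_j.+1 => M1 u) (Ordinal uj)).
apply: hM0; apply: leq_trans (hM1 _ _ _ ai bi) _.
exact: (@leq_bigmax _ (fun u : 'I_i.+1 => M1 u) ord_max).
Qed.

Variables (G : nat -> kgraph k) (U : set_system nat).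
Hypotheses (UU : UltraFilter U) (Uoo : \oo `<=` U).
Hypothesis Gbig : forall M : nat, \forall n \near \oo, (M <= nv (G n))%N.

(** The limit object is the edge probability [wp] at the full set. Its symmetry is the invariance of
    the conditional probabilities under relabelling. *)
Theorem limit_jgraphon : exists w : ({set 'I_k} -> R) -> R,
  jgraphon w /\ forall F : kgraph k, tG R F (G n) @[n --> U] --> tJ F w.
Proof.
have mE := @uE_mean R _ _ _ UU Uoo Gbig.
have xE := @uE_exch R _ _ _ UU Uoo Gbig.
set E := uE G U in mE xE.
have [Mseq [Mnd Mgood]] := Mseq_ex mE.
pose w := wp E Mseq [set: 'I_k]%SET [:: true].
have jw : jgraphon w.
  split.
  - exact: bmf_wp.
  - by move=> x; have /andP[] := wp01 Mseq mE [set: 'I_k]%SET [:: true] x.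
  - by move=> x; have /andP[] := wp01 Mseq mE [set: 'I_k]%SET [:: true] x.
  - move=> x t; apply: wp_dep => B BT; rewrite /upd; case: eqP => // e.
    by move: BT; rewrite e fintype.properxx.
  - move=> s x.
    have sT : s @: [set: 'I_k]%SET = [set: 'I_k]%SET.
      apply/setP => i; rewrite inE; apply/imsetP.
      by exists ((s^-1)%g i); rewrite ?inE ?permKV.
    rewrite /w -(wp_relab Mseq xE [set: 'I_k]%SET [:: true] x (perm_inj (s := s))) sT.
    reflexivity.
exists w; split=> // F.
have -> : tJ F w = E (fun X => \prod_(A in edges F) (X (sam A))%:R).
  rewrite (edge_law mE xE Mnd Mgood (fun A AF => edge_card AF)).
  apply: Jint_ext => x; apply: eq_bigr => A AF.
  have [th [inj E1 E2]] := edge_param (edge_card AF).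
  have e : (fun B => x (edge_img A B)) = pull th x by apply/funext => B; rewrite /pull E2.
  rewrite /wE /w e -(wp_relab Mseq xE [set: 'I_k]%SET [:: true] x inj) E1; reflexivity.
exact: tG_uE.
Qed.

End Existence.

(** * Degrees and star hypergraphs *)

Lemma tG_avg (R : realType) k (F G : kgraph k) : tG R F G =
  avg (fun psi : {ffun 'I_(nv F) -> 'I_(nv G)} =>
    \prod_(A in edges F) (psi @: A \in edges G)%:R).
Proof.
rewrite /tG /avg card_ffun !card_ord natrX; congr (_ / _).
rewrite -sum1_card natr_sum [LHS]big_mkcond /=; apply: eq_bigr => psi _.
rewrite mem_cset; case: ifP => [/forallP al|/negbT].
  by rewrite big1 // => A AF; have := al A; rewrite AF => /= ->.
rewrite negb_forall => /existsP[A]; rewrite negb_imply => /andP[AF /negbTE nA].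
by rewrite (bigD1 A) //= nA mul0r.
Qed.

Section Blocks.
Variables (R : realType) (I : finType).
Implicit Types (f g : (I -> R) -> R).

Lemma indep_Ulist (i : I) (s : seq I) f : indep i f -> indep i (Ulist s f).
Proof. by move=> fi; elim: s => //= j s IH; exact: indep_Uint. Qed.

(** [Ulist_prod] with a whole list of private coordinates for each factor. *)
Lemma Ulist_blocks (T : eqType) (r : seq T) (D : T -> seq I) (Phi : (I -> R) -> R)
    (phi : T -> (I -> R) -> R) :
  uniq r -> bmf Phi -> (forall a, bmf (phi a)) ->
  (forall a i, a \in r -> i \in D a -> indep i Phi) ->
  (forall a b i, a \in r -> b \in r -> a != b -> i \in D b -> indep i (phi a)) ->
  Ulist (flatten [seq D a | a <- r]) (fun x => Phi x * \prod_(a <- r) phi a x)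
  = fun x => Phi x * \prod_(a <- r) Ulist (D a) (phi a) x.
Proof.
move=> us; elim: r Phi us => [|a s IH] Phi /=.
  by move=> _ _ _ _ _; apply/funext => x; rewrite !big_nil.
move=> /andP[as_ us] bPhi bphi iPhi iphi.
have E1 : (fun x => Phi x * \prod_(b <- a :: s) phi b x) =
          (fun x => (Phi x * phi a x) * \prod_(b <- s) phi b x).
  by apply/funext => x; rewrite big_cons mulrA.
rewrite Ulist_cat E1 IH //; last 3 first.
- exact: bmfM.
- move=> b i bs ib; apply: indepM; first by apply: (iPhi b) => //; rewrite inE bs orbT.
  apply: (iphi _ b); rewrite ?mem_head ?inE ?bs ?orbT //.
  by apply: contraNneq as_ => ->.
- by move=> b c i bs cs; apply: iphi; rewrite inE ?bs ?cs orbT.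
have -> : (fun x => Phi x * phi a x * \prod_(b <- s) Ulist (D b) (phi b) x) =
   (fun x => (Phi x * \prod_(b <- s) Ulist (D b) (phi b) x) * phi a x).
  by apply/funext => x; rewrite mulrAC.
rewrite UlistMl //; first by apply/funext => x; rewrite big_cons -mulrA; congr (_ * _); rewrite mulrC.
move=> i ia; apply: indepM; first by apply: (iPhi a) => //; rewrite mem_head.
move=> x t; rewrite !big_seq; apply: eq_bigr => b bs; apply: indep_Ulist.
apply: (iphi b a); rewrite ?mem_head ?inE ?bs ?orbT //.
by apply: contraNneq as_ => <-.
Qed.

End Blocks.

Section Glue.
Variables (l s : nat).

(** Writing [k = l + s] splits an edge: [rho] places the vertices whose degree is taken, [y] the
    remaining ones. *)
Definition glue (V : Type) (rho : 'I_l -> V) (y : 'I_s -> V) : 'I_(l + s) -> V :=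
  fun v => match fintype.split v with inl u => rho u | inr j => y j end.

Lemma glue_l V (rho : 'I_l -> V) y u : glue rho y (lshift s u) = rho u.
Proof. by rewrite /glue (unsplitK (inl u)). Qed.

Lemma glue_r V (rho : 'I_l -> V) y j : glue rho y (rshift l j) = y j.
Proof. by rewrite /glue (unsplitK (inr j)). Qed.

Lemma glueP (P : 'I_(l + s) -> Prop) :
  (forall u, P (lshift s u)) -> (forall j, P (rshift l j)) -> forall v, P v.
Proof. by move=> pl pr v; rewrite -(splitK v); case: (fintype.split v). Qed.

Lemma glue_inj V (rho : 'I_l -> V) y : injective rho -> injective y ->
  (forall u j, rho u <> y j) -> injective (glue rho y).
Proof.
move=> ir iy ry; elim/glueP => u; elim/glueP => v; rewrite ?glue_l ?glue_r.
- by move=> /ir ->.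
- by move=> /ry.
- by move=> /esym /ry.
- by move=> /iy ->.
Qed.

Lemma glue_comp V V' (f : V -> V') (rho : 'I_l -> V) y v :
  f (glue rho y v) = glue (f \o rho) (f \o y) v.
Proof. by rewrite /glue; case: (fintype.split v). Qed.

Lemma in_lowk (v : 'I_(l + s)) : (v \in lowk (l + s) l) = (v < l)%N.
Proof. by rewrite inE. Qed.

Lemma lowk_glue n (rho : 'I_l -> 'I_n) (y y' : 'I_s -> 'I_n) (B : {set 'I_(l + s)}) :
  B \subset lowk (l + s) l -> glue rho y @: B = glue rho y' @: B.
Proof.
move=> /fintype.subsetP BL; apply: eq_in_imset => v /BL; rewrite in_lowk.
by elim/glueP: v => [u|j]; rewrite ?glue_l //= ltnNge leq_addr.
Qed.

Lemma glue_image (T : finType) (rho : 'I_l -> T) (y : 'I_s -> T) :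
  glue rho y @: [set: 'I_(l + s)]%SET = (rho @: [set: 'I_l] :|: y @: [set: 'I_s])%SET.
Proof.
apply/setP => v; rewrite inE; apply/imsetP/orP => [[u _ ->]|[/imsetP[u _ ->]|/imsetP[u _ ->]]].
- elim/glueP: u => u; [left; rewrite glue_l|right; rewrite glue_r]; by rewrite imset_f ?inE.
- by exists (lshift s u); rewrite ?glue_l ?inE.
- by exists (rshift l u); rewrite ?glue_r ?inE.
Qed.

End Glue.

Section Degree.
Variables (R : realType) (l s : nat).
Notation k := (l + s)%N.
Implicit Types (w : ({set 'I_k} -> R) -> R).

Lemma bmf_pull w n (th : 'I_k -> 'I_n) : bmf w -> bmf (fun x => w (pull th x)).
Proof. exact: (bmf_reindex (fun B : {set 'I_k} => th @: B)). Qed.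

(** Members of [D] that are no images under [th] do not occur in the integrand; the others
    correspond to [hidx]. *)
Lemma deg_int w n (th : 'I_k -> 'I_n) (D : {set {set 'I_n}}) x :
  bmf w -> injective th ->
  (forall B : {set 'I_k}, (th @: B \in D) = (B \in hidx k l)) ->
  Ulist (enum D) (fun x => w (pull th x)) x = degJ l w (pull th x).
Proof.
move=> bw inj hD; have ij := imset_inj inj.
pose rest := (D :\: [set th @: (B : {set 'I_k}) | B in [set: {set 'I_k}]])%SET.
have pe : perm_eq (enum D) (map (fun B : {set 'I_k} => th @: B) (enum (hidx k l)) ++ enum rest).
  apply: uniq_perm; first exact: enum_uniq.
    rewrite cat_uniq map_inj_uniq // !enum_uniq andbT /=.
    apply/hasPn => A; rewrite mem_enum inE => /andP[nA _]; apply/negP => /mapP[B _ e].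
    by case/negP: nA; apply/imsetP; exists B; rewrite ?inE.
  move=> A; rewrite mem_enum mem_cat mem_enum inE.
  have [/imsetP[B _ ->]|nA] := boolP (A \in [set th @: (B : {set 'I_k}) | B in [set: {set 'I_k}]]%SET).
    by rewrite /= orbF hD (mem_map ij) mem_enum.
  rewrite /=; case: (boolP (A \in map _ _)) => //= /mapP[B _ e].
  by case/negP: nA; rewrite e; apply/imsetP; exists B; rewrite ?inE.
rewrite (perm_Ulist pe); last exact: bmf_pull.
rewrite Ulist_cat (@Ulist_id _ _ (enum rest)).
  by rewrite (Ulist_reindex (eta := fun B : {set 'I_k} => th @: B)).
move=> A; rewrite mem_enum inE => /andP[nA _] z t; congr w; apply/funext => B.
rewrite /pull /upd; case: eqP => // e; case/negP: nA; rewrite -e.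
by apply/imsetP; exists B; rewrite ?inE.
Qed.

Lemma degJ_low w (x y : {set 'I_k} -> R) :
  (forall B : {set 'I_k}, B \subset lowk k l -> x B = y B) -> degJ l w x = degJ l w y.
Proof.
have dT : depon [set: {set 'I_k}]%SET w.
  by move=> u v uv; congr w; apply/funext => B; apply: uv; rewrite inE.
move=> xy; apply: (depon_Ulist (s := enum (hidx k l)) dT) => B.
have -> : [set:: enum (hidx k l)]%SET = hidx k l by apply/setP => A; rewrite inE mem_enum.
by rewrite !inE negbK andbT => /xy.
Qed.

Lemma degJ01 w x : jgraphon w -> 0 <= degJ l w x <= 1.
Proof.
move=> jw; apply/andP; split.
  by apply: Ulist_ge0; [exact: jg_bmf | exact: jg_ge0].
by apply: Ulist_le1; [exact: jg_bmf | exact: jg_le1].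
Qed.

Hypothesis s_gt0 : (0 < s)%N.

Section Star.
Variable p : nat.
Notation n := (l + p * s)%N.

Definition srho (u : 'I_l) : 'I_n := lshift (p * s) u.
Definition sblk (a : 'I_p) (j : 'I_s) : 'I_n := rshift l (mxvec_index a j).
Definition sth (a : 'I_p) : 'I_k -> 'I_n := glue srho (sblk a).

Lemma sblk_inj a b i j : sblk a i = sblk b j -> a = b /\ i = j.
Proof.
move=> /rshift_inj e; have [g gK _] := curry_mxvec_bij p s.
have : g (uncurry (@mxvec_index p s) (a, i)) = g (uncurry (@mxvec_index p s) (b, j)) by congr g.
by rewrite !gK // => -[].
Qed.

Lemma srho_blk u a j : srho u <> sblk a j.
Proof. by move=> /(congr1 val) /= e; have := ltn_ord u; rewrite e ltnNge leq_addr. Qed.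

Lemma sth_inj a : injective (sth a).
Proof.
apply: glue_inj => [u v /lshift_inj //|i j /sblk_inj[]//|u j]; exact: srho_blk.
Qed.

Lemma sth_blk a b (A B : {set 'I_k}) : A \in hidx k l -> sth a @: A = sth b @: B -> a = b.
Proof.
rewrite inE => /subsetPn[v vA]; rewrite inE; elim/glueP: v vA => [u|j] vA; first by rewrite /= ltn_ord.
move=> _ /setP /(_ (sth a (rshift l j))); rewrite imset_f // => /esym /imsetP[w _].
rewrite /sth glue_r; elim/glueP: w => [u|i]; rewrite ?glue_l ?glue_r.
  by move=> /esym /srho_blk.
by move=> /sblk_inj[].
Qed.

Lemma sedge_inj : injective (fun a => sth a @: [set: 'I_k]%SET).
Proof.
move=> a b; apply: sth_blk; rewrite inE.
apply/subsetPn; exists (rshift l (Ordinal s_gt0)); rewrite ?inE //=.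
by rewrite addn0 ltnn.
Qed.

Lemma star_size : [forall e in [set sth a @: [set: 'I_k]%SET | a : 'I_p]%SET, #|e| == k].
Proof.
apply/forall_inP => _ /imsetP[a _ ->].
by rewrite card_imset ?cardsT ?card_ord //; exact: sth_inj.
Qed.

(* [p] edges sharing their first [l] vertices and otherwise disjoint: its density is the
   [p]-th moment of the degree *)
Definition star : kgraph k := KGraph star_size.

Lemma star_prod (f : {set 'I_n} -> R) :
  \prod_(A in edges star) f A = \prod_(a < p) f (sth a @: [set: 'I_k]%SET).
Proof. by rewrite /= big_imset //= => a b _ _; exact: sedge_inj. Qed.

(** Two edges of the star share only coordinates of subsets of the common [l] vertices. Given these,
    the edges integrate separately, each to the same degree. *)
Lemma tJ_star w : jgraphon w -> tJ star w = Jint (fun x => degJ l w x ^+ p).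
Proof.
move=> jw; have bw := jg_bmf jw.
rewrite /tJ (_ : (fun x => _) = fun x => 1 * \prod_(a <- enum 'I_p) w (pull (sth a) x)); last first.
  apply/funext => x; rewrite mul1r star_prod big_enum /=; apply: eq_bigr => a _.
  apply: wE_inj => //; [exact: jg_sym | exact: sth_inj].
pose D a := [set sth a @: (B : {set 'I_k}) | B in hidx k l]%SET.
have inD a (B : {set 'I_k}) : (sth a @: B \in D a) = (B \in hidx k l).
  by rewrite (mem_imset _ _ (imset_inj (@sth_inj a))).
have bp a : bmf (fun x => w (pull (sth a) x)) by exact: bmf_pull.
rewrite -(Jint_Ulist (flatten [seq enum (D a) | a <- enum 'I_p])); last first.
  by apply: bmfM; [exact: bmf_cst | exact: bmf_prod].
rewrite (Ulist_blocks (D := fun a => enum (D a)) (phi := fun a x => w (pull (sth a) x))) //; last 3 first.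
- exact: enum_uniq.
- exact: bmf_cst.
- move=> a b i _ _ ab; rewrite mem_enum => /imsetP[A AH ->] x t.
  congr w; apply/funext => B; rewrite /pull /upd; case: eqP => // e.
  by move: ab; rewrite (sth_blk AH (esym e)) eqxx.
case: (posnP p) => [p0|p_gt0].
  rewrite [X in _ = Jint X](_ : _ = fun=> 1); last by apply/funext => x; rewrite p0 expr0.
  rewrite Jint_cst -[RHS](@Jint_cst R {set 'I_n}).
  congr Jint; apply/funext => x; rewrite mul1r big_enum /= big1 // => a _.
  by have := ltn_ord a; rewrite {2}p0.
pose a0 := Ordinal p_gt0.
rewrite -[RHS](Jint_reindex (imset_inj (@sth_inj a0))); last exact/bmfX/bmf_degJ.
congr Jint; apply/funext => x; rewrite mul1r big_enum /=.
rewrite (eq_bigr (fun=> degJ l w (pull (sth a0) x))) ?prodr_const ?card_ord // => a _.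
rewrite (deg_int (w := w) x bw (@sth_inj a) (inD a)); apply: degJ_low => B BL.
by rewrite /pull (lowk_glue srho (sblk a) (sblk a0) BL).
Qed.

Definition dens (G : kgraph k) (rho : 'I_l -> 'I_(nv G)) : R :=
  avg (fun y : {ffun 'I_s -> 'I_(nv G)} => (glue rho y @: [set: 'I_k]%SET \in edges G)%:R).

Definition unstar (V : finType) (f : {ffun 'I_n -> V}) :
    {ffun 'I_l -> V} * {ffun 'I_p -> {ffun 'I_s -> V}} :=
  ([ffun u => f (srho u)], [ffun a => [ffun j => f (sblk a j)]]).

Lemma unstar_bij (V : finType) : bijective (@unstar V).
Proof.
apply: inj_card_bij => [f f' [/ffunP e1 /ffunP e2]|].
  apply/ffunP => v; rewrite -(splitK v); case: (fintype.split v) => [u|t] /=.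
    by have := e1 u; rewrite !ffunE.
  case/mxvec_indexP: t => a j.
  by have /ffunP/(_ j) := e2 a; rewrite !ffunE.
by rewrite card_prod !card_ffun !card_ord -expnM -expnD (mulnC s p).
Qed.

(** A map of the star is a map [rho] of its centre together with [p] free maps of the blocks, so for
    fixed [rho] the sum of products is a power of a sum. *)
Lemma avg_star (V : finType) (h : ('I_l -> V) -> ('I_s -> V) -> R) :
  avg (fun f : {ffun 'I_n -> V} => \prod_(a < p) h (f \o srho) (f \o sblk a))
  = avg (fun rho : {ffun 'I_l -> V} => avg (fun y : {ffun 'I_s -> V} => h rho y) ^+ p).
Proof.
rewrite /avg; have -> : (#|{ffun 'I_n -> V}| = #|{ffun 'I_l -> V}| * #|{ffun 'I_s -> V}| ^ p)%N.
  by rewrite !card_ffun !card_ord -expnM -expnD (mulnC s p).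
rewrite natrM natrX invfM mulrA mulrAC; congr (_ / _).
pose H (q : {ffun 'I_l -> V} * {ffun 'I_p -> {ffun 'I_s -> V}}) : R := \prod_(a < p) h q.1 (q.2 a).
transitivity ((\sum_(f : {ffun 'I_n -> V}) H (unstar f)) / #|{ffun 'I_s -> V}|%:R ^+ p).
  congr (_ / _); apply: eq_bigr => f _; apply: eq_bigr => a _.
  by congr h; apply/funext => u; rewrite /= !ffunE.
rewrite -(reindex (@unstar V) (P := predT) (F := H)) /=; last exact/onW_bij/unstar_bij.
rewrite -(pair_bigA _ (fun (rho : {ffun 'I_l -> V}) (Y : {ffun 'I_p -> {ffun 'I_s -> V}}) => \prod_(a < p) h rho (Y a))) /= mulr_suml.
apply: eq_bigr => rho _; rewrite expr_div_n; congr (_ / _).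
rewrite -(bigA_distr_bigA (fun (a : 'I_p) (y : {ffun 'I_s -> V}) => h rho y)).
by rewrite prodr_const card_ord.
Qed.

Lemma tG_star (G : kgraph k) : tG R star G = avg (fun rho : {ffun 'I_l -> 'I_(nv G)} => dens (G := G) rho ^+ p).
Proof.
rewrite tG_avg.
rewrite -(avg_star (fun rho y => (glue rho y @: [set: 'I_k]%SET \in edges G)%:R)).
congr avg; apply/funext => f; rewrite star_prod; apply: eq_bigr => a _.
congr (nat_of_bool _)%:R; rewrite -imset_comp; congr (_ \in edges G).
by apply: eq_imset => v; exact: (glue_comp f srho (sblk a) v).
Qed.

End Star.
End Degree.

(** * Counting injective maps, copies and degrees *)

Section Counting.
Variable R : realType.

Lemma prod_onem_ge (T : Type) (r : seq T) (x : T -> R) : (forall t, 0 <= x t <= 1) ->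
  1 - \sum_(t <- r) x t <= \prod_(t <- r) (1 - x t).
Proof.
move=> x01; elim: r => [|t r IH]; first by rewrite !big_nil subr0.
rewrite !big_cons; have /andP[h0 h1] := x01 t.
have p1 : \prod_(j <- r) (1 - x j) <= 1.
  by apply: prodr_ile1 => j _; have /andP[? ?] := x01 j; apply/andP; split; lra.
have : x t * \prod_(j <- r) (1 - x j) <= x t by exact: ler_piMr.
rewrite mulrBl mul1r; lra.
Qed.

(** The ratio is a product of factors [1 - i / n], bounded below by one minus the sum; for [n < m]
    the left side is not positive. *)
Lemma ffact_ratio m n : (0 < n)%N -> 1 - (m ^ 2)%:R / n%:R <= (n ^_ m)%:R / (n ^ m)%:R :> R.
Proof.
move=> n0; have nR : 0 < n%:R :> R by rewrite ltr0n.
have [nm|mn] := ltnP n m.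
  apply: (@le_trans _ _ 0); last by rewrite divr_ge0.
  rewrite subr_le0 ler_pdivlMr // mul1r ler_nat.
  by apply: leq_trans (ltnW nm) _; rewrite -mulnn leq_pmulr // (leq_trans n0 (ltnW nm)).
have -> : (n ^ m)%:R = \prod_(i < m) (n%:R : R) by rewrite prodr_const card_ord natrX.
rewrite ffact_prod natr_prod -prodf_div.
have x01 (i : 'I_m) : 0 <= (i%:R / n%:R : R) <= 1.
  rewrite divr_ge0 //= ler_pdivrMr // mul1r ler_nat.
  exact: leq_trans (ltnW (ltn_ord i)) mn.
have -> : \prod_(i < m) ((n - i)%N%:R / n%:R) = \prod_(i < m) (1 - i%:R / n%:R) :> R.
  apply: eq_bigr => i _; rewrite natrB; last exact: leq_trans (ltnW (ltn_ord i)) mn.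
  by rewrite mulrBl divff // gt_eqF.
apply: le_trans (prod_onem_ge _ x01); rewrite lerD2l lerN2 -mulr_suml.
apply: ler_wpM2r; first by rewrite invr_ge0 ltW.
rewrite -natr_sum ler_nat -mulnn.
apply: (@leq_trans (\sum_(i < m) m)%N); first by apply: leq_sum => i _; exact/ltnW/ltn_ord.
by rewrite sum_nat_const card_ord.
Qed.

Lemma avg_noninj m n : (0 < n)%N ->
  avg (fun f : {ffun 'I_m -> 'I_n} => (~~ injectiveb f)%:R : R) <= (m ^ 2)%:R / n%:R.
Proof.
move=> n0; have := ffact_ratio m n0.
have V0 : (0 < #|{ffun 'I_m -> 'I_n}|)%N by rewrite card_ffun !card_ord expn_gt0 n0.
suff -> : avg (fun f : {ffun 'I_m -> 'I_n} => (~~ injectiveb f)%:R : R) = 1 - (n ^_ m)%:R / (n ^ m)%:R by lra.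
have <- : avg (fun f : {ffun 'I_m -> 'I_n} => (injectiveb f)%:R : R) = (n ^_ m)%:R / (n ^ m)%:R.
  rewrite /avg card_ffun !card_ord; congr (_ / _).
  have := card_inj_ffuns 'I_m 'I_n; rewrite !card_ord => <-.
  rewrite -natr_sum -sum1_card [in RHS]big_mkcond /=; congr (_%:R).
  by apply: eq_bigr => f _; rewrite inE; case: injectiveb.
rewrite -[X in X - _](avg_cst (T := {ffun 'I_m -> 'I_n}) 1 V0) -[RHS]addrC -mulN1r -avgZl -avgD.
by congr avg; apply/funext => f; case: injectiveb; rewrite /= ?mulr1 ?mulr0 ?addNr ?add0r.
Qed.

(** An injective homomorphism would be a copy of [F], so only noninjective maps contribute. *)
Lemma tG_free k (Fam : set (kgraph k)) (F G : kgraph k) : (0 < nv G)%N ->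
  kfree Fam G -> Fam F -> tG R F G <= (nv F ^ 2)%:R / (nv G)%:R.
Proof.
move=> n0 fr FF; apply: le_trans (avg_noninj (nv F) n0).
rewrite tG_avg; apply: le_avg => f.
case: (boolP (injectiveb f)) => [/injectiveP inj|_] /=; last first.
  by apply: prodr_ile1 => A _; case: (_ \in _); rewrite ?lexx ?ler01.
have := fr F FF; rewrite /subgraph_of => nsub.
suff [A AF nA] : exists2 A, A \in edges F & f @: A \notin edges G.
  by rewrite (bigD1 A) //= (negbTE nA) mul0r.
apply: contrapT => h; apply: nsub; exists f; split=> // A AF.
by apply: contrapT => /negP nA; apply: h; exists A.
Qed.

Lemma kdegE k (G : kgraph k) (L : {set 'I_(nv G)}) :
  kdeg L = (\sum_(e in edges G) (L \subset e))%N.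
Proof.
rewrite /kdeg -sum1_card big_mkcond [RHS]big_mkcond /=; apply: eq_bigr => e _.
by rewrite inE; case: (e \in edges G); case: (L \subset e).
Qed.

(** Each edge containing the image of [rho] is completed by exactly [s] factorial tuples [y], the
    orderings of its remaining vertices. *)
Lemma dens_kdeg l s (G : kgraph (l + s)) (rho : 'I_l -> 'I_(nv G)) : injective rho ->
  dens R rho = (s`! * kdeg (rho @: [set: 'I_l]%SET))%:R / (nv G ^ s)%:R.
Proof.
move=> inj; set L := rho @: [set: 'I_l]%SET.
have cL : #|L| = l by rewrite /L card_imset // cardsT card_ord.
rewrite /dens /avg card_ffun !card_ord; congr (_ / _).
rewrite -natr_sum; congr (_%:R); rewrite kdegE big_distrr /=.
transitivity (\sum_(y : {ffun 'I_s -> 'I_(nv G)}) \sum_(e in edges G)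
   ((L :|: y @: [set: 'I_s])%SET == e : nat))%N.
  apply: eq_bigr => y _; rewrite glue_image -/L.
  case: (boolP ((L :|: y @: [set: 'I_s])%SET \in edges G)) => h.
    by rewrite (bigD1 _ h) /= eqxx big1 // => e /andP[_]; rewrite eq_sym => /negbTE->.
  rewrite big1 // => e eG; case: eqP => // e'; by rewrite e' eG in h.
rewrite exchange_big /=; apply: eq_bigr => e eG.
have ce : #|e| = (l + s)%N by exact: edge_card eG.
case: (boolP (L \subset e)) => Le; last first.
  rewrite muln0 big1 // => y _; case: eqP => // e'.
  by rewrite -e' finset.subsetUl in Le.
rewrite muln1; have cD : #|(e :\: L)%SET| = s by rewrite cardsD (finset.setIidPr Le) ce cL addKn.
have := card_inj_ffuns_on 'I_s (mem (e :\: L)%SET).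
rewrite card_ord cD ffactnn => <-; rewrite -sum1_card [RHS]big_mkcond /=; apply: eq_bigr => y _; rewrite inE.
case: eqP => [e'|ne].
  have sub : (e :\: L)%SET \subset (y @: [set: 'I_s])%SET.
    apply/fintype.subsetP => v; rewrite inE => /andP[vL]; rewrite -e' inE (negbTE vL) //.
  have cy : #|(y @: [set: 'I_s])%SET| = s.
    apply/eqP; rewrite eqn_leq; apply/andP; split.
      by apply: leq_trans (leq_imset_card _ _) _; rewrite cardsT card_ord.
    by rewrite -[X in (X <= _)%N]cD subset_leq_card.
  have eqD : (e :\: L)%SET = (y @: [set: 'I_s])%SET by apply/eqP; rewrite eqEcard sub cy cD leqnn.
  rewrite (_ : y \in ffun_on _) /=; last first.
    by apply/ffun_onP => j; rewrite eqD imset_f ?inE.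
  suff -> : injectiveb y by [].
  apply/injectiveP => i j; have /imset_injP h : #|(y @: [set: 'I_s])%SET| == #|[set: 'I_s]%SET|.
    by rewrite cy cardsT card_ord.
  by apply: h; rewrite inE.
case: (boolP (y \in _)) => //= /ffun_onP yon; case: (boolP (injectiveb y)) => // /injectiveP iy.
case: ne; apply/eqP; rewrite eqEcard; apply/andP; split.
  apply/fintype.subsetP => v; rewrite inE => /orP[/(fintype.subsetP Le)//|/imsetP[j _ ->]].
  by have := yon j; rewrite inE => /andP[].
rewrite ce cardsU cL (card_imset _ iy) cardsT card_ord.
rewrite (_ : (L :&: _)%SET = finset.set0) ?cards0 ?subn0 //.
apply/setP => v; rewrite !inE; apply/negbTE/negP => /andP[vL /imsetP[j _ e']].
by have := yon j; rewrite -e' inE vL.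
Qed.

End Counting.

(** * Minimum degree in the limit *)

Lemma near_div (R : realType) (K e : R) : 0 < e -> \forall n \near \oo, K / n%:R <= e.
Proof.
move=> e0; near=> n.
have n0 : 0 < n%:R :> R by rewrite ltr0n; near: n; exact: nbhs_infty_gt.
rewrite ler_pdivrMr // mulrC -ler_pdivrMr //.
by near: n; exact: nbhs_infty_ger.
Unshelve. all: by end_near. Qed.

Lemma near_nv_div (R : realType) k (FF : set_system nat) (PF : ProperFilter FF) (G : nat -> kgraph k) (K e : R) :
  (forall M : nat, \forall n \near FF, (M <= nv (G n))%N) -> 0 < e ->
  \forall n \near FF, K / (nv (G n))%:R <= e.
Proof.
move=> big /(near_div K)[N _ hN].
by apply: filterS (big N) => n; exact: hN.
Qed.

Section Limits.
Variables (R : realType) (l s : nat).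
Notation k := (l + s)%N.
Hypothesis s_gt0 : (0 < s)%N.

Lemma binom_sum m (x : R) : (1 - x) ^+ m = \sum_(i < m.+1) ((-1) ^+ i *+ 'C(m, i)) * x ^+ i.
Proof. by rewrite exprBn; apply: eq_bigr => i _; rewrite expr1n mulr1 mulrnAl. Qed.

Lemma avg_sum (T : finType) (J : finType) (c : J -> R) (f : J -> T -> R) :
  \sum_j c j * avg (f j) = avg (fun t => \sum_j c j * f j t).
Proof.
rewrite /avg exchange_big /= mulr_suml; apply: eq_bigr => j _.
by rewrite mulrA mulr_sumr.
Qed.

Lemma cvg_lincomb (FF : set_system nat) (PF : ProperFilter FF) (J : finType)
  (c : J -> R) (u : J -> nat -> R) (v : J -> R) :
  (forall j, u j n @[n --> FF] --> v j) ->
  \sum_j c j * u j n @[n --> FF] --> \sum_j c j * v j.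
Proof.
move=> cv; elim: (index_enum J) => [|j r IH].
  rewrite big_nil; have -> : (fun n => \sum_(j <- [::]) c j * u j n) = fun=> 0.
    by apply/funext => n; rewrite big_nil.
  exact: cvg_cst.
rewrite big_cons.
have -> : (fun n => \sum_(i <- j :: r) c i * u i n) =
    fun n => c j * u j n + \sum_(i <- r) c i * u i n.
  by apply/funext => n; rewrite big_cons.
have c1 : (fun n => c j * u j n) @ FF --> c j * v j by apply: cvgMr; exact: cv.
exact: cvgD c1 IH.
Qed.

Lemma dens01 (G : kgraph k) (rho : 'I_l -> 'I_(nv G)) : (0 < nv G)%N -> 0 <= dens R rho <= 1.
Proof.
move=> n0; have V0 : (0 < #|{ffun 'I_s -> 'I_(nv G)}|)%N by rewrite card_ffun !card_ord expn_gt0 n0.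
rewrite avg_ge0 //= -[X in _ <= X](avg_cst 1 V0); apply: le_avg => y.
by case: (_ \in _); rewrite ?ler01 ?lexx.
Qed.

Lemma ffact_sub_ratio n : (0 < n)%N -> (l + s <= n)%N ->
  1 - ((l + s) ^ 2 + s ^ 2)%:R / n%:R <= ((n - l) ^_ s)%:R / (n ^ s)%:R :> R.
Proof.
move=> n0 nk; have nR : 0 < n%:R :> R by rewrite ltr0n.
rewrite ffact_prod natr_prod.
have -> : (n ^ s)%:R = \prod_(i < s) (n%:R : R) by rewrite prodr_const card_ord natrX.
rewrite -prodf_div.
have lin (i : 'I_s) : (l + i <= n)%N by rewrite (leq_trans _ nk) // leq_add2l ltnW.
have -> : \prod_(i < s) ((n - l - i)%N%:R / n%:R) = \prod_(i < s) (1 - (l + i)%:R / n%:R) :> R.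
  apply: eq_bigr => i _; rewrite -subnDA natrB // mulrBl divff // gt_eqF //.
have x01 (i : 'I_s) : 0 <= ((l + i)%:R / n%:R : R) <= 1.
  by rewrite divr_ge0 //= ler_pdivrMr // mul1r ler_nat.
apply: le_trans (prod_onem_ge _ x01); rewrite lerD2l lerN2 -mulr_suml.
apply: ler_wpM2r; first by rewrite invr_ge0 ltW.
rewrite -natr_sum ler_nat; apply: (@leq_trans (\sum_(i < s) (l + s))%N).
  by apply: leq_sum => i _; rewrite leq_add2l ltnW.
rewrite sum_nat_const card_ord -mulnn; apply: leq_trans (leq_addr _ _).
by rewrite leq_mul2r leq_addl orbT.
Qed.

(** One [e] is lost in the degree hypothesis, the other in replacing a falling factorial by
    [n ^ s]. *)
Lemma dens_ge (G : kgraph k) (rho : 'I_l -> 'I_(nv G)) (c e : R) :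
  injective rho -> (0 < nv G)%N -> 0 <= e -> c <= 1 -> (l + s <= nv G)%N ->
  ((l + s) ^ 2 + s ^ 2)%:R / (nv G)%:R <= e ->
  (forall L : {set 'I_(nv G)}, #|L| = l -> (c - e) * ('C((nv G - l)%N, s))%:R <= (kdeg L)%:R) ->
  c - 2 * e <= dens R rho.
Proof.
move=> inj n0 e0 c1 nk ne hk; set n := nv G in inj n0 nk ne hk *.
have [ce|ce] := ltP (c - e) 0.
  by apply: (@le_trans _ _ 0); [lra | have /andP[] := dens01 rho n0].
have nR : 0 < n%:R :> R by rewrite ltr0n.
rewrite dens_kdeg //; set L := rho @: _.
have cL : #|L| = l by rewrite /L card_imset // cardsT card_ord.
have nsR : 0 < (n ^ s)%:R :> R by rewrite ltr0n expn_gt0 n0.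
apply: (@le_trans _ _ ((c - e) * ((n - l) ^_ s)%:R / (n ^ s)%:R)); last first.
  apply: ler_wpM2r; first by rewrite invr_ge0 ltW.
  rewrite -bin_ffact mulnC !natrM mulrCA; apply: ler_wpM2l => //.
  exact: hk.
have h : 1 - e <= ((n - l) ^_ s)%:R / (n ^ s)%:R.
  by apply: le_trans (ffact_sub_ratio n0 nk); rewrite lerD2l lerN2.
rewrite -mulrA; apply: (@le_trans _ _ ((c - e) * (1 - e))); last exact: ler_wpM2l.
have : (c - e) * e <= e by apply: ler_piMl => //; lra.
rewrite mulrBr mulr1; lra.
Qed.

(** Moments of [1 - deg] are combinations of star densities and pass to the limit. They are at most
    [2 * a ^+ m], so by Markov the degree is below [y] with probability at most [2 * (a / b) ^+ m],
    for every [m]. The filter is arbitrary because both an ultrafilter and plain convergence are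
    used. *)
Lemma limit_below (FF : set_system nat) (PF : ProperFilter FF) (G : nat -> kgraph k) w (c : R) :
  jgraphon w -> c <= 1 ->
  (forall M : nat, \forall n \near FF, (M <= nv (G n))%N) ->
  (forall e : R, 0 < e -> \forall n \near FF, forall L : {set 'I_(nv (G n))}, #|L| = l ->
     (c - e) * ('C((nv (G n) - l)%N, s))%:R <= (kdeg L)%:R) ->
  (forall F, tG R F (G n) @[n --> FF] --> tJ F w) ->
  forall y, y < c -> below l w y = 0.
Proof.
move=> jw c1 big hdeg hcv y yc.
have bw := jg_bmf jw; have bd : bmf (degJ l w) by exact: bmf_degJ.
have inv_small (K : nat) (e : R) : 0 < e -> \forall n \near FF, K%:R / (nv (G n))%:R <= e.
  exact: near_nv_div.
have n_gt0 : \forall n \near FF, (0 < nv (G n))%N by exact: big 1%N.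
(* [a] belongs to the midpoint of [y] and [c], [b] to [y]; [c <= 1] makes [a] positive, and the gap
   between them makes the ratio less than 1. *)
pose a : R := 1 - (c + y) / 2; pose b : R := 1 - y.
have a0 : 0 < a by rewrite /a; lra.
have ab : a < b by rewrite /a /b; lra.
have b0 : 0 < b by exact: lt_trans ab.
(* the star densities carry the moment bounds over to the limit *)
have mom m : Jint (fun x => (1 - degJ l w x) ^+ m) <= a ^+ m + a ^+ m.
  pose A n : R := avg (fun rho : {ffun 'I_l -> 'I_(nv (G n))} => (1 - dens R rho) ^+ m).
  have cvA : A n @[n --> FF] --> Jint (fun x => (1 - degJ l w x) ^+ m).
    have -> : A = fun n => \sum_(i < m.+1) ((-1) ^+ i *+ 'C(m, i)) * tG R (star l s i) (G n).
      apply/funext => n.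
      have E (i : 'I_m.+1) : ((-1) ^+ i *+ 'C(m, i)) * tG R (star l s i) (G n) =
          ((-1) ^+ i *+ 'C(m, i)) * avg (fun rho : {ffun 'I_l -> 'I_(nv (G n))} => dens R rho ^+ i).
        by rewrite (tG_star R s_gt0).
      rewrite (eq_bigr _ (fun i _ => E i)).
      by rewrite avg_sum; congr avg; apply/funext => rho; exact: binom_sum.
    have -> : Jint (fun x => (1 - degJ l w x) ^+ m) =
        \sum_(i < m.+1) ((-1) ^+ i *+ 'C(m, i)) * tJ (star l s i) w.
      have E (i : 'I_m.+1) : ((-1) ^+ i *+ 'C(m, i)) * tJ (star l s i) w =
          Jint (fun x => ((-1) ^+ i *+ 'C(m, i)) * degJ l w x ^+ i).
        by rewrite (tJ_star s_gt0 _ jw) JintZl //; exact: bmfX.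
      rewrite (eq_bigr _ (fun i _ => E i)).
      rewrite -Jint_sum; last by move=> i _; apply: bmfM; [exact: bmf_cst | exact: bmfX].
      by apply: Jint_ext => x; exact: binom_sum.
    by apply: cvg_lincomb => i; exact: hcv.
  apply: (closed_cvg (fun x : R => x <= a ^+ m + a ^+ m)) cvA; first exact: closed_le.
  (* Then [c - 2 * e] is the midpoint [(c + y) / 2]. The second [a ^+ m] absorbs the noninjective
     [rho]. *)
  pose e := (c - y) / 4; have e0 : 0 < e by rewrite /e; lra.
  have am0 : 0 < a ^+ m by exact: exprn_gt0.
  near=> n.
  have n0 : (0 < nv (G n))%N by near: n.
  have V0 : (0 < #|{ffun 'I_l -> 'I_(nv (G n))}|)%N by rewrite card_ffun !card_ord expn_gt0 n0.
  apply: (@le_trans _ _ (avg (fun rho : {ffun 'I_l -> 'I_(nv (G n))} => a ^+ m + (~~ injectiveb rho)%:R : R))).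
    apply: le_avg => rho; have /andP[d0 d1] := dens01 rho n0.
    case: (boolP (injectiveb rho)) => [/injectiveP inj|_] /=.
      rewrite addr0; apply: lerXn2r; [by rewrite nnegrE subr_ge0|by rewrite nnegrE (ltW a0)|].
      have : c - 2 * e <= dens R rho.
        apply: dens_ge => //; first exact: ltW.
        - by near: n; exact: big.
        - by near: n; exact: inv_small.
        - by near: n; exact: hdeg.
      by rewrite /a /e; lra.
    have : (1 - dens R rho) ^+ m <= 1 by rewrite exprn_ile1 ?subr_ge0 // lerBlDr lerDl.
    by move=> h; rewrite mulr1n; lra.
  rewrite avgD avg_cst // lerD2l; apply: le_trans (avg_noninj R l n0) _.
  by near: n; exact: inv_small.
have bel m : below l w y <= 2 * (a / b) ^+ m.
  have -> : 2 * (a / b) ^+ m = (b ^+ m)^-1 * (a ^+ m + a ^+ m).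
    by rewrite expr_div_n; ring.
  have bm0 : 0 < b ^+ m by exact: exprn_gt0.
  apply: (@le_trans _ _ ((b ^+ m)^-1 * Jint (fun x => (1 - degJ l w x) ^+ m))); last first.
    by apply: ler_wpM2l => //; rewrite invr_ge0 ltW.
  have b1 : bmf (fun x => (1 - degJ l w x) ^+ m).
    by apply: bmfX; apply: bmfB => //; exact: bmf_cst.
  rewrite -JintZl //; apply: le_Jint; first exact: bmf_below.
    by apply: bmfM => //; exact: bmf_cst.
  move=> x; have /andP[d0 d1] := degJ01 x jw.
  rewrite mulrC ler_pdivlMr //; case: (ltP (degJ l w x) y) => dy; last first.
    by rewrite mul0r exprn_ge0 // subr_ge0.
  rewrite mul1r; apply: lerXn2r; [by rewrite nnegrE (ltW b0)|by rewrite nnegrE subr_ge0|].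
  by rewrite /b; lra.
apply/eqP; rewrite eq_le; apply/andP; split; last first.
  by apply: Jint_ge0 => //; exact: bmf_below.
have cg : (fun m => 2 * (a / b) ^+ m) @ \oo --> (0 : R).
  apply: cvg_geometric; rewrite ger0_norm ?divr_ge0 ?(ltW a0) ?(ltW b0) //.
  by rewrite ltr_pdivrMr // mul1r.
apply: (closed_cvg (fun x : R => below l w y <= x)) cg; first exact: closed_ge.
by apply: nearW => m; exact: bel.
Unshelve. all: by end_near. Qed.

End Limits.

(** * Fixing the coordinate of the empty set *)

Section Slices.
Variables (R : realType) (I : finType).
Notation mu01 := (mu01 R).
Implicit Types (f : (I -> R) -> R).

Lemma Ulist_upd (i : I) t s f x : i \notin s ->
  Ulist s f (upd i t x) = Ulist s (fun y => f (upd i t y)) x.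
Proof.
elim: s x => //= j s IH x; rewrite inE negb_or => /andP[ij si].
congr Rintegral; apply/funext => u.
by rewrite updC 1?eq_sym // IH.
Qed.

Lemma Jint_slice (i : I) f : bmf f -> exists g : R -> R,
  [/\ bm1 g, Jint f = \int[mu01]_t g t & forall t, Jint (fun x => f (upd i t x)) = g t].
Proof.
move=> bf; have pe := perm_to_rem (mem_enum predT i : i \in enum I).
set r := rem i (enum I) in pe.
have ir : i \notin r by rewrite mem_rem_uniqF ?enum_uniq.
have br := bmf_Ulist r bf.
exists (fun t => Ulist r f (upd i t (fun=> 0))); split; first exact: bmf_slice.
  by rewrite /Jint (perm_Ulist pe bf).
move=> t; have bt : bmf (fun x => f (upd i t x)).
  apply: (bmf_comp bf) => j; rewrite /upd; case: (j == i); first exact: measurable_cst.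
  exact: measurable_coord.
rewrite /Jint (perm_Ulist pe bt) Ulist_cons // Uint_id ?Ulist_upd // => x u.
by congr f; apply/funext => j; rewrite /upd; case: (j == i).
Qed.

Lemma Jint_slice_ae0 (i : I) f : bmf f -> (forall x, 0 <= f x) -> Jint f = 0 ->
  \forall t \ae mu01, Jint (fun x => f (upd i t x)) = 0.
Proof.
move=> bf f0 J0; have [g [bg Jg sg]] := Jint_slice i bf.
have g0 t : 0 <= g t.
  rewrite -sg; apply: Jint_ge0 => //; apply: (bmf_comp bf) => j; rewrite /upd.
  case: (j == i); first exact: measurable_cst.
  exact: measurable_coord.
have mg : measurable_fun setT (EFin \o g) by apply/measurable_EFinP; case: bg.
have : ae_eq mu01 setT (EFin \o g) (cst 0%E).
  apply/ae_eq_integral_abs => //=.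
  under eq_integral do rewrite ger0_norm //.
  by rewrite -Rint01E // -Jg J0.
apply: filterS => t /(_ Logic.I) /= [gt0].
by rewrite sg.
Qed.

End Slices.

(** Embeds [k]-graphs in a countable type, so that one null set serves a whole family; what is
    forgotten is a proof of a boolean equality. *)
Definition kcode k (F : kgraph k) : {n & {set {set 'I_n}}} := existT _ (nv F) (edges F).

Lemma kcode_inj k : injective (@kcode k).
Proof.
case=> n E hE; case=> n' E' hE'; rewrite /kcode /= => e.
have en : n = n' by exact: (congr1 (@projT1 _ _) e).
case: _ / en E' hE' e => E' hE' /eqP; rewrite -tag_eqE /tag_eq eqxx /= tagged_asE => /eqP /= e.
by case: _ / e hE' => hE'; congr KGraph; exact: bool_irrelevance.
Qed.

Section FixEmpty.
Variables (R : realType) (k : nat).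
Variable w : ({set 'I_k} -> R) -> R.
Hypothesis jw : jgraphon w.
Notation e0 := finset.set0.

(** The default 0 is reached only at the full set, whose coordinate [w] ignores by [jg_top]. *)
Definition atz (z : R) (x : rlt k -> R) : R :=
  w (fun B : {set 'I_k} => if B == e0 then z else if insub B is Some C then x C else 0).

Lemma wW_atz z x : wW (atz z) x = w (upd e0 z x).
Proof.
apply: (indep_pull (jg_top jw)) => B BT; rewrite /upd.
case: eqP => // /eqP B0; case: insubP => [C _ /= ->//|].
by rewrite /rltP B0 BT.
Qed.

Lemma atz_hypergraphon z : hypergraphon (atz z).
Proof.
have ba : bmf (atz z).
  apply: (bmf_comp (jg_bmf jw)) => B; case: eqP => _; first exact: measurable_cst.
  by case: insubP => [C _ _|_]; [exact: measurable_coord | exact: measurable_cst].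
split.
- by move=> B mB; have := ba.1 measurableT B mB; rewrite setTI.
- by move=> x; rewrite (jg_ge0 jw) (jg_le1 jw).
- move=> s x y xy; rewrite /atz -(jg_sym jw s).
  apply: (indep_pull (jg_top jw)) => B BT; rewrite /pull.
  have -> : (s @: B == e0) = (B == e0) by rewrite imset_eq0.
  case: eqP => // /eqP B0.
  have hB : rltP B by rewrite /rltP B0.
  have sBT : s @: B != [set: 'I_k]%SET.
    apply: contra BT => /eqP E; rewrite eqEcard finset.subsetT -E card_imset ?leqnn //; exact: perm.perm_inj.
  have hsB : rltP (s @: B) by rewrite /rltP imset_eq0 B0.
  rewrite (insubT (@rltP k) hsB) (insubT (@rltP k) hB).
  exact: xy.
Qed.

Lemma tJ_atz z (F : kgraph k) :
  tJ F (wW (atz z)) = Jint (fun x => \prod_(A in edges F) wE w A (upd e0 z x)).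
Proof.
apply: Jint_ext => x; apply: eq_bigr => A AF; rewrite /wE wW_atz; congr w.
have [th [inj E eE]] := edge_param (edge_card AF).
by apply/funext => B; rewrite /upd eE imset_eq0.
Qed.

Lemma below_atz z l y :
  below l (wW (atz z)) y = Jint (fun x => (degJ l w (upd e0 z x) < y)%R%:R).
Proof.
apply: Jint_ext => x; rewrite /degJ Ulist_upd; last first.
  by rewrite mem_enum inE finset.sub0set.
by congr ((Ulist _ _ _ < _)%R%:R); apply/funext => u; exact: wW_atz.
Qed.

(* almost every value of the coordinate of the empty set inherits all countably many
   almost sure properties of [w] *)
Lemma fix_empty l (P : kgraph k -> Prop) (c : R) : (l < k)%N ->
  (forall F, P F -> tJ F w = 0) -> (forall y, y < c -> below l w y = 0) ->
  exists W : (rlt k -> R) -> R,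
    [/\ hypergraphon W, forall F, P F -> tW F W = 0 & (c%:E <= mindegW l W)%E].
Proof.
move=> lk h0 hb; have bw := jg_bmf jw.
have fl : Filter (almost_everywhere (mu01 R)) by exact: ae_filter_ringOfSetsType.
have a1 : \forall z \ae mu01 R, forall q, forall F, P F -> pickle (kcode F) = q -> tJ F (wW (atz z)) = 0.
  apply: ae_foralln => q.
  have [[F [PF Fq]]|no] := pselect (exists F, P F /\ pickle (kcode F) = q); last first.
    by apply: aeW => z F PF Fq; exfalso; apply: no; exists F.
  have : \forall z \ae mu01 R, tJ F (wW (atz z)) = 0.
    have := Jint_slice_ae0 e0 (bmf_prodE F jw) _ (h0 _ PF).
    have ge x : 0 <= \prod_(A in edges F) wE w A x by apply: prodr_ge0 => A _; exact: wE_ge0.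
    by move=> /(_ ge); apply: filterS => z; rewrite -tJ_atz.
  apply: filterS => z Hz F' _; rewrite -Fq => /(pcan_inj pickleK) /kcode_inj -> //.
(* Countably many thresholds approaching [c] suffice, [below] being monotone in its threshold. *)
have a2 : \forall z \ae mu01 R, forall q : nat, below l (wW (atz z)) (c - q.+1%:R^-1) = 0.
  apply: ae_foralln => q.
  have := Jint_slice_ae0 e0 (bmf_below l (c - q.+1%:R^-1) bw) (fun x => ler0n _ _).
  have yc : c - q.+1%:R^-1 < c by rewrite ltrBlDr ltrDl invr_gt0 ltr0n.
  by move=> /(_ (hb _ yc)); apply: filterS => z; rewrite -below_atz.
have pf : ProperFilter (almost_everywhere (mu01 R)).
  have h : (0 < mu01 R setT)%E by rewrite mu01T lte01.
  exact: ae_properfilter_algebraOfSetsType h.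
have [z [z1 z2]] : exists z : R,
    (forall q, forall F, P F -> pickle (kcode F) = q -> tJ F (wW (atz z)) = 0) /\
    (forall q : nat, below l (wW (atz z)) (c - q.+1%:R^-1) = 0).
  exact: (filter_ex (filterI a1 a2)).
exists (atz z); have hz := atz_hypergraphon z; split => //.
  by move=> F PF; rewrite tW_tJ //; exact: z1 PF erefl.
apply/mindegW_geP => // y yc.
have bz := jg_bmf (wW_jg hz).
have [q hq] : exists q : nat, y <= c - q.+1%:R^-1.
  have d0 : 0 < c - y by rewrite subr_gt0.
  exists (Num.bound (c - y)^-1); rewrite lerBrDl addrC -lerBrDl.
  rewrite invf_ple ?posrE ?ltr0n //; apply: ltW.
  apply: lt_trans (archi_boundP _) _; first by rewrite invr_ge0 ltW.
  by rewrite ltr_nat.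
apply/eqP; rewrite eq_le; apply/andP; split; last by apply: Jint_ge0 => //; exact: bmf_below.
rewrite -(z2 q); apply: le_Jint; try exact: bmf_below.
by move=> x; rewrite ler_nat; case: (ltP _ y) => // h1; rewrite (lt_le_trans h1).
Qed.

End FixEmpty.

(** * Random samples from a hypergraphon *)

Section Counting.

(** Such a map is determined by a list of [r] vertices, padded if necessary, and for each index a
    choice among them and the [l] values of [rho]. *)
Lemma card_cover (T : finType) n r l (rho : 'I_l -> 'I_n) : (0 < n)%N ->
  (#|[set psi : {ffun T -> 'I_n} |
      (#|(psi @: [set: T]) :\: (rho @: [set: 'I_l])|%SET <= r)%N]%SET|
   <= n ^ r * (r + l) ^ #|T|)%N.
Proof.
move=> n0; pose F (uv : {ffun 'I_r -> 'I_n} * {ffun T -> 'I_(r + l)}) : {ffun T -> 'I_n} :=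
  [ffun t => glue uv.1 rho (uv.2 t)].
have <- : #|{: {ffun 'I_r -> 'I_n} * {ffun T -> 'I_(r + l)}}| = (n ^ r * (r + l) ^ #|T|)%N.
  by rewrite card_prod !card_ffun !card_ord.
rewrite -cardsT; apply: leq_trans (leq_imset_card F _).
apply: subset_leq_card; apply/fintype.subsetP => psi; rewrite inE => hr.
set V := (_ :\: _)%SET in hr.
pose u : {ffun 'I_r -> 'I_n} := [ffun i : 'I_r => nth (Ordinal n0) (enum V) i].
have h t : exists j, glue u rho j == psi t.
  have [/imsetP[j _ e]|nL] := boolP (psi t \in rho @: [set: 'I_l]%SET).
    by exists (rshift r j); rewrite glue_r e.
  have tV : psi t \in enum V by rewrite mem_enum inE nL imset_f ?inE.
  have ir : (index (psi t) (enum V) < r)%N.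
    by apply: leq_trans hr; rewrite cardE index_mem.
  by exists (lshift l (Ordinal ir)); rewrite glue_l ffunE /= nth_index.
apply/imsetP; exists (u, [ffun t => xchoose (h t)]); rewrite ?inE //.
by apply/ffunP => t; rewrite !ffunE; apply/esym/eqP; exact: xchooseP (h t).
Qed.

Definition clash (T : finType) n (L : {set 'I_n}) (psi : {ffun T -> 'I_n}) (t : T) : bool :=
  (psi t \in L) || [exists t', (t' != t) && (psi t' == psi t)].

(* each value outside L absorbs total weight at least 2, a clashing index having weight 1 *)
Lemma card_image_clash (T : finType) n (L : {set 'I_n}) (psi : {ffun T -> 'I_n}) :
  (2 * #|(psi @: [set: T]) :\: L|%SET + #|[set t | clash L psi t]%SET| <= 2 * #|T|)%N.
Proof.
pose wt t := (2 - clash L psi t)%N.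
have wt1 t : (1 <= wt t)%N by rewrite /wt; case: clash.
have -> : (2 * #|T| = \sum_t (wt t + clash L psi t))%N.
  rewrite (eq_bigr (fun=> 2%N)); first by rewrite sum_nat_const mulnC.
  by move=> t _; rewrite /wt; case: clash.
rewrite big_split /= -[#|[set t | _]%SET|]sum1_card.
have -> : (\sum_(i in [set t | clash L psi t]%SET) 1 = \sum_t clash L psi t)%N.
  by rewrite big_mkcond; apply: eq_bigr => t _; rewrite inE; case: clash.
rewrite leq_add2r; set V := (_ :\: _)%SET.
rewrite (partition_big psi predT) //= [leqRHS](bigID (mem V)) /=.
apply: leq_trans (leq_addr _ _).
rewrite mulnC -sum_nat_const; apply: leq_sum => v.
rewrite !inE => /andP[vL /imsetP[t _ e]].
rewrite (bigD1 t) /= ?e // {1}/wt; case: (boolP (clash L psi t)) => [|_]; last exact: leq_addr.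
rewrite /clash -e (negbTE vL) /= => /existsP[t' /andP[tt' /eqP e']].
rewrite (bigD1 t') /=; last by rewrite -e' eqxx tt'.
by rewrite -(addn1 1) leq_add // (leq_trans (wt1 t')) ?leq_addr.
Qed.

End Counting.

Section Moment.
Variables (R : realType) (I : finType) (n s q l : nat) (rho : 'I_l -> 'I_n).
Variables (g : {ffun 'I_s -> 'I_n} -> (I -> R) -> R) (D : {ffun 'I_s -> 'I_n} -> {set I}).
Hypotheses (n0 : (0 < n)%N) (bg : forall y, bmf (g y)) (g1 : forall y x, `|g y x| <= 1).
Hypothesis (g_mean : forall y : {ffun 'I_s -> 'I_n}, (forall j u, y j <> rho u) -> forall x, Ulist (enum (D y)) (g y) x = 0).
Hypothesis (g_indep : forall (y y' : {ffun 'I_s -> 'I_n}) i, (forall j u, y j <> rho u) -> (forall j j', y j <> y' j') ->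
  i \in D y -> indep i (g y')).

(* a block whose values meet no other block integrates to 0 on its own *)
Lemma moment_isolated (p : nat) (psi : {ffun 'I_p -> {ffun 'I_s -> 'I_n}}) a :
  (forall j u, psi a j <> rho u) -> (forall b, b != a -> forall j j', psi a j <> psi b j') ->
  Jint (fun x => \prod_b g (psi b) x) = 0.
Proof.
move=> aL ab.
have br : bmf (fun x => \prod_(b | b != a) g (psi b) x) by exact: bmf_prod.
have E : (fun x => \prod_b g (psi b) x) =
    fun x => (\prod_(b | b != a) g (psi b) x) * g (psi a) x.
  by apply/funext => x; rewrite (bigD1 a) //= mulrC.
rewrite E -(@Jint_Ulist _ _ (enum (D (psi a)))); last exact: bmfM.
rewrite UlistMl //; last first.
  move=> i; rewrite mem_enum => iD; apply: indep_prod => b ba.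
  exact: g_indep aL (ab b ba) iD.
rewrite -[RHS](@Jint_cst R I 0); apply: Jint_ext => x.
by rewrite g_mean // mulr0.
Qed.

(* only the tuples of blocks without an isolated one contribute; each of them takes at most
   [2 q s - q] new values *)
Lemma moment : Jint (fun x => avg (fun y => g y x) ^+ (2 * q)) <=
  ((2 * q * s - q + l) ^ (2 * q * s))%:R / (n ^ q)%:R.
Proof.
set p := (2 * q)%N; pose Y := {ffun 'I_s -> 'I_n}.
have cY : #|{: Y}| = (n ^ s)%N by rewrite card_ffun !card_ord.
have E x : avg (fun y => g y x) ^+ p =
    (n ^ s)%:R ^- p * \sum_(psi : {ffun 'I_p -> Y}) \prod_b g (psi b) x.
  rewrite /avg cY exprMn mulrC exprVn; congr (_ * _).
  rewrite -[in LHS](card_ord p) -prodr_const.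
  by rewrite bigA_distr_bigA.
rewrite (Jint_ext E) JintZl; last by apply: bmf_sum => psi _; exact: bmf_prod.
rewrite Jint_sum; last by move=> psi _; exact: bmf_prod.
pose unc (psi : {ffun 'I_p -> Y}) : {ffun 'I_p * 'I_s -> 'I_n} := [ffun t => psi t.1 t.2].
have uncI : injective unc.
  move=> psi psi' e; apply/ffunP => a; apply/ffunP => j.
  by have /ffunP /(_ (a, j)) := e; rewrite !ffunE.
pose L := rho @: [set: 'I_l]%SET.
(* The second condition keeps the subtraction [p * s - q] from being truncated. *)
pose C := [set phi : {ffun 'I_p * 'I_s -> 'I_n} |
   (#|(phi @: [set: 'I_p * 'I_s]) :\: L|%SET <= p * s - q)%N & (q <= p * s)%N]%SET.
have T1 (psi : {ffun 'I_p -> Y}) : Jint (fun x => \prod_b g (psi b) x) <= (unc psi \in C)%:R.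
  have [?|nC] := boolP (unc psi \in C).
    apply: le_trans (_ : Jint (fun=> 1 : R) <= _); last by rewrite Jint_cst.
    apply: le_Jint; [exact: bmf_prod|exact: bmf_cst|move=> x].
    apply: le_trans (ler_norm _) _; rewrite normr_prod.
    by apply: prodr_ile1 => b _; rewrite normr_ge0 g1.
  suff [a [aL ab]] : exists a, (forall j u, psi a j <> rho u) /\
     (forall b, b != a -> forall j j', psi a j <> psi b j').
    by rewrite (moment_isolated aL ab).
  apply: contrapT => no; case/negP: nC.
  have h a : exists j, clash L (unc psi) (a, j).
    apply: contrapT => nj; apply: no; exists a; split=> [j u e|b ba j j' e].
      apply: nj; exists j; apply/orP; left.
      by rewrite ffunE /= e imset_f ?inE.
    apply: nj; exists j; apply/orP; right; apply/existsP; exists (b, j').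
    by rewrite !ffunE /= e eqxx andbT xpair_eqE (negbTE ba).
  have pc : (p <= #|[set t | clash L (unc psi) t]%SET|)%N.
    have jj : injective (fun a => (a, xchoose (h a))) by move=> a b /(congr1 fst).
    rewrite -[X in (X <= _)%N](card_ord p) -cardsT -(card_imset _ jj).
    apply: subset_leq_card; apply/fintype.subsetP => _ /imsetP[a _ ->].
    by rewrite inE; exact: xchooseP (h a).
  have := card_image_clash L (unc psi); rewrite card_prod !card_ord => ci.
  move: pc ci; rewrite inE -/L; move: (#|_ :\: _|%SET) (#|finset _|) => v c pc ci.
  have pE : p = (2 * q)%N by [].
  by move: ci; move: (p * s)%N => m ci; lia.
have cC : (#|C| * n ^ q <= (p * s - q + l) ^ (p * s) * n ^ (p * s))%N.
  have [qp|qp] := leqP q (p * s); last first.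
    rewrite (_ : C = finset.set0) ?cards0 //.
    by apply/setP => phi; rewrite !inE [(q <= _)%N]leqNgt qp andbF.
  rewrite -[X in (_ <= _ * n ^ X)%N](subnK qp) expnD mulnA leq_mul2r; apply/orP; right.
  rewrite mulnC; apply: (@leq_trans (n ^ (p * s - q) * (p * s - q + l) ^ #|{: 'I_p * 'I_s}|)%N).
    apply: leq_trans (card_cover _ _ rho n0); apply: subset_leq_card.
    by apply/fintype.subsetP => phi; rewrite !inE => /andP[].
  by rewrite card_prod !card_ord.
have nR : 0 < n%:R :> R by rewrite ltr0n.
apply: (@le_trans _ _ ((n ^ s)%:R ^- p * (#|C|)%:R)).
  apply: ler_wpM2l; first by rewrite invr_ge0 exprn_ge0.
  apply: le_trans (ler_sum _ (fun psi _ => T1 psi)) _.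
  rewrite -natr_sum ler_nat.
  have -> : (\sum_(psi : {ffun 'I_p -> Y}) (unc psi \in C) = #|[set psi | unc psi \in C]%SET|)%N.
    by rewrite -sum1_card [RHS]big_mkcond; apply: eq_bigr => psi _; rewrite inE; case: (_ \in _).
  rewrite -(card_imset _ uncI); apply: subset_leq_card.
  by apply/fintype.subsetP => _ /imsetP[psi /[!inE] h ->].
rewrite ler_pdivlMr; last by rewrite ltr0n expn_gt0 n0.
rewrite -mulrA mulrC ler_pdivrMr; last by rewrite exprn_gt0 // ltr0n expn_gt0 n0.
by rewrite -natrX -!natrM ler_nat -expnM (mulnC s).
Qed.

End Moment.

Lemma int_lt01 (R : realType) (c : R) : 0 <= c <= 1 -> \int[mu01 R]_t (t < c)%R%:R = c.
Proof.
move=> /andP[c0 c1]; rewrite /Rintegral.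
have mf : measurable_fun setT (EFin \o (fun t : R => (t < c)%R%:R : R)).
  apply/measurable_EFinP.
  have -> : (fun t => (t < c)%R%:R : R) = \1_(`]-oo, c[%classic).
    by apply/funext => t; rewrite indicE mem_setE in_itv /=.
  exact: measurable_indic.
rewrite integral_uniform //.
rewrite subr0 invr1 mul1e -integral_itv_bndo_bndc; last exact: measurable_funTS.
transitivity (fine (\int[lebesgue_measure]_(t in `[0, 1[) (\1_(`[0, c[%classic) t)%:E)).
  congr fine; apply: eq_integral => t; rewrite inE /= in_itv /= => /andP[t0 _].
  by rewrite indicE mem_setE in_itv /= t0.
rewrite integral_indic //= (_ : `[0, c[%classic `&` _ = `[0, c[%classic); last first.
  rewrite eqEsubset; split=> t /=; first by case.
  rewrite !in_itv /= => /andP[h1 h2]; rewrite h1 h2; split=> //.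
  exact: lt_le_trans h2 c1.
rewrite lebesgue_measure_itv /= lte_fin; case: ltP => [_|h] /=; first by rewrite subr0.
by apply/eqP; rewrite eq_le c0 h.
Qed.

Section Idem.
Variables (R : realType) (I : finType).
Implicit Types (f : (I -> R) -> R).

Lemma indep_Ulist_in (i : I) s f : i \in s -> indep i (Ulist s f).
Proof.
elim: s => //= j s IH; rewrite inE => /orP[/eqP ->|/IH h]; first exact: indep_Uint_self.
exact: indep_Uint.
Qed.

Lemma Ulist_absorb s s' f : bmf f -> {subset s' <= s} -> Ulist s (Ulist s' f) = Ulist s f.
Proof.
move=> bf sub; rewrite UlistC // Ulist_id // => i /sub; exact: indep_Ulist_in.
Qed.

End Idem.

Section Sample.
Variables (R : realType) (k : nat) (w : ({set 'I_k} -> R) -> R).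
Hypotheses (jw : jgraphon w) (k0 : (0 < k)%N).
Let bw := jg_bmf jw.

Definition inH n (A : {set 'I_n}) (x : {set 'I_n} -> R) : R := (x A < wE w A x)%R%:R.

Lemma bmf_inH n (A : {set 'I_n}) : bmf (inH A).
Proof. by apply: bmf_lt; [exact: measurable_coord | exact: (bmf_wE A bw).1]. Qed.

Lemma inH01 n (A : {set 'I_n}) x : 0 <= inH A x <= 1.
Proof. by rewrite /inH; case: (_ < _); rewrite ?ler01 ?lexx. Qed.

Lemma indep_wE n (A B : {set 'I_n}) : #|A| = k -> ~~ (B \proper A) -> indep B (wE w A).
Proof. by move=> cA nB; apply: (depon_indep (depon_wE jw cA)); rewrite inE. Qed.

Lemma indep_inH n (A B : {set 'I_n}) : #|A| = k -> ~~ (B \subset A) -> indep B (inH A).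
Proof.
move=> cA nB x t; rewrite /inH indep_wE //; last by apply: contra nB => /proper_sub.
by rewrite /upd; case: eqP nB => // ->; rewrite fintype.subxx.
Qed.

Lemma Uint_inH n (A : {set 'I_n}) : #|A| = k -> Uint A (inH A) = wE w A.
Proof.
move=> cA; apply/funext => x.
rewrite -[RHS]int_lt01; last by rewrite wE_ge0 // wE_le1.
apply: eq_Rintegral => t _; rewrite /inH indep_wE ?fintype.properxx //.
by rewrite /upd eqxx.
Qed.

(** Given the smaller sets, the edges of the sample are independent, each being decided by its own
    coordinate; the own coordinates are integrated first. *)
Lemma Ulist_prod_inH n (S D : {set {set 'I_n}}) : (forall A, A \in S -> #|A| = k) ->
  S \subset D ->
  Ulist (enum D) (fun x => \prod_(A in S) inH A x) =
  Ulist (enum D) (fun x => \prod_(A in S) wE w A x).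
Proof.
move=> cS /fintype.subsetP SD.
have bi : bmf (fun x => \prod_(A in S) inH A x) by apply: bmf_prod => A _; exact: bmf_inH.
rewrite -(Ulist_absorb (s' := enum S) bi); last by move=> A; rewrite !mem_enum; exact: SD.
congr Ulist.
have := @Ulist_prod R _ (enum S) (fun=> 1) (@inH n) (enum_uniq _) (bmf_cst _ _).
have E f (x : {set 'I_n} -> R) : \prod_(A in S) f A x = 1 * \prod_(A <- enum S) f A x :> R.
  by rewrite mul1r big_enum.
have -> : (fun x => \prod_(A in S) inH A x) = fun x => 1 * \prod_(A <- enum S) inH A x.
  by apply/funext => x; rewrite -E.
move=> ->; [|by move=> A; exact: bmf_inH|by []|].
  apply/funext => x; rewrite E; congr (_ * _); apply: eq_big_seq => A.
  by rewrite mem_enum => AS; rewrite Uint_inH // cS.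
move=> A B; rewrite !mem_enum => AS BS AB; apply: indep_inH; first exact: cS.
by apply: contra AB => BA; rewrite eq_sym eqEcard BA (cS _ AS) (cS _ BS) leqnn.
Qed.

(** The coordinates averaged out to centre the block [y]. They do not affect a block with values
    disjoint from [y], even one glued to a fixed [rho] that [y] avoids. *)
Definition meets n s (y : 'I_s -> 'I_n) : {set {set 'I_n}} :=
  [set B : {set 'I_n} | [exists j, y j \in B]]%SET.

Lemma wE_image m n (f : 'I_m -> 'I_n) (A : {set 'I_m}) x :
  injective f -> #|A| = k -> wE w (f @: A) x = wE w A (pull f x).
Proof.
move=> inj cA; have [th [ith E _]] := edge_param cA.
rewrite (wE_inj _ (jg_sym jw) ith E) (@wE_inj _ _ _ _ (f \o th) _ _ (jg_sym jw)); last 2 first.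
- exact: inj_comp.
- by rewrite imset_comp E.
by congr w; apply/funext => B; rewrite /pull imset_comp.
Qed.

Section Hom.
Hypothesis ne : noempty w.
Variables (F : kgraph k) (n : nat).

Definition homH (f : 'I_(nv F) -> 'I_n) (x : {set 'I_n} -> R) : R :=
  \prod_(A in edges F) inH (f @: A) x.

Lemma bmf_homH f : bmf (homH f).
Proof. by apply: bmf_prod => A _; exact: bmf_inH. Qed.

Lemma homH01 f x : 0 <= homH f x <= 1.
Proof.
apply/andP; split; first by apply: prodr_ge0 => A _; have /andP[] := inH01 (f @: A) x.
by apply: prodr_ile1 => A _; exact: inH01.
Qed.

(** By [noempty w] every coordinate involved is a nonempty subset of the image of [f], hence meets
    it. Nothing random is left and the result is a constant. *)
Lemma Ulist_homH f x : injective f -> Ulist (enum (meets f)) (homH f) x = tJ F w.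
Proof.
move=> inj; have ij := imset_inj inj.
pose S := [set f @: (A : {set 'I_(nv F)}) | A in edges F]%SET.
have ES (g : {set 'I_n} -> ({set 'I_n} -> R) -> R) :
    (fun x => \prod_(A in edges F) g (f @: A) x) = fun x => \prod_(A in S) g A x.
  by apply/funext => z; rewrite big_imset //= => A B _ _; exact: ij.
rewrite /homH ES Ulist_prod_inH -?ES; last 2 first.
- by move=> _ /imsetP[A AF ->]; rewrite card_imset // (edge_card AF).
- apply/fintype.subsetP => _ /imsetP[A AF ->]; rewrite inE.
  have /card_gt0P[v vA] : (0 < #|A|)%N by rewrite (edge_card AF).
  by apply/existsP; exists v; rewrite imset_f.
pose P (z : {set 'I_(nv F)} -> R) := \prod_(A in edges F) wE w A z.
have bP : bmf P by exact: bmf_prodE.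
have -> : (fun z => \prod_(A in edges F) wE w (f @: A) z) = fun z => P (pull f z).
  by apply/funext => z; apply: eq_bigr => A AF; rewrite wE_image // (edge_card AF).
rewrite (@Ulist_Jint _ _ _ (meets f)); first exact: Jint_reindex ij bP.
- exact: (bmf_reindex (fun B : {set 'I_(nv F)} => f @: B) bP).
- move=> z z' zz'; apply: eq_bigr => A AF.
  apply: (depon_wE0 jw ne (edge_card AF)) => B; rewrite inE => /andP[_ /set0Pn[v vB]].
  by apply: zz'; rewrite inE; apply/existsP; exists v; rewrite imset_f.
- by move=> B; rewrite mem_enum.
Qed.

Lemma Jint_homH f : injective f -> Jint (homH f) = tJ F w.
Proof.
move=> inj; rewrite -(@Jint_Ulist _ _ (enum (meets f))); last exact: bmf_homH.
by rewrite -[RHS](@Jint_cst R {set 'I_n}); apply: Jint_ext => x; rewrite Ulist_homH.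
Qed.

Definition homdev (f : {ffun 'I_(nv F) -> 'I_n}) (x : {set 'I_n} -> R) : R :=
  if injectiveb f then homH f x - tJ F w else 0.

Lemma tJ01 : 0 <= tJ F w <= 1.
Proof.
have bP := bmf_prodE F jw; apply/andP; split.
  by apply: Jint_ge0 => // x; apply: prodr_ge0 => A _; exact: wE_ge0.
rewrite -[X in _ <= X](@Jint_cst R {set 'I_(nv F)} 1); apply: le_Jint => //; first exact: bmf_cst.
by move=> x; apply: prodr_ile1 => A _; rewrite wE_ge0 // wE_le1.
Qed.

Lemma bmf_homdev f : bmf (homdev f).
Proof.
rewrite /homdev; case: injectiveb; last exact: bmf_cst.
by apply: bmfB; [exact: bmf_homH | exact: bmf_cst].
Qed.

Lemma norm_homdev f x : `|homdev f x| <= 1.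
Proof.
rewrite /homdev; case: injectiveb; last by rewrite normr0 ler01.
have /andP[h0 h1] := homH01 f x; have /andP[t0 t1] := tJ01.
by rewrite ler_norml; apply/andP; split; lra.
Qed.

(** The case [l = 0], [q = 1] of [moment]: all vertices of [F] form one block and no vertex is
    fixed, which gives a variance bound. *)
Lemma moment_hom : (0 < n)%N ->
  Jint (fun x => avg (fun f => homdev f x) ^+ 2) <= ((2 * nv F) ^ (2 * nv F))%:R / n%:R.
Proof.
move=> n0; have rho0 : 'I_0 -> 'I_n by case.
have := @moment R {set 'I_n} n (nv F) 1 0 rho0 homdev (fun f => meets f) n0 bmf_homdev norm_homdev.
have h1 : forall f : {ffun 'I_(nv F) -> 'I_n}, (forall j u, f j <> rho0 u) -> forall x,
    Ulist (enum (meets f)) (homdev f) x = 0.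
  move=> f _ x; rewrite /homdev; case: (boolP (injectiveb f)) => [/injectiveP inj|_].
    by rewrite UlistB ?Ulist_homH ?Ulist_cst ?subrr //; [exact: bmf_homH | exact: bmf_cst].
  by rewrite Ulist_cst.
move=> /(_ h1); rewrite muln1 expn1 => h; apply: le_trans (h _) _.
  move=> f f' B _ ff'; rewrite inE => /existsP[j jB].
  rewrite /homdev; case: (boolP (injectiveb f')) => [/injectiveP inj|_] //.
  move=> x t; congr (_ - _).
  apply: (@indep_prod R {set 'I_n} _ _ (mem (edges F)) B (fun A => inH (f' @: A))) => A AF.
  apply: indep_inH; first by rewrite card_imset // (edge_card AF).
  apply/negP => /fintype.subsetP /(_ _ jB) /imsetP[j' _ e]; exact: ff' e.
apply: ler_wpM2r; first by rewrite invr_ge0.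
by rewrite ler_nat; case: (2 * nv F)%N => // m; rewrite leq_exp2r // addn0 leq_subr.
Qed.
End Hom.
End Sample.

Section DegreeMoment.
Variables (R : realType) (l s : nat).
Notation k := (l + s)%N.
Variable w : ({set 'I_k} -> R) -> R.
Hypotheses (jw : jgraphon w) (s0 : (0 < s)%N).
Let bw := jg_bmf jw.
Let k0 : (0 < k)%N. Proof. by rewrite addn_gt0 s0 orbT. Qed.
Variables (n : nat) (rho : 'I_l -> 'I_n).

Definition degdev (y : {ffun 'I_s -> 'I_n}) (x : {set 'I_n} -> R) : R :=
  if injectiveb (glue rho y) then
    inH w (glue rho y @: [set: 'I_k]%SET) x - degJ l w (pull (glue rho y) x) else 0.

Lemma bmf_degpull th : bmf (fun x : {set 'I_n} -> R => degJ l w (pull th x)).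
Proof. exact: (bmf_pull th (bmf_degJ l bw)). Qed.

Lemma bmf_degdev y : bmf (degdev y).
Proof.
rewrite /degdev; case: injectiveb; last exact: bmf_cst.
by apply: bmfB; [exact: bmf_inH | exact: bmf_degpull].
Qed.

Lemma norm_degdev y x : `|degdev y x| <= 1.
Proof.
rewrite /degdev; case: injectiveb; last by rewrite normr0 ler01.
set A := _ @: _; have /andP[h0 h1] := inH01 w A x.
have /andP[t0 t1] := degJ01 (pull (glue rho y) x) jw.
by rewrite ler_norml; apply/andP; split; lra.
Qed.

Lemma card_glue (y : 'I_s -> 'I_n) : injective (glue rho y) -> #|glue rho y @: [set: 'I_k]%SET| = k.
Proof. by move=> inj; rewrite card_imset // cardsT card_ord. Qed.

Lemma indep_degpull (y y' : 'I_s -> 'I_n) B : (forall j u, y j <> rho u) -> B \in meets y ->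
  indep B (fun x => degJ l w (pull (glue rho y') x)).
Proof.
move=> yr; rewrite inE => /existsP[j jB] x t; apply: degJ_low => C CL; rewrite /pull /upd.
case: eqP => // e; move: jB; rewrite -e => /imsetP[v vC].
have := fintype.subsetP CL _ vC; rewrite in_lowk.
elim/glueP: v vC => [u|j'] _; rewrite ?glue_l ?glue_r; first by move=> _ /yr.
by rewrite /= ltnNge leq_addr.
Qed.

(** Averaging over the sets that meet [y] turns the edge indicator into the degree, which reads only
    subsets of the image of [rho] and is unchanged by the averaging. *)
Lemma degdev_mean (y : {ffun 'I_s -> 'I_n}) : (forall j u, y j <> rho u) -> forall x, Ulist (enum (meets y)) (degdev y) x = 0.
Proof.
move=> yr x; rewrite /degdev; case: (boolP (injectiveb _)) => [/injectiveP inj|_]; last first.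
  by rewrite Ulist_cst.
set th := glue rho y in inj *; set A := _ @: _.
have cA : #|A| = k by exact: card_glue.
have D (C : {set 'I_k}) : (th @: C \in meets y) = (C \in hidx k l).
  rewrite !inE; apply/existsP/subsetPn => [[j /imsetP[v vC e]]|[v vC]].
    exists v => //; move: e; rewrite inE; elim/glueP: v vC => [u|j'] _; rewrite /th ?glue_l ?glue_r.
      by move=> /yr.
    by rewrite -leqNgt /= leq_addr.
  rewrite inE; elim/glueP: v vC => [u|j'] vC; first by rewrite /= ltn_ord.
  by move=> _; exists j'; rewrite -(glue_r rho y j') imset_f.
rewrite UlistB //; [|exact: bmf_inH|exact: bmf_degpull].
have AD : A \in meets y.
  rewrite D inE; apply/subsetPn; exists (rshift l (Ordinal s0)); rewrite ?inE //=.
  by rewrite addn0 ltnn.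
rewrite [X in _ - X x]Ulist_id; last by move=> B; rewrite mem_enum; exact: indep_degpull.
apply/eqP; rewrite subr_eq0; apply/eqP.
have -> : Ulist (enum (meets y)) (inH w A) = Ulist (enum (meets y)) (Ulist [:: A] (inH w A)).
  rewrite Ulist_absorb //; first exact: bmf_inH.
  by move=> B; rewrite mem_seq1 => /eqP ->; rewrite mem_enum.
rewrite /= Uint_inH // -(deg_int x bw inj D).
congr (Ulist _ _ x); apply/funext => z.
exact: wE_inj (jg_sym jw) inj erefl.
Qed.

Lemma moment_deg q : (0 < n)%N ->
  Jint (fun x => avg (fun y => degdev y x) ^+ (2 * q)) <=
    ((2 * q * s - q + l) ^ (2 * q * s))%:R / (n ^ q)%:R.
Proof.
move=> n0.
apply: (@moment R {set 'I_n} n s q l rho degdev (fun y => meets y) n0 bmf_degdev norm_degdev).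
  exact: degdev_mean.
move=> y y' B yr yy' By; rewrite /degdev; case: (boolP (injectiveb _)) => [/injectiveP inj|_] //.
move=> x t; congr (_ - _); last exact: indep_degpull yr By _ _.
apply: indep_inH => //; first exact: card_glue.
move: By; rewrite inE => /existsP[j jB]; apply/negP => /fintype.subsetP /(_ _ jB) /imsetP[v _].
by elim/glueP: v => [u|j']; rewrite ?glue_l ?glue_r; [exact: yr | exact: yy'].
Qed.

End DegreeMoment.

Lemma le_sum1 (R : realType) (T : finType) (f : T -> R) t : (forall t, 0 <= f t) -> f t <= \sum_t f t.
Proof. by move=> f0; rewrite (bigD1 t) //= lerDl; apply: sumr_ge0. Qed.

Section Sampling.
Variables (R : realType) (l s : nat).
Notation k := (l + s)%N.
Variable w : ({set 'I_k} -> R) -> R.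
Hypotheses (jw : jgraphon w) (ne : noempty w) (s0 : (0 < s)%N).
Let bw := jg_bmf jw.
Let k0 : (0 < k)%N. Proof. by rewrite addn_gt0 s0 orbT. Qed.

Section Fixed.
Variables (n : nat) (x : {set 'I_n} -> R).

Definition sedges : {set {set 'I_n}} := [set A : {set 'I_n} | (#|A| == k) && (x A < wE w A x)]%SET.

Lemma sedges_size : [forall A in sedges, #|A| == k].
Proof. by apply/forall_inP => A; rewrite inE => /andP[]. Qed.

Definition sgraph : kgraph k := KGraph sedges_size.

Lemma sedgesE (A : {set 'I_n}) : #|A| = k -> (A \in sedges)%:R = inH w A x.
Proof. by move=> cA; rewrite inE cA eqxx. Qed.

End Fixed.

Lemma card_inj_glue n (rho : 'I_l -> 'I_n) : injective rho ->
  #|[set y : {ffun 'I_s -> 'I_n} | injectiveb (glue rho y)]%SET| = ((n - l) ^_ s)%N.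
Proof.
move=> inj; set L := rho @: [set: 'I_l]%SET.
have cL : #|L| = l by rewrite /L card_imset // cardsT card_ord.
have := card_inj_ffuns_on 'I_s (mem (~: L)%SET).
have cC : #|(~: L)%SET| = (n - l)%N by rewrite cardsCs finset.setCK cL card_ord.
rewrite card_ord cC => <-.
apply: eq_card => y; rewrite !inE.
apply/injectiveP/andP => [ig|[/ffun_onP yon /injectiveP iy]].
  split; last by apply/injectiveP => i j e; apply: (@rshift_inj l); apply: ig; rewrite !glue_r.
  apply/ffun_onP => j; rewrite inE; apply/imsetP => -[u _ e].
  have /eqP : rshift l j = lshift s u by apply: ig; rewrite glue_r glue_l.
  by rewrite eq_sym eq_lrshift.
apply: glue_inj => // u j e; have := yon j; rewrite inE => /negP; apply.
by rewrite -e imset_f ?inE.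
Qed.

Variables (Fam : set (kgraph k)) (c : R).
Hypotheses (Fam0 : forall F, Fam F -> tJ F w = 0).
Hypotheses (hb : forall y, y < c -> below l w y = 0).

(** A single sample has to meet all requirements. The test list [Fs] is a parameter: empty for
    bounds on the codegree, growing with the sample when [W] itself is approximated. *)
Lemma sampling (J : finType) (Fs : J -> kgraph k) (e : R) : 0 < e ->
  \forall n \near \oo, exists G : kgraph k, [/\ nv G = n, kfree Fam G,
    forall L : {set 'I_(nv G)}, #|L| = l -> (c - e) * ('C((nv G - l)%N, s))%:R <= (kdeg L)%:R &
    forall j, `|tG R (Fs j) G - tJ (Fs j) w| <= e].
Proof.
(* Degrees lose [d] in passing to [c'] and a deviation [d], which counts as [2 * d] after division
   by a ratio of at least 1/2. Densities lose [d] by deviation and [d] by noninjective maps. *)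
move=> e0; pose d := e / 4; have d0 : 0 < d by rewrite /d; lra.
pose c' := c - d; have cc : c' < c by rewrite /c'; lra.
pose q := l.+1.
pose K1 : R := ((2 * q * s - q + l) ^ (2 * q * s))%:R / d ^+ (2 * q).
pose K2 : R := \sum_j ((2 * nv (Fs j)) ^ (2 * nv (Fs j)))%:R / d ^+ 2.
pose K3 : R := \sum_j (nv (Fs j) ^ 2)%:R.
near=> n.
have n0 : (0 < n)%N by near: n; exact: nbhs_infty_gt.
have nk : (k <= n)%N by near: n; exact: nbhs_infty_ge.
have nR : 0 < n%:R :> R by rewrite ltr0n.
have hK12 : (K1 + K2) / n%:R <= 1 / 2 by near: n; apply: near_div; lra.
have hK3 : K3 / n%:R <= d by near: n; apply: near_div.
have hr : (k ^ 2 + s ^ 2)%:R / n%:R <= 1 / 2 :> R by near: n; apply: near_div; lra.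
(* Markov's inequality for, in order: the deviation of the degrees from those of [w], low
   degrees in [w], copies of members of [Fam], the deviation of the densities *)
pose B1 (x : {set 'I_n} -> R) : R :=
  \sum_(rho : {ffun 'I_l -> 'I_n}) (avg (fun y => degdev w rho y x) ^+ (2 * q) * (d ^+ (2 * q))^-1).
pose B2 (x : {set 'I_n} -> R) : R := \sum_(th : {ffun 'I_k -> 'I_n})
  (injectiveb th)%:R * (degJ l w (pull th x) < c')%R%:R.
pose B3 (x : {set 'I_n} -> R) : R := \sum_(m < n.+1) \sum_(E : {set {set 'I_m}})
  \sum_(f : {ffun 'I_m -> 'I_n})
   (`[< injective f /\ exists2 F, Fam F & kcode F = existT _ (m : nat) E >])%:R *
   \prod_(A in E) inH w (f @: A) x.
pose B4 (x : {set 'I_n} -> R) : R :=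
  \sum_j (avg (fun f => homdev w (F := Fs j) f x) ^+ 2 * (d ^+ 2)^-1).
have b1 rho : bmf (fun x : {set 'I_n} -> R => avg (fun y => degdev w rho y x) ^+ (2 * q)).
  apply: bmfX; apply: bmfM; last exact: bmf_cst.
  by apply: bmf_sum => y _; exact: bmf_degdev.
have b2 (th : {ffun 'I_k -> 'I_n}) : bmf (fun x : {set 'I_n} -> R =>
     (injectiveb th)%:R * (degJ l w (pull th x) < c')%R%:R : R).
  by apply: bmfM; [exact: bmf_cst|exact: (bmf_pull th (bmf_below l c' bw))].
have b3 (b : R) m (E : {set {set 'I_m}}) (f : {ffun 'I_m -> 'I_n}) :
    bmf (fun x : {set 'I_n} -> R => b * \prod_(A in E) inH w (f @: A) x).
  by apply: bmfM; [exact: bmf_cst|apply: bmf_prod => A _; exact: bmf_inH].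
have b4 j : bmf (fun x : {set 'I_n} -> R => avg (fun f => homdev w (F := Fs j) f x) ^+ 2).
  apply: bmfX; apply: bmfM; last exact: bmf_cst.
  by apply: bmf_sum => f _; exact: bmf_homdev.
have bB1 : bmf B1 by apply: bmf_sum => rho _; apply: bmfM => //; exact: bmf_cst.
have bB2 : bmf B2 by apply: bmf_sum.
have bB3 : bmf B3 by do 3! (apply: bmf_sum => ? _); exact: b3.
have bB4 : bmf B4 by apply: bmf_sum => j _; apply: bmfM => //; exact: bmf_cst.
have d2q (p : nat) : 0 < (d ^+ p)^-1 by rewrite invr_gt0 exprn_gt0.
have J1 : Jint B1 <= K1 / n%:R.
  rewrite Jint_sum; last by move=> rho _; apply: bmfM => //; exact: bmf_cst.
  have -> : K1 / n%:R = \sum_(rho : {ffun 'I_l -> 'I_n})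
     (((2 * q * s - q + l) ^ (2 * q * s))%:R / (n ^ q)%:R * (d ^+ (2 * q))^-1).
    rewrite sumr_const card_ffun !card_ord -mulr_natr /K1 /q expnS natrM.
    have nl : (n ^ l)%:R != 0 :> R by rewrite gt_eqF // ltr0n expn_gt0 n0.
    rewrite invfM; move: (_ ^+ _)^-1 => D; field.
    by rewrite nl gt_eqF.
  apply: ler_sum => rho _.
  under Jint_ext do rewrite mulrC.
  rewrite JintZl // mulrC; apply: ler_wpM2r; first exact: ltW.
  exact: (moment_deg jw s0 rho q n0).
have J2 : Jint B2 = 0.
  rewrite Jint_sum //; apply: big1 => th _; rewrite JintZl; last exact: (bmf_pull th (bmf_below l c' bw)).
  case: (boolP (injectiveb th)) => [/injectiveP inj|_]; last by rewrite mul0r.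
  by rewrite (Jint_reindex (imset_inj inj) (bmf_below l c' bw)) -/(below l w c') hb // mulr0.
have J3 : Jint B3 = 0.
  rewrite Jint_sum; last by move=> m _; do 2! (apply: bmf_sum => ? _); exact: b3.
  apply: big1 => m _; rewrite Jint_sum; last by move=> E _; (apply: bmf_sum => ? _); exact: b3.
  apply: big1 => E _; rewrite Jint_sum; last by move=> f _; exact: b3.
  apply: big1 => f _; rewrite JintZl; last by apply: bmf_prod => A _; exact: bmf_inH.
  case: asboolP => [[inj [F FF cF]]|_]; last by rewrite mul0r.
  rewrite mul1r -(Fam0 FF).
  have gen (u : {m & {set {set 'I_m}}}) (g : 'I_(projT1 u) -> 'I_n) : kcode F = u -> injective g ->
     Jint (fun x => \prod_(A in projT2 u) inH w (g @: A) x) = tJ F w.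
    by move=> eu; case: _ / eu g => g ig; exact: (Jint_homH jw k0 ne ig).
  exact: (gen (existT _ (m : nat) E) f cF inj).
have J4 : Jint B4 <= K2 / n%:R.
  rewrite Jint_sum; last by move=> j _; apply: bmfM => //; exact: bmf_cst.
  rewrite mulr_suml; apply: ler_sum => j _.
  under Jint_ext do rewrite mulrC.
  rewrite JintZl // mulrC mulrAC; apply: ler_wpM2r; first exact: ltW.
  exact: moment_hom.
have [x hx] : exists x : {set 'I_n} -> R, B1 x + B2 x + (B3 x + B4 x) < 1.
  apply: Jint_lt_ex; first by apply: bmfD; exact: bmfD.
  rewrite JintD; [|exact: bmfD|exact: bmfD].
  rewrite !JintD // J2 J3.
  have := lerD J1 J4; rewrite -mulrDl; lra.
have p1 : 0 <= B1 x.
  apply: sumr_ge0 => rho _; apply: mulr_ge0; last exact: ltW.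
  by rewrite exprM exprn_ge0 // sqr_ge0.
have p2 : 0 <= B2 x by apply: sumr_ge0 => th _; rewrite -natrM.
have p3' (b : bool) m (E : {set {set 'I_m}}) (f : {ffun 'I_m -> 'I_n}) :
    0 <= b%:R * \prod_(A in E) inH w (f @: A) x.
  by apply: mulr_ge0 => //; apply: prodr_ge0 => A _; have /andP[] := inH01 w (f @: A) x.
have p3 : 0 <= B3 x by do 3! (apply: sumr_ge0 => ? _); exact: p3'.
have p4 : 0 <= B4 x.
  by apply: sumr_ge0 => j _; apply: mulr_ge0; [exact: sqr_ge0 | exact: ltW].
have small (a : R) p : (0 < p)%N -> a ^+ (2 * p) * (d ^+ (2 * p))^-1 < 1 -> `|a| < d.
  move=> p0; rewrite ltr_pdivrMr ?exprn_gt0 // mul1r => h.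
  rewrite ltNge; apply/negP => da; move: h; apply/negP; rewrite -leNgt.
  have -> : a ^+ (2 * p) = `|a| ^+ (2 * p) by rewrite !exprM real_normK ?num_real.
  by apply: lerXn2r; rewrite ?nnegrE ?(ltW d0).
have x1 (rho : {ffun 'I_l -> 'I_n}) : `|avg (fun y => degdev w rho y x)| < d.
  apply: (small _ q) => //; apply: le_lt_trans (_ : B1 x < 1); last lra.
  apply: (@le_sum1 R _ (fun rho : {ffun 'I_l -> 'I_n} => avg (fun y => degdev w rho y x) ^+ (2 * q) * (d ^+ (2 * q))^-1)).
  move=> r; apply: mulr_ge0; last exact: ltW.
  by rewrite exprM exprn_ge0 // sqr_ge0.
have x2 (th : {ffun 'I_k -> 'I_n}) : injective th -> c' <= degJ l w (pull th x).
  move=> /injectiveP inj; rewrite leNgt; apply/negP => h.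
  have : (1 : R) <= B2 x.
    apply: le_trans (le_sum1 th _); last by move=> t; rewrite -natrM.
    by rewrite inj h mulr1.
  lra.
have x4 j : `|avg (fun f => homdev w (F := Fs j) f x)| < d.
  apply: (small _ 1%N) => //; apply: le_lt_trans (_ : B4 x < 1); last lra.
  apply: (@le_sum1 R _ (fun j => avg (fun f => homdev w (F := Fs j) f x) ^+ 2 * (d ^+ 2)^-1)).
  by move=> i; apply: mulr_ge0; [exact: sqr_ge0 | exact: ltW].
exists (sgraph x); split => //.
(* A copy of [F] makes a term of [B3 x] equal to 1; its code is within the range of the sum because
   [f] embeds the vertices of [F] among [n]. *)
- move=> F FF [f [inj hf]].
  have mn : (nv F < n.+1)%N.
    by rewrite ltnS; have := leq_card f inj; rewrite !card_ord.
  have : (1 : R) <= B3 x.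
    apply: le_trans (le_sum1 (Ordinal mn) _); last by move=> m; do 2! (apply: sumr_ge0 => ? _); exact: p3'.
    apply: le_trans (le_sum1 (edges F) _); last by move=> E; (apply: sumr_ge0 => ? _); exact: p3'.
    apply: le_trans (le_sum1 (finfun f) _); last by move=> g; exact: p3'.
    rewrite asboolT; last by split; [move=> i j; rewrite !ffunE; exact: inj | exists F].
    rewrite mul1r big1 // => A AF.
    rewrite (_ : finfun f @: A = f @: A); last by apply: eq_imset => v; rewrite ffunE.
    rewrite -sedgesE; last by rewrite card_imset // (edge_card AF).
    by rewrite (hf _ AF).
  lra.
- move=> /= L cL; have [rho [irho EL _]] := edge_param cL.
  pose frho : {ffun 'I_l -> 'I_n} := finfun rho.
  have ifr : injective frho by move=> i j; rewrite !ffunE; exact: irho.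
  have EL' : frho @: [set: 'I_l]%SET = L.
    by rewrite -EL; apply: eq_imset => v; rewrite ffunE.
  have V0 : (0 < #|{ffun 'I_s -> 'I_n}|)%N by rewrite card_ffun !card_ord expn_gt0 n0.
  have hd : c' * (((n - l) ^_ s)%:R / (n ^ s)%:R) - d <= dens R (G := sgraph x) frho.
    have -> : ((n - l) ^_ s)%:R / (n ^ s)%:R = avg (fun y : {ffun 'I_s -> 'I_n} => (injectiveb (glue frho y))%:R) :> R.
      rewrite /avg card_ffun !card_ord -(card_inj_glue ifr) -natr_sum; congr (_%:R / _).
      rewrite -sum1_card big_mkcond; apply: eq_bigr => y _; rewrite inE; by case: injectiveb.
    rewrite -avgZl.
    have : avg (fun y : {ffun 'I_s -> 'I_n} => c' * (injectiveb (glue frho y))%:R) +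
           avg (fun y => degdev w frho y x) <= dens R (G := sgraph x) frho.
      rewrite -avgD; apply: le_avg => y; rewrite /degdev.
      case: (boolP (injectiveb _)) => [/injectiveP ig|_]; last by rewrite mulr0 addr0.
      rewrite (_ : (_ \in _)%:R = inH w (glue frho y @: [set: 'I_k]%SET) x); last first.
        by rewrite -sedgesE //; exact: card_glue ig.
      have := x2 (finfun (glue frho y)).
      rewrite (_ : pull _ x = pull (glue frho y) x); last first.
        by apply/funext => B; rewrite /pull; congr x; apply: eq_imset => v; rewrite ffunE.
      move=> /(_ _); rewrite mulr1 => h.
      have : c' <= degJ l w (pull (glue frho y) x).
        by apply: h => i j; rewrite !ffunE; exact: ig.
      lra.
    have := x1 frho; rewrite ltr_norml => /andP[]; lra.
  have : (s`! * kdeg (G := sgraph x) (frho @: [set: 'I_l]%SET))%:R / (n ^ s)%:R =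
     dens R (G := sgraph x) frho by rewrite dens_kdeg.
  rewrite EL' => dE; rewrite -dE in hd.
  have ns : 0 < (n ^ s)%:R :> R by rewrite ltr0n expn_gt0 n0.
  have r1 : 1 / 2 <= ((n - l) ^_ s)%:R / (n ^ s)%:R :> R.
    by apply: le_trans (ffact_sub_ratio R n0 nk); lra.
  have hd2 : (c' - 2 * d) * (((n - l) ^_ s)%:R / (n ^ s)%:R) <=
      (s`! * kdeg (G := sgraph x) L)%:R / (n ^ s)%:R.
    apply: le_trans hd; rewrite mulrBl lerD2l lerN2 -mulrA.
    have : d * (1 / 2) <= d * (((n - l) ^_ s)%:R / (n ^ s)%:R) by apply: ler_wpM2l => //; exact: ltW.
    lra.
  rewrite mulrA ler_pM2r ?invr_gt0 // -bin_ffact mulnC !natrM mulrCA in hd2.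
  rewrite ler_pM2l ?ltr0n ?fact_gt0 // in hd2.
  apply: le_trans hd2; apply: ler_wpM2r => //.
  by rewrite /c' /d; lra.
- move=> j; have V0 : (0 < #|{ffun 'I_(nv (Fs j)) -> 'I_n}|)%N by rewrite card_ffun !card_ord expn_gt0 n0.
  rewrite tG_avg; set t := tJ _ w; have /andP[t0 t1] : 0 <= t <= 1 by exact: tJ01.
  pose P (f : {ffun 'I_(nv (Fs j)) -> 'I_n}) : R := \prod_(A in edges (Fs j)) (f @: A \in sedges x)%:R.
  have P01 f : 0 <= P f <= 1.
    apply/andP; split; first by apply: prodr_ge0.
    by apply: prodr_ile1 => A _; case: (_ \in _); rewrite ?lexx ?ler01.
  have -> : avg P - t = avg (fun f => homdev w (F := Fs j) f x) +
      avg (fun f : {ffun 'I_(nv (Fs j)) -> 'I_n} => (~~ injectiveb f)%:R * (P f - t)).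
    rewrite -avgD -[X in _ - X](avg_cst t V0) -[X in _ + X]mulN1r -avgZl -avgD.
    congr avg; apply/funext => f; rewrite /homdev.
    case: (boolP (injectiveb f)) => [/injectiveP inj|_] /=; last by rewrite mul1r add0r mulN1r.
    rewrite mul0r addr0 mulN1r; congr (_ - _); apply: eq_bigr => A AF.
    by rewrite sedgesE // card_imset // (edge_card AF).
  apply: le_trans (ler_normD _ _) _.
  have h2 : `|avg (fun f : {ffun 'I_(nv (Fs j)) -> 'I_n} => (~~ injectiveb f)%:R * (P f - t))| <= d.
    apply: (@le_trans _ _ (avg (fun f : {ffun 'I_(nv (Fs j)) -> 'I_n} => (~~ injectiveb f)%:R : R))).
      have e1 (f : {ffun 'I_(nv (Fs j)) -> 'I_n}) : `|(~~ injectiveb f)%:R * (P f - t)| <= (~~ injectiveb f)%:R.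
        rewrite normrM ger0_norm //; apply: ler_piMr => //.
        by have /andP[? ?] := P01 f; rewrite ler_norml; apply/andP; split; lra.
      rewrite ler_norml; apply/andP; split.
        rewrite -mulN1r -avgZl; apply: le_avg => f; rewrite mulN1r.
        by have := e1 f; rewrite ler_norml => /andP[].
      by apply: le_avg => f; have := e1 f; rewrite ler_norml => /andP[].
    apply: le_trans (avg_noninj R _ n0) _; apply: le_trans hK3.
    apply: ler_wpM2r; first by rewrite invr_ge0 ltW.
    exact: (@le_sum1 R _ (fun j => (nv (Fs j) ^ 2)%:R)).
  by have := x4 j; rewrite /d in h2 *; lra.
Unshelve. all: by end_near. Qed.

End Sampling.

(** * Codegree densities *)

Lemma bigminn_le (T : eqType) (r : seq T) (P : pred T) (f : T -> nat) d i :
  i \in r -> P i -> (\big[minn/d]_(j <- r | P j) f j <= f i)%N.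
Proof.
elim: r => //= j r IH; rewrite inE big_cons => /orP[/eqP <- ->|/IH h Pi].
  exact: geq_minl.
by case: (P j); [exact: leq_trans (geq_minr _ _) (h Pi) | exact: h].
Qed.

Section MinDegree.
Variable R : realType.

Lemma kmindeg_le k l (G : kgraph k) (L : {set 'I_(nv G)}) : #|L| = l -> (kmindeg l G <= kdeg L)%N.
Proof. by move=> cL; apply: bigminn_le; [rewrite mem_index_enum | rewrite cL]. Qed.

Lemma exists_lset n l : (l <= n)%N -> exists L : {set 'I_n}, #|L| = l.
Proof.
move=> ln; have : (0 < #|[set L : {set 'I_n} | L \subset [set: 'I_n] & #|L| == l]%SET|)%N.
  by rewrite cards_draws cardsT card_ord bin_gt0.
by case/card_gt0P => L; rewrite inE => /andP[_ /eqP]; exists L.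
Qed.

(** The default value of the minimum is the number of edges, which dominates the degree of any
    [l]-set; [l <= nv G] provides one. *)
Lemma kmindeg_ge k l (G : kgraph k) (r : R) : (l <= nv G)%N ->
  (forall L : {set 'I_(nv G)}, #|L| = l -> r <= (kdeg L)%:R) -> r <= (kmindeg l G)%:R.
Proof.
move=> ln h; rewrite /kmindeg; elim/big_ind: _ => [|m p hm hp|L /eqP]; last exact: h.
  have [L cL] := exists_lset ln; apply: (le_trans (h L cL)); rewrite ler_nat.
  by apply: subset_leq_card; apply/fintype.subsetP => A; rewrite inE => /andP[].
by rewrite /minn; case: ltnP.
Qed.

Lemma kdeg_le_bin k l (G : kgraph k) (L : {set 'I_(nv G)}) : (l <= k)%N -> #|L| = l ->
  (kdeg L <= 'C(nv G - l, k - l))%N.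
Proof.
move=> lk cL; rewrite /kdeg.
have cC : #|(~: L)%SET| = (nv G - l)%N by rewrite cardsCs finset.setCK cL card_ord.
rewrite -cC -cards_draws.
set S := finset _.
have inj : {in S &, injective (fun A : {set 'I_(nv G)} => (A :\: L)%SET)}.
  move=> A B; rewrite !inE => /andP[_ LA] /andP[_ LB] e.
  by rewrite -(finset.setID A L) -(finset.setID B L) e (finset.setIidPr LA) (finset.setIidPr LB).
rewrite -(card_in_imset inj); apply: subset_leq_card; apply/fintype.subsetP => _ /imsetP[A + ->].
rewrite !inE => /andP[AG LA]; rewrite finset.setDE finset.subsetIr /=.
by rewrite -finset.setDE cardsD (finset.setIidPr LA) cL (edge_card AG).
Qed.

Section Coex.
Variables (k l : nat) (Fam : set (kgraph k)).
Hypothesis lk : (l < k)%N.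
Hypothesis hFam : forall F : kgraph k, Fam F -> edges F != finset.set0.

Lemma coex_le n : (coex l Fam n <= 'C(n - l, k - l))%N.
Proof. by apply/bigmax_leqP => m _; rewrite -ltnS. Qed.

Lemma edgeless_size n : [forall A in (finset.set0 : {set {set 'I_n}}), #|A| == k].
Proof. by apply/forall_inP => A; rewrite inE. Qed.

Lemma edgeless_free n : kfree Fam (KGraph (edgeless_size n)).
Proof.
move=> F /hFam /set0Pn[A AF] [f [_ /(_ A AF)]].
by rewrite inE.
Qed.

(** The maximum ranges over a nonempty set: members of [Fam] have edges, so the edgeless [k]-graph
    is free and 0 is feasible. *)
Lemma coex_attained n : coex_feasible l Fam n (coex l Fam n).
Proof.
have h0 : `[< coex_feasible l Fam n (@ord0 'C(n - l, k - l)) >].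
  by apply/asboolP; exists (KGraph (edgeless_size n)); split => //; exact: edgeless_free.
rewrite /coex (bigop.bigmax_eq_arg ord0 h0).
by case: arg_maxnP => // m /asboolP.
Qed.

Lemma le_coex (G : kgraph k) m : (l <= nv G)%N -> kfree Fam G ->
  (forall L : {set 'I_(nv G)}, #|L| = l -> (m <= kdeg L)%N) -> (m <= coex l Fam (nv G))%N.
Proof.
move=> ln fr h; have [L cL] := exists_lset ln.
have mC : (m < ('C(nv G - l, k - l)).+1)%N.
  by rewrite ltnS; apply: leq_trans (h L cL) _; exact: kdeg_le_bin (ltnW lk) cL.
apply: (@leq_bigmax_cond _ (fun m : 'I_('C(nv G - l, k - l)).+1 =>
   `[< coex_feasible l Fam (nv G) m >]) (fun m => (m : nat)) (Ordinal mC)).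
by apply/asboolP; exists G.
Qed.

Definition coratio n : R := (coex l Fam n)%:R / ('C((n - l)%N, (k - l)%N))%:R.

Lemma coratio01 n : 0 <= coratio n <= 1.
Proof.
rewrite divr_ge0 //=; have [C0|C0] := posnP 'C(n - l, k - l).
  by rewrite /coratio C0 invr0 mulr0 ler01.
by rewrite ler_pdivrMr ?ltr0n // mul1r ler_nat coex_le.
Qed.

End Coex.

Lemma tG_ge0 k (F G : kgraph k) : 0 <= tG R F G.
Proof. by rewrite divr_ge0. Qed.

Lemma tG_lim0 k (Fam : set (kgraph k)) (F : kgraph k) (FF : set_system nat) (PF : ProperFilter FF)
  (G : nat -> kgraph k) (t : R) :
  (forall n, kfree Fam (G n)) -> Fam F ->
  (forall M : nat, \forall n \near FF, (M <= nv (G n))%N) ->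
  tG R F (G n) @[n --> FF] --> t -> t = 0.
Proof.
move=> fr FF0 big cv; apply/eqP; rewrite eq_le; apply/andP; split; last first.
  apply: (closed_cvg (fun x : R => 0 <= x)) cv; first exact: closed_ge.
  by apply: nearW => n; exact: tG_ge0.
apply/ler_addgt0Pr => e e0; rewrite add0r.
apply: (closed_cvg (fun x : R => x <= e)) cv; first exact: closed_le.
have h1 : \forall n \near FF, (nv F ^ 2)%:R / (nv (G n))%:R <= e by exact: near_nv_div.
apply: filterS (filterI (big 1%N) h1) => n [n0 h].
exact: le_trans (tG_free R n0 (fr n) FF0) h.
Qed.

End MinDegree.

(** * The codegree limit and its extremal hypergraphons *)

Section Main.
Variables (R : realType) (l s : nat).
Notation k := (l + s)%N.
Hypothesis s0 : (0 < s)%N.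
Variable Fam : set (kgraph k).
Hypothesis hFam : forall F : kgraph k, Fam F -> edges F != finset.set0.
Let lk : (l < k)%N. Proof. by rewrite -[X in (X < _)%N]addn0 ltn_add2l. Qed.
Notation a := (coratio R l Fam).

(** The compactness half, for extremal [k]-graphs along any sequence [sig] of orders, so that it can
    be fed a sequence on which the ratios are too large. *)
Lemma hypergraphon_of_coratio (sig : nat -> nat) (c : R) : c <= 1 ->
  (forall M : nat, \forall i \near \oo, (M <= sig i)%N) ->
  (forall e : R, 0 < e -> \forall i \near \oo, c - e <= a (sig i)) ->
  exists W : (rlt k -> R) -> R, [/\ hypergraphon W, Wfree Fam W & (c%:E <= mindegW l W)%E].
Proof.
move=> c1 big hc.
have /choice[G hG] : forall i, exists G : kgraph k, [/\ nv G = sig i, kfree Fam G &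
    forall L : {set 'I_(nv G)}, #|L| = l -> (coex l Fam (sig i) <= kdeg L)%N].
  by move=> i; exact: coex_attained.
have nG i : nv (G i) = sig i by case: (hG i).
have fG i : kfree Fam (G i) by case: (hG i).
have bigG (M : nat) : \forall i \near \oo, (M <= nv (G i))%N.
  by apply: filterS (big M) => i; rewrite nG.
have [U [UU sub]] := @ultraFilterLemma nat \oo _.
have [w [jw cv]] := limit_jgraphon R UU sub bigG.
have bigU (M : nat) : \forall i \near U, (M <= nv (G i))%N by exact: sub (bigG M).
apply: (@fix_empty R k w jw l Fam c lk).
  move=> F FF; exact: (tG_lim0 _ fG FF bigU (cv F)).
apply: (limit_below s0 _ jw c1 bigU _ cv) => e e0.
have h1 : \forall i \near \oo, c - e <= a (sig i) /\ (k <= nv (G i))%N.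
  exact: filterI (hc e e0) (bigG k).
apply: filterS (sub _ h1) => i [hi ki] L cL.
have [_ _ hd] := hG i.
have C0 : 0 < ('C((nv (G i) - l)%N, s))%:R :> R.
  by rewrite ltr0n bin_gt0 leq_subRL ?(leq_trans _ ki) // leq_addr.
apply: (@le_trans _ _ (coex l Fam (sig i))%:R); last by rewrite ler_nat; exact: hd.
by rewrite -ler_pdivlMr // nG; move: hi; rewrite /coratio addKn.
Qed.

Lemma hypergraphon_sampling (W : (rlt k -> R) -> R) (c : R) (J : finType) (Fs : J -> kgraph k) (e : R) :
  hypergraphon W -> Wfree Fam W -> (c%:E <= mindegW l W)%E -> 0 < e ->
  \forall n \near \oo, exists G : kgraph k, [/\ nv G = n, kfree Fam G,
    forall L : {set 'I_(nv G)}, #|L| = l -> (c - e) * ('C((nv G - l)%N, s))%:R <= (kdeg L)%:R &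
    forall j, `|tG R (Fs j) G - tW (Fs j) W| <= e].
Proof.
move=> hW fW /(mindegW_geP hW lk) hb e0.
have F0 F : Fam F -> tJ F (wW W) = 0 by move=> FF; rewrite -tW_tJ //; exact: fW.
have := sampling (wW_jg hW) (@wW_noempty _ _ W) s0 F0 hb Fs e0.
apply: filterS => n [G [nG fG dG hG]]; exists G; split => // j.
by rewrite tW_tJ //; exact: hG.
Qed.

Lemma ratio_le_coratio (G : kgraph k) : (k <= nv G)%N -> kfree Fam G ->
  (kmindeg l G)%:R / ('C((nv G - l)%N, s))%:R <= a (nv G) :> R.
Proof.
move=> kn fG; rewrite /coratio addKn ler_pM2r; last first.
  by rewrite invr_gt0 ltr0n bin_gt0 leq_subRL ?(leq_trans _ kn) // leq_addr.
rewrite ler_nat; apply: le_coex => //; first by rewrite (leq_trans _ kn) // leq_addr.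
by move=> L; exact: kmindeg_le.
Qed.

Lemma ratio_ge (G : kgraph k) (c : R) : (k <= nv G)%N ->
  (forall L : {set 'I_(nv G)}, #|L| = l -> c * ('C((nv G - l)%N, s))%:R <= (kdeg L)%:R) ->
  c <= (kmindeg l G)%:R / ('C((nv G - l)%N, s))%:R.
Proof.
move=> kn h; rewrite ler_pdivlMr; last first.
  by rewrite ltr0n bin_gt0 leq_subRL ?(leq_trans _ kn) // leq_addr.
by apply: kmindeg_ge => //; rewrite (leq_trans _ kn) // leq_addr.
Qed.

(** The sampling half with the empty list of test graphs: only freeness and degrees matter for the
    codegree. *)
Lemma coratio_ge (W : (rlt k -> R) -> R) (c e : R) :
  hypergraphon W -> Wfree Fam W -> (c%:E <= mindegW l W)%E -> 0 < e ->
  \forall n \near \oo, c - e <= a n.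
Proof.
move=> hW fW hc e0.
have := @hypergraphon_sampling W c void (fun v : void => match v with end) e hW fW hc e0.
have k_oo : \forall n \near \oo, (k <= n)%N by exact: nbhs_infty_ge.
move=> h; apply: filterS (filterI k_oo h) => n [kn [G [nG fG dG _]]].
rewrite -nG in kn *; exact: le_trans (ratio_ge kn dG) (ratio_le_coratio kn fG).
Qed.

(** [S] consists of the degree bounds achieved by free hypergraphons. Sampling keeps the ratios from
    falling below its supremum [g] and compactness from exceeding it; knowing then that the ratios
    stay above [g - e], compactness applied once more achieves [g] itself. *)
Lemma gamma_spec : exists g : R, [/\ a @ \oo --> g,
  exists W : (rlt k -> R) -> R, [/\ hypergraphon W, Wfree Fam W & (g%:E <= mindegW l W)%E] &
  forall W : (rlt k -> R) -> R, hypergraphon W -> Wfree Fam W -> (mindegW l W <= g%:E)%E].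
Proof.
pose S : set R := [set c | exists W : (rlt k -> R) -> R,
   [/\ hypergraphon W, Wfree Fam W & (c%:E <= mindegW l W)%E]].
have S0 : S 0.
  apply: (@hypergraphon_of_coratio id) => // [M|e e0]; first exact: nbhs_infty_ge.
  by apply: nearW => n; have /andP[] := coratio01 R l Fam n; lra.
have Sle1 c : S c -> c <= 2.
  move=> [W [hW fW hc]]; have [N _ /(_ N (leqnn N))] := coratio_ge hW fW hc ltr01.
  by have /andP[] := coratio01 R l Fam N; lra.
have supS : has_sup S by split; [exists 0 | exists 2 => c; exact: Sle1].
pose g := sup S.
have leg c : S c -> c <= g by move=> Sc; exact: sup_upper_bound.
have lo (e : R) : 0 < e -> \forall n \near \oo, g - e <= a n.
  move=> e0; have e2 : 0 < e / 2 by lra.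
  have [c Sc hc] := sup_adherent e2 supS; have [W [hW fW hd]] := Sc.
  by apply: filterS (coratio_ge hW fW hd e2) => n; rewrite -/g in hc; lra.
have hi (e : R) : 0 < e -> \forall n \near \oo, a n <= g + e.
  (* Infinitely many ratios above [g + e] would form a sequence [sig] whose limit puts [g + e] into
     [S]. *)
  move=> e0; apply: contrapT => nh.
  have /choice[sig hs] : forall N : nat, exists n, (N <= n)%N /\ g + e < a n.
    move=> N; apply: contrapT => no; apply: nh; exists N => // n Nn.
    by rewrite leNgt; apply/negP => h; apply: no; exists n.
  suff /leg : S (g + e) by lra.
  apply: (@hypergraphon_of_coratio sig).
  - by have [_ h] := hs 0%N; have /andP[] := coratio01 R l Fam (sig 0%N); lra.
  - move=> M; exists M => // i Mi; have [h _] := hs i; exact: leq_trans Mi h.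
  - by move=> d d0; apply: nearW => i; have [_ h] := hs i; lra.
exists g; split.
- apply/cvgrPdist_le => e e0.
  by apply: filterS (filterI (lo e e0) (hi e e0)) => n [h1 h2]; rewrite ler_distlC; apply/andP; split; lra.
- apply: (@hypergraphon_of_coratio id) => // [|M]; last exact: nbhs_infty_ge.
  have hn (e : R) : 0 < e -> g <= 1 + e.
    move=> e0; have [N _ /(_ N (leqnn N))] := lo e e0.
    by have /andP[] := coratio01 R l Fam N; lra.
  by apply/ler_addgt0Pr.
- move=> W hW fW; rewrite leNgt; apply/negP => h.
  (* [mindegW] is extended real, so a real bound above [g] is extracted; [g + 1] serves if the value
     is infinite. *)
  have [c [gc hc]] : exists c : R, g < c /\ (c%:E <= mindegW l W)%E.
    case: (mindegW l W) h => [r| |] // h; first by exists r; split.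
    by exists (g + 1); rewrite ltrDl ltr01 leey.
  by have := leg c; rewrite leNgt gc => /(_ _)/negP; apply => //; exists W.
Qed.

Lemma cvg_coratio : a @ \oo --> gamma R l Fam.
Proof. have [g [cv _ _]] := gamma_spec.
by have -> : gamma R l Fam = g by exact: cvg_lim cv. Qed.

Lemma gamma_attained : exists W : (rlt k -> R) -> R,
  [/\ hypergraphon W, Wfree Fam W & mindegW l W = (gamma R l Fam)%:E].
Proof.
have [g [cv [W [hW fW hg]] ub]] := gamma_spec.
have -> : gamma R l Fam = g by exact: cvg_lim cv.
by exists W; split => //; apply/eqP; rewrite eq_le hg ub.
Qed.

Lemma gamma_max (W : (rlt k -> R) -> R) :
  hypergraphon W -> Wfree Fam W -> (mindegW l W <= (gamma R l Fam)%:E)%E.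
Proof.
have [g [cv _ ub]] := gamma_spec.
have -> : gamma R l Fam = g by exact: cvg_lim cv.
exact: ub.
Qed.

Lemma gamma_le1 : gamma R l Fam <= 1.
Proof.
apply: (closed_cvg (fun x : R => x <= 1)) cvg_coratio; first exact: closed_le.
by apply: nearW => n; have /andP[] := coratio01 R l Fam n.
Qed.

(** The given [W] is already the limit and has no coordinate for the empty set, so the moment
    argument applies along the sequence itself; the reverse inequality is [gamma_max]. *)
Lemma limit_of_Wl (W : (rlt k -> R) -> R) : Wl l Fam W ->
  Wfree Fam W /\ mindegW l W = (gamma R l Fam)%:E.
Proof.
move=> [hW [Gs [fG cv big deg]]].
have cvJ F : tG R F (Gs n) @[n --> \oo] --> tJ F (wW W) by rewrite -tW_tJ //; exact: cv.
have fW : Wfree Fam W.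
  by move=> F FF; rewrite tW_tJ //; exact: (tG_lim0 _ fG FF big (cvJ F)).
split=> //; apply/eqP; rewrite eq_le gamma_max //=; apply/mindegW_geP => //.
apply: (limit_below s0 _ (wW_jg hW) gamma_le1 big _ cvJ) => e e0.
have /cvgrPdist_le/(_ e e0) h := deg.
apply: filterS (filterI (big k) h) => n [kn]; rewrite addKn ler_distlC => /andP[h1 _] L cL.
rewrite -ler_pdivlMr; last by rewrite ltr0n bin_gt0 leq_subRL ?(leq_trans _ kn) // leq_addr.
apply: le_trans h1 _; rewrite ler_pM2r ?ler_nat; first exact: kmindeg_le.
by rewrite invr_gt0 ltr0n bin_gt0 leq_subRL ?(leq_trans _ kn) // leq_addr.
Qed.

(** The sample of index [M] matches the densities of all [k]-graphs with code below [M] up to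
    [1 / (M + 1)]. Each fixed [F] enters the list eventually, which gives convergence by a diagonal
    choice. *)
Lemma Wl_of_limit (W : (rlt k -> R) -> R) : hypergraphon W -> Wfree Fam W ->
  mindegW l W = (gamma R l Fam)%:E -> Wl l Fam W.
Proof.
move=> hW fW hm; set g := gamma R l Fam in hm *.
have gm : (g%:E <= mindegW l W)%E by rewrite hm.
(* Numbers that code no [k]-graph are filled with the edgeless one on no vertices. *)
pose Fs M (j : 'I_M) : kgraph k :=
  if pselect (exists F : kgraph k, pickle (kcode F) = j) is left h then sval (cid h)
  else KGraph (edgeless_size k 0).
have FsE M (F : kgraph k) (h : (pickle (kcode F) < M)%N) : Fs M (Ordinal h) = F.
  rewrite /Fs; case: pselect => [p|[]]; last by exists F.
  by case: cid => F' /= /(pcan_inj pickleK) /kcode_inj.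
have e0 (M : nat) : 0 < M.+1%:R^-1 :> R by rewrite invr_gt0 ltr0n.
have /choice[Gs hG] : forall M, exists G : kgraph k, [/\ (maxn k M <= nv G)%N, kfree Fam G,
    forall L : {set 'I_(nv G)}, #|L| = l -> (g - M.+1%:R^-1) * ('C((nv G - l)%N, s))%:R <= (kdeg L)%:R &
    forall j, `|tG R (Fs M j) G - tW (Fs M j) W| <= M.+1%:R^-1].
  move=> M; have [N _ hN] := hypergraphon_sampling (Fs M) hW fW gm (e0 M).
  have [G [nG fG dG tGG]] := hN (maxn N (maxn k M)) (leq_maxl _ _).
  by exists G; split => //; rewrite nG leq_maxr.
have ng M : (maxn k M <= nv (Gs M))%N by case: (hG M).
have fG M : kfree Fam (Gs M) by case: (hG M).
have big (M : nat) : \forall n \near \oo, (M <= nv (Gs n))%N.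
  by exists M => // n Mn; apply: leq_trans (ng n); rewrite (leq_trans Mn) // leq_maxr.
have kG M : (k <= nv (Gs M))%N by apply: leq_trans (ng M); exact: leq_maxl.
split => //; exists Gs; split => //.
- move=> F; apply/cvgrPdist_le => e e1.
  have h1 : \forall n \near \oo, (pickle (kcode F) < n)%N by exact: nbhs_infty_gt.
  apply: filterS (filterI h1 (near_infty_natSinv_lt (PosNum e1))) => n [hn ne].
  have [_ _ _ /(_ (Ordinal hn))] := hG n; rewrite FsE distrC => h.
  exact: le_trans h (ltW ne).
- rewrite -/g; apply/cvgrPdist_le => e e1.
  (* Sampling bounds the minimum degree only from below; from above it is bounded by the codegree
     ratio at the same order, which tends to [g]. *)
  have cva : (fun n => a (nv (Gs n))) @ \oo --> g.
    have /cvgrPdist_le cv := cvg_coratio; apply/cvgrPdist_le => d d0.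
    by have [N _ hN] := cv d d0; apply: filterS (big N) => n; exact: hN.
  have /cvgrPdist_le/(_ e e1) h1 := cva.
  apply: filterS (filterI h1 (near_infty_natSinv_lt (PosNum e1))) => n [h2 ne].
  have [_ _ dG _] := hG n; move: h2; rewrite addKn !ler_distlC => /andP[_ h2].
  have := ratio_ge (kG n) dG; have := ratio_le_coratio (kG n) (fG n).
  have ne' : n.+1%:R^-1 < e := ne.
  by move=> h3 h4; apply/andP; split; [by apply: le_trans h4; rewrite lerD2l lerN2 ltW |  exact: le_trans h3 h2].
Qed.

End Main.

Theorem theorem5p1 (R : realType) (k l : nat) (Fam : set (kgraph k))
  (hlk : (l < k)%N)
  (hFam : forall F : kgraph k, Fam F -> edges F != finset.set0) :
  [/\ (exists W : (rlt k -> R) -> R,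
         [/\ hypergraphon W, Wfree Fam W & mindegW l W = (gamma R l Fam)%:E]),
      (forall W : (rlt k -> R) -> R,
         hypergraphon W -> Wfree Fam W -> (mindegW l W <= (gamma R l Fam)%:E)%E) &
      (forall W : (rlt k -> R) -> R,
         hypergraphon W ->
         (Wl l Fam W <-> (Wfree Fam W /\ mindegW l W = (gamma R l Fam)%:E)))].
Proof.
(* The edge size is rewritten as [l + s] in the types, the form in which edges are glued from [l]
   fixed and [s] free vertices. *)
have [s ks] : exists s, k = (l + s)%N by exists (k - l)%N; rewrite subnKC // ltnW.
subst k; have s0 : (0 < s)%N by rewrite -(ltn_add2l l) addn0.
split; [exact: gamma_attained | by move=> W; exact: gamma_max |].
move=> W hW; split; first exact: limit_of_Wl.
by move=> [fW hm]; exact: Wl_of_limit.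
Qed.
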